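(* Suppose that $X$ has a countable base of open sets and that $G$ is consistent and positive definite. Let $f\in\mathcal F^+$ with $c^*(f)<+\infty$. For any quasi u.s.c. envelope $f^*$ of $f$ we have $$c^*(f)=c(f^* ),\qquad \Lambda^*(f)=\Lambda(f^* ),\qquad \mathrm M^*(f)=\mathrm M(f^* ),$$ where $\mathrm M(f^* )$ denotes the nonempty vaguely compact convex set of all capacitary measures for $f^*\in\mathcal H_0^*$.
   Context: $X$ is a nonempty locally compact Hausdorff space, $\mathcal M^+$ the set of positive Radon measures on $X$ with the vague topology (coarsest topology making $\mu\mapsto\int\varphi\,d\mu$ continuous for every continuous compactly supported $\varphi$). $G:X\times X\to[0,+\infty]$ is a kernel: lower semicontinuous (l.s.c.), symmetric, and $G(x,x)>0$ for all $x$. For $\mu\in\mathcal M^+$: $G\mu(x)=\int G(x,y)\,d\mu(y)$, $\|\mu\|=(\int G\mu\,d\mu)^{1/2}$; $\mathcal E^+=\{\mu\in\mathcal M^+:\|\mu\|<+\infty\}$, $\mathcal E^+_1=\{\mu\in\mathcal M^+:\|\mu\|\le1\}$. $\mathcal F^+$: all functions $X\to[0,+\infty]$. $\mathcal G$: l.s.c. functions in $\mathcal F^+$. $\mathcal H_0$: finite-valued upper semicontinuous (u.s.c.) functions $X\to[0,+\infty[$ of compact support. $\mathcal C_0^+=\mathcal G\cap\mathcal H_0$. Energy capacity: $c(\varphi)=\max\{\int\varphi\,d\mu:\mu\in\mathcal E_1^+\}$ for $\varphi\in\mathcal C_0^+$; $c(h)=\inf\{c(\varphi):\varphi\in\mathcal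 C_0^+,\varphi\ge h\}$ for $h\in\mathcal H_0$; $c(g)=\sup\{c(\varphi):\varphi\in\mathcal C_0^+,\varphi\le g\}$ for $g\in\mathcal G$. For $f\in\mathcal F^+$: $c_*(f)=\sup\{c(h):h\in\mathcal H_0,h\le f\}$, $c^*(f)=\inf\{c(g):g\in\mathcal G,g\ge f\}$; $c^*(E)=c^*(1_E)$ for $E\subset X$. When $c_*(f)=c^*(f)$ (true for $f\in\mathcal G,\mathcal H_0,\mathcal H_0^*$) the common value is $c(f)$. q.e. means: except on a set $E$ with $c^*(E)=0$. $\mathcal H_0^*$: the set of $f\in\mathcal F^+$ with $\inf\{c^*(f-h):h\in\mathcal H_0,h\le f\}=0$. $f\in\mathcal F^+$ is quasi u.s.c. if for every $\varepsilon>0$ there is $V\subset X$ with $c^*(V)<\varepsilon$ and $f|_{X\setminus V}$ u.s.c. $G$ is consistent if for every $\lambda\in\mathcal E^+$ the function $\mu\mapsto\int G\lambda\,d\mu$ on $\mathcal E^+_1$ is finite and vaguely continuous. $G$ is positive definite if $\int G\mu\,d\nu\le\|\mu\|\,\|\nu\|$ for all $\mu,\nu\in\mathcal E^+$. For $f\in\mathcal F^+$: $\Phi^*(f)=\{\varphi\in\mathcal F^+:\varphi\text{ quasi u.s.c., }\varphi\ge f\text{ q.e.}\}$. A quasi u.s.c. envelope of $f$ is an element $f^*\in\Phi^*(f)$ such that $f^*\le\varphi$ q.e. for every $\varphi\in\Phi^*(f)$; under the present assumptions such envelopes exist, are unique up to equality q.e., and belong to $\mathcal H_0^*$ when $c^*(f)<+\infty$.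 $\Gamma^*(f)=\{\lambda\in\mathcal E^+:G\lambda\ge f\text{ q.e.}\}$, $\gamma^*(f)=\inf\{\|\lambda\|:\lambda\in\Gamma^*(f)\}$, $\Lambda^*(f)=\{\lambda\in\Gamma^*(f):\|\lambda\|=\gamma^*(f)\}$; for $f\in\mathcal H_0^*$, $\Lambda^*(f)$ is written $\Lambda(f)$. $\mathrm M^*(f)$ (upper capacitary measures for $f$): the set of $\mu\in\mathcal E^+$ such that $G\mu\ge f$ q.e. and $G\mu\le f^*$ $\mu$-a.e., where $f^*$ is a chosen quasi u.s.c. envelope of $f$. For $h\in\mathcal H_0^*$, $\mathrm M(h)$ (capacitary measures for $h$) is the set of $\mu\in\mathcal E^+$ maximizing $\nu\mapsto2\int h\,d\nu-\|\nu\|^2$ over $\mathcal E^+$. *)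

(* Defs.v *)
From HB Require Import structures.
From mathcomp Require Import all_boot all_order all_algebra.
From mathcomp Require Import all_classical all_reals all_analysis.

Set Implicit Arguments.
Unset Strict Implicit.
Unset Printing Implicit Defensive.

Import Order.TTheory GRing.Theory Num.Theory.
Import numFieldNormedType.Exports.

Local Open Scope classical_set_scope.
Local Open Scope ring_scope.

Definition has_compact_support (X : topologicalType) (V : nmodType)
    (f : X -> V) : Prop :=
  compact (closure [set x | f x != 0]).

Definition upper_semicontinuous (X : topologicalType) (R : numFieldType)
    (f : X -> \bar R) : Prop :=
  forall x (a : R), (f x < a%:E)%E ->
    exists2 V, nbhs x V & forall y, V y -> (f y < a%:E)%E.

Definition borel (X : ptopologicalType) := g_sigma_algebraType (@open X).

(* [X] is meant to be locally compact Hausdorff. Outer regularity is asked for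
   every set and not only for Borel sets: this has no effect on the Borel sets,
   but fixes the otherwise arbitrary values that a library measure takes on
   non-measurable sets, so that two Radon measures which agree on Borel sets
   are equal. *)
Definition is_radon (R : realType) (X : ptopologicalType)
    (mu : {measure set (borel X) -> \bar R}) : Prop :=
  [/\ forall K : set X, compact K -> (mu K < +oo)%E,
      forall U : set X, open U ->
        mu U = ereal_sup [set mu K | K in [set K : set X |
                                            compact K /\ K `<=` U]] &
      forall A : set X,
        mu A = ereal_inf [set mu U | U in [set U : set X |
                                            open U /\ A `<=` U]]].

Record radon (R : realType) (X : ptopologicalType) := Radon {
  radon_measure :> {measure set (borel X) -> \bar R} ;
  radon_measureP : is_radon radon_measure }.

HB.instance Definition _ (R : realType) (X : ptopologicalType) :=
  gen_eqMixin (radon R X).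
HB.instance Definition _ (R : realType) (X : ptopologicalType) :=
  gen_choiceMixin (radon R X).

Definition test_function (R : realType) (X : topologicalType) : Type :=
  {phi : X -> R | continuous phi /\ has_compact_support phi}.

Definition test_integral (R : realType) (X : ptopologicalType)
    (phi : test_function R X) (mu : radon R X) : R :=
  Rintegral mu setT (sval phi : borel X -> R).

Definition vague (R : realType) (X : ptopologicalType) : Type :=
  @sup_topology (radon R X) (test_function R X)
    (fun phi => Topological.class (initial_topology (test_integral phi))).

HB.instance Definition _ (R : realType) (X : ptopologicalType) :=
  Topological.on (vague R X).
HB.instance Definition _ (R : realType) (X : ptopologicalType) :=
  Topological.copy (radon R X) (vague R X).

Definition convex_radon (R : realType) (X : ptopologicalType)
    (M : set (radon R X)) : Prop :=
  forall mu nu : radon R X, M mu -> M nu ->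
  forall t : R, 0 <= t <= 1 ->
    exists2 rho : radon R X, M rho &
      forall A : set (borel X), measurable A ->
        rho A = (t%:E * mu A + (1 - t)%:E * nu A)%E.

Local Open Scope ereal_scope.

Section Energy.
Context {R : realType} {X : ptopologicalType}.
Variable G : X * X -> \bar R.
Implicit Types (f g h phi : X -> \bar R) (mu nu lambda : radon R X).

Definition is_kernel : Prop :=
  [/\ forall p, 0 <= G p, lower_semicontinuous G,
      forall x y, G (x, y) = G (y, x) & forall x, 0 < G (x, x)].

(* For a nonnegative integrand, the library's integral is a supremum over
   simple Borel functions below it: integrands that are only measurable for
   the completion of [mu], such as the elements of [H0star], are thus
   integrated correctly. *)
Definition rint mu f : \bar R := \int[mu]_(x in [set: borel X]) f x.

Definition potential mu (x : X) : \bar R := rint mu (fun y => G (x, y)).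

Definition enorm mu : \bar R := sqrte (rint mu (potential mu)).

Definition finite_energy : set (radon R X) := [set mu | enorm mu < +oo].

Definition unit_energy : set (radon R X) := [set mu | enorm mu <= 1].

Definition consistent : Prop :=
  forall lambda, finite_energy lambda ->
    (forall mu, unit_energy mu -> rint mu (potential lambda) < +oo) /\
    {within unit_energy, continuous (fun mu => rint mu (potential lambda))}.

Definition positive_definite : Prop :=
  forall mu nu, finite_energy mu -> finite_energy nu ->
    rint nu (potential mu) <= enorm mu * enorm nu.

Definition Fplus : set (X -> \bar R) := [set f | forall x, 0 <= f x].

Definition Glsc : set (X -> \bar R) :=
  [set g | Fplus g /\ lower_semicontinuous g].

Definition H0 : set (X -> \bar R) :=
  [set h | [/\ Fplus h, forall x, h x < +oo, upper_semicontinuous h &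
               has_compact_support h]].

Definition C0plus : set (X -> \bar R) := Glsc `&` H0.

Definition cap_C0 phi : \bar R :=
  ereal_sup [set rint mu phi | mu in unit_energy].

Definition cap_H0 h : \bar R :=
  ereal_inf [set cap_C0 phi | phi in [set phi | C0plus phi /\
                                        forall x, h x <= phi x]].

Definition cap_Glsc g : \bar R :=
  ereal_sup [set cap_C0 phi | phi in [set phi | C0plus phi /\
                                        forall x, phi x <= g x]].

Definition lower_cap f : \bar R :=
  ereal_sup [set cap_H0 h | h in [set h | H0 h /\ forall x, h x <= f x]].

Definition upper_cap f : \bar R :=
  ereal_inf [set cap_Glsc g | g in [set g | Glsc g /\ forall x, f x <= g x]].

Definition upper_cap_set (E : set X) : \bar R :=
  upper_cap (fun x => (\1_E x)%:E).

(* "c(f) is defined and equal to v" *)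
Definition has_cap f (v : \bar R) : Prop := lower_cap f = v /\ upper_cap f = v.

Definition qe (P : X -> Prop) : Prop :=
  exists2 E : set X, upper_cap_set E = 0 & forall x, ~ E x -> P x.

Definition H0star : set (X -> \bar R) :=
  [set f | Fplus f /\
    ereal_inf [set upper_cap (f \- h) | h in [set h | H0 h /\
                                            forall x, h x <= f x]] = 0].

(* The topology of [subspace A] is the relative one on [A] and is discrete
   outside of [A]. *)
Definition quasi_usc f : Prop :=
  Fplus f /\
  forall e : R, (0 < e)%R -> exists2 V : set X, upper_cap_set V < e%:E &
    upper_semicontinuous (f : subspace (~` V) -> \bar R).

Definition Phi_upper f : set (X -> \bar R) :=
  [set phi | quasi_usc phi /\ qe (fun x => f x <= phi x)].

Definition is_envelope f fs : Prop :=
  Phi_upper f fs /\ forall phi, Phi_upper f phi -> qe (fun x => fs x <= phi x).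

Definition Gamma_upper f : set (radon R X) :=
  [set lambda | finite_energy lambda /\ qe (fun x => f x <= potential lambda x)].

Definition gamma_upper f : \bar R :=
  ereal_inf [set enorm lambda | lambda in Gamma_upper f].

Definition Lambda_upper f : set (radon R X) :=
  [set lambda | Gamma_upper f lambda /\ enorm lambda = gamma_upper f].

Definition M_upper f fs : set (radon R X) :=
  [set mu | [/\ finite_energy mu, qe (fun x => f x <= potential mu x) &
                {ae (mu : {measure set (borel X) -> \bar R}),
                  forall x, potential mu x <= fs x}]].

Definition M_cap h : set (radon R X) :=
  [set mu | finite_energy mu /\
    forall nu, finite_energy nu ->
      2%:E * rint nu h - enorm nu ^+ 2 <= 2%:E * rint mu h - enorm mu ^+ 2].

End Energy.

(* Main.v *)
From HB Require Import structures.
Require Import Defs.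
From mathcomp Require Import all_boot all_order all_algebra.
From mathcomp Require Import all_classical all_reals all_analysis.
From mathcomp Require Import measurable_realfun ring lra.
Import Order.TTheory GRing.Theory Num.Theory.
Import numFieldNormedType.Exports.

(* On a vaguely compact energy ball, [mu |-> int h dmu] is vaguely upper
   semicontinuous for [h] in [H0], and also for [h] in [H0star], which [H0]
   approximates from below up to small capacity. So the maximum [c = c(h)] over
   the unit ball is attained, and the capacitary measures for [h] are exactly
   the [mu] with [|mu| <= c] and [int h dmu >= c^2]. Perturbing such a [mu] in
   the direction [nu] gives [int h dnu <= int G mu dnu] for every [nu] of finite
   energy; testing this against measures of the unit ball restricted to compact
   subsets of [{h > G mu}] yields [h <= G mu] q.e. when [h] is quasi u.s.c.

   By consistency every [G lambda] with [lambda] of finite energy is quasi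
   u.s.c. and lies in [H0star]. Passing to the limit in the capacitary measures
   of an increasing sequence of test functions, any l.s.c. [g] with
   [c(g) < +oo] satisfies [g <= G lambda] q.e. with [|lambda| <= c(g)]. Hence
   an envelope [fs] of [f] lies q.e. below every [G lambda] that is q.e. above
   [f]: this gives [Gamma_upper f = Gamma_upper fs] and [c*(fs) <= c*(f)],
   because [c*(G lambda) <= |lambda|] by positive definiteness, and it puts
   [fs] in [H0star]. Finally [mu] is capacitary for [fs] iff [fs <= G mu] q.e.
   and [int fs dmu = int G mu dmu], i.e. iff moreover [G mu <= fs] mu-a.e.

   The compactness of energy balls follows from the Riesz representation
   theorem, which is obtained by a Daniell extension, and from [G(x,x) > 0]. *)

(** Elements of [H0star], and envelopes in particular, need not be Borel, so their integrals are
    lower integrals. Lower bounds for these follow from monotonicity. Upper bounds must pass through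
    Borel majorants: [h] in [H0star] is bounded by [k + g] with [k] in [H0] and [g] l.s.c. of small
    capacity.

    The formula of [cap_C0], a supremum of integrals over the unit ball, makes sense for every
    nonnegative function and serves throughout as the capacity [c]. Homogeneity gives
    [int h dnu <= c |nu|] for every [nu] of finite energy, hence [2 int h dnu - |nu|^2 <= 2 c |nu| -
    |nu|^2 <= c^2]; this is where the description of capacitary measures by [c] comes from.

    The energy is quadratic in the measure, while vague convergence controls one linear integral at
    a time. Second countability writes [G] as an increasing limit of finite maxima of products
    [a(x) b(y)]; the potentials of such maxima are controlled by finitely many integrals, so they
    converge locally uniformly along a vaguely convergent filter. Filters stand in for subsequences
    wherever a limit measure is extracted. *)

Local Open Scope classical_set_scope.
Local Open Scope ring_scope.

Set Implicit Arguments.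
Unset Strict Implicit.
Unset Printing Implicit Defensive.

(** * Functions of compact support and semicontinuous functions *)

Section Compactness.
Context {T : topologicalType}.

(** If [P K] failed, the sets [A] with [P (K \ A)] would form a proper filter containing [K]; a
    cluster point of it in [K] contradicts the local hypothesis there. *)
Lemma compact_local_ind (K : set T) (P : set T -> Prop) :
  compact K -> P set0 ->
  (forall A B, A `<=` B -> P B -> P A) ->
  (forall A B, P A -> P B -> P (A `|` B)) ->
  (forall x, K x -> exists2 N, nbhs x N & P (N `&` K)) -> P K.
Proof.
move=> cK P0 PS PU PN; apply: contrapT => nPK.
pose F : set_system T := [set A | P (K `\` A)].
have FF : ProperFilter F.
  split; first by rewrite /F /= setD0.
  split.
  - by rewrite /F/= setDT.
  - by move=> A B PA PB; rewrite /F/= setDIr; exact: PU.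
  - by move=> A B AB; apply: PS; exact: setDS.
have [x [Kx clx]] : K `&` cluster F !=set0 by apply: cK => //; rewrite /F/= setDv.
have [N Nx PNx] := PN _ Kx.
have [y [nNy Ny]] : (~` N) `&` N !=set0.
  by apply: clx => //; apply: PS PNx => z [Kz /contrapT].
by [].
Qed.

(** The form of compactness behind every Dini argument below. Openness is asked only relative to
    [K], because consistency gives continuity only within the unit ball. *)
Lemma compact_increasing_cover (K : set T) (P : nat -> set T) :
  compact K -> (forall n, P n `<=` P n.+1) ->
  (forall n x, K x -> P n x -> exists2 N, nbhs x N & N `&` K `<=` P n) ->
  (forall x, K x -> exists n, P n x) ->
  exists n, K `<=` P n.
Proof.
move=> cK Pinc Pop Pcov.
have Pmon m n : (m <= n)%N -> P m `<=` P n.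
  move=> /subnK <-; elim: (n - m)%N => // k IH.
  by rewrite addSn; apply: subset_trans (Pinc _).
apply: (compact_local_ind (P := fun A => exists n, A `<=` P n)) => //.
- by exists 0%N.
- by move=> A B AB [n Bn]; exists n; exact: subset_trans Bn.
- move=> A B [m Am] [n Bn]; exists (maxn m n) => x [/Am|/Bn].
  + by apply: Pmon; exact: leq_maxl.
  + by apply: Pmon; exact: leq_maxr.
- move=> x Kx; have [n Pnx] := Pcov _ Kx.
  by have [N Nx NP] := Pop _ _ Kx Pnx; exists N => //; exists n.
Qed.

End Compactness.

Section CompactSupport.
Context {R : realType} {X : topologicalType}.
Implicit Types (u v : X -> R).

Definition Cc : set (X -> R) :=
  [set u | continuous u /\ has_compact_support u].

Lemma compact_supportP (V : nmodType) (f : X -> V) :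
  has_compact_support f -> exists2 K, compact K & forall x, ~ K x -> f x = 0.
Proof.
move=> cf; exists (closure [set x | f x != 0]) => // x nKx.
by apply/eqP; apply: contrapT => fx; apply: nKx; apply: subset_closure; apply/negP.
Qed.

Hypothesis hX : hausdorff_space X.

Lemma has_compact_supportW (V : nmodType) (f : X -> V) (K : set X) :
  compact K -> (forall x, ~ K x -> f x = 0) -> has_compact_support f.
Proof.
move=> cK fK; apply: (subclosed_compact _ cK); first exact: closed_closure.
have /closure_id -> := compact_closed hX cK.
apply: closureS => x /= /eqP fx; apply: contrapT => nK; apply: fx; exact: fK.
Qed.

Lemma Cc_comp2 (op : R -> R -> R) u v :
  Cc u -> Cc v -> op 0 0 = 0 -> continuous (fun x => op (u x) (v x)) ->
  Cc (fun x => op (u x) (v x)).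
Proof.
move=> [_ /compact_supportP[K cK uK]] [_ /compact_supportP[L cL vL]] op0 cop.
split=> //; apply: (@has_compact_supportW _ _ (K `|` L)); first exact: compactU.
by move=> x nKL; rewrite uK ?vL // => ?; apply: nKL; [right|left].
Qed.

Lemma CcD u v : Cc u -> Cc v -> Cc (fun x => u x + v x).
Proof.
by move=> cu cv; apply: Cc_comp2 => //; rewrite ?addr0// => x;
   apply: continuousD; [apply: cu.1|apply: cv.1].
Qed.

Lemma CcB u v : Cc u -> Cc v -> Cc (fun x => u x - v x).
Proof.
by move=> cu cv; apply: (Cc_comp2 (op := fun a b => a - b)) => //; rewrite ?subr0// => x;
   apply: continuousB; [apply: cu.1|apply: cv.1].
Qed.

Lemma Cc_max u v : Cc u -> Cc v -> Cc (fun x => Num.max (u x) (v x)).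
Proof.
by move=> cu cv; apply: Cc_comp2 => //; rewrite ?maxxx// => x;
   apply: continuous_max; [apply: cu.1|apply: cv.1].
Qed.

Lemma Cc0 : Cc (fun=> 0).
Proof.
split; first by move=> x; exact: cvg_cst.
by apply: (has_compact_supportW (K := set0)) => //; exact: compact0.
Qed.

Lemma CcZ (c : R) u : Cc u -> Cc (fun x => c * u x).
Proof.
move=> cu; apply: (Cc_comp2 (op := fun a b => c * a) cu Cc0); rewrite ?mulr0// => x.
by apply: continuousM; [exact: cvg_cst|exact: cu.1].
Qed.

Lemma Cc_min_cst u (c : R) : 0 <= c -> Cc u -> Cc (fun x => Num.min (u x) c).
Proof.
move=> c0 cu; apply: (Cc_comp2 (op := fun a b => Num.min a c) cu Cc0).
  exact/min_idPl.
by move=> x; apply: continuous_min; [exact: cu.1|exact: cvg_cst].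
Qed.

Lemma Cc_pos u : Cc u -> Cc (fun x => Num.max (u x) 0).
Proof. by move=> cu; exact: Cc_max Cc0. Qed.

Lemma Cc_bounded u : Cc u -> exists2 M : R, 0 <= M & forall x, `|u x| <= M.
Proof.
move=> [cu /compact_supportP[K cK uK]].
suff [M MK] : exists M : R, forall x, K x -> `|u x| <= M.
  exists (Num.max M 0); first by rewrite le_max lexx orbT.
  move=> x; have [/MK Kx|/uK ->] := pselect (K x).
    by rewrite le_max Kx.
  by rewrite normr0 le_max lexx orbT.
apply: (compact_local_ind (P := fun A => exists M : R, forall x, A x -> `|u x| <= M) cK).
- by exists 0.
- by move=> A B AB [M MB]; exists M => x /AB/MB.
- move=> A B [M MA] [N NB]; exists (Num.max M N) => x [/MA|/NB] H;
  by rewrite le_max H ?orbT.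
- move=> x Kx; have := cu x => /cvgrPdist_le/(_ _ ltr01) ux.
  exists [set y | `|u x - u y| <= 1] => //.
  exists (`|u x| + 1) => y [/= uy _].
  by have := ler_normB (u x) (u x - u y);
  rewrite opprB addrCA subrr addr0 => /le_trans; apply; rewrite lerD2l.
Qed.

End CompactSupport.
Arguments Cc : clear implicits.

Section LscApproximation.
Context {R : realType} {X : topologicalType}.
Implicit Types (u v : X -> R) (K U : set X).
Hypothesis hX : hausdorff_space X.
Hypothesis lX : locally_compact [set: X].

Lemma point_bump (x : X) U : open U -> U x ->
  exists u : X -> R, [/\ Cc R X u, forall y, 0 <= u y <= 1,
    \forall y \near x, u y = 1 & forall y, ~ U y -> u y = 0].
Proof.
move=> oU Ux.
have [W Wx [cW clW]] : exists2 W, nbhs x W & compact W /\ closed W.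
  by have [W] := lX (x := x) I; rewrite withinET => Wx WP; exists W.
pose V := U `&` interior W.
have oV : open V by apply: openI => //; exact: open_interior.
have Vx : V x by split.
have := @locally_compact_completely_regular X R lX hX x (~` V) (open_closedC oV) (fun H => H Vx).
move=> /(@uniform_separatorP _ R)[f [cf f01 fx fV]].
have fE y : 0 <= f y <= 1.
  by have := f01 (f y) (ex_intro2 _ _ y I erefl); rewrite /= in_itv.
have fx0 : f x = 0 by apply: fx; exists x.
have fV1 y : ~ V y -> f y = 1 by move=> Vy; apply: fV; exists y.
(* The separating function vanishes at [x] only; doubling [1 - f] and truncating at 1 gives the
   value 1 on the whole neighbourhood where [f <= 1/2]. *)
pose u y : R := Num.min (2 * (1 - f y)) 1.
have cu : continuous u.
  move=> y; apply: (@continuous_min R X (fun y => 2 * (1 - f y)) (fun=> 1)).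
    2: exact: cvg_cst.
  by apply: continuousM; [exact: cvg_cst|apply: continuousB; [exact: cvg_cst|exact: cf]].
have uV y : ~ V y -> u y = 0.
  by move=> /fV1 fy; rewrite /u fy subrr mulr0; apply/min_idPl.
exists u; split.
- split=> //; apply: (has_compact_supportW hX cW) => y nW; apply: uV => -[_].
  by move/interior_subset.
- move=> y; have /andP[f0 f1] := fE y.
  rewrite /u le_min ge_min lexx orbT ler01 mulr_ge0// ?subr_ge0//.
- have : \forall y \near x, `|f x - f y| <= 1/2.
    by have := cf x => /cvgrPdist_le; apply; rewrite divr_gt0.
  apply: filterS => y; rewrite fx0 sub0r normrN => fy.
  have /andP[f0 _] := fE y.
  move: fy; rewrite ger0_norm// => fy; apply/min_idPr; lra.
- by move=> y nU; apply: uV => -[].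
Qed.

Lemma compact_bump K U : compact K -> open U -> K `<=` U ->
  exists u : X -> R, [/\ Cc R X u, forall y, 0 <= u y <= 1,
    forall y, K y -> u y = 1 & forall y, ~ U y -> u y = 0].
Proof.
move=> cK oU KU.
apply: (compact_local_ind (P := fun A => exists u : X -> R, [/\ Cc R X u, forall y, 0 <= u y <= 1,
    forall y, A y -> u y = 1 & forall y, ~ U y -> u y = 0]) cK).
- exists (fun=> 0); split => //; first exact: Cc0.
  by move=> y; rewrite lexx ler01.
- by move=> A B AB [u [cu u01 uB uU]]; exists u; split => // y /AB/uB.
- move=> A B [u [cu u01 uA uU]] [v [cv v01 vB vU]].
  exists (fun x => Num.max (u x) (v x)); split.
  + exact: Cc_max.
  + move=> y; rewrite le_max ge_max.
    by have /andP[-> ->] := u01 y; have /andP[-> ->] := v01 y.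
  + move=> y [/uA ->|/vB ->].
    * by apply/max_idPl; have /andP[_] := v01 y.
    * by apply/max_idPr; have /andP[_] := u01 y.
  + by move=> y nU; rewrite uU// vU// maxxx.
- move=> x /KU Ux; have [u [cu u01 ux uU]] := point_bump oU Ux.
  by exists [set y | u y = 1] => //; exists u; split => // y [].
Qed.

Hypothesis sX : @second_countable X.

Lemma countable_basis : exists B : nat -> set X,
  forall (x : X) N, nbhs x N -> exists n, B n x /\ B n `<=` N.
Proof.
have [B /pfcard_geP [->|[f]] [_ bB]] := sX.
  exists (fun=> set0) => x N xN; by have [? []] := bB x N xN.
exists (fun n => f n) => x N xN; have [U /= [BU Ux] UN] := bB x N xN.
have [n _ fn] := @surj _ _ _ _ f U BU.
by exists n; rewrite fn.
Qed.

(* A countable family of minorants: one for each basic open set and each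
   rational lower bound on it, whenever there is one. *)
Lemma lsc_countable_minorants (g : X -> \bar R) :
  (forall x, 0 <= g x)%E -> lower_semicontinuous g ->
  exists v : nat -> X -> R, [/\ forall n, Cc R X (v n),
    forall n x, 0 <= v n x, forall n x, ((v n x)%:E <= g x)%E &
    forall x (a : R), (a%:E < g x)%E -> exists n, a < v n x].
Proof.
move=> g0 lg; have [B bB] := countable_basis.
pose good (i : nat * rat) (u : X -> R) := [/\ Cc R X u, forall x, 0 <= u x,
  forall x, ((u x)%:E <= g x)%E & forall x, B i.1 x -> ratr i.2 <= u x].
have ex i : exists u : X -> R, [/\ Cc R X u, forall x, 0 <= u x,
    forall x, ((u x)%:E <= g x)%E & (exists u', good i u') -> good i u].
  have [[u gu]|H] := pselect (exists u, good i u).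
    by have [? ? ? ?] := gu; exists u.
  by exists (fun=> 0); split => //; exact: Cc0.
pose v' i := projT1 (cid (ex i)).
have v'P i := projT2 (cid (ex i)).
pose v n := if unpickle n is Some i then v' i else fun=> 0.
have vP n : [/\ Cc R X (v n), forall x, 0 <= v n x & forall x, ((v n x)%:E <= g x)%E].
  rewrite /v; case: unpickle => [i|]; last by split => //; exact: Cc0.
  by have [] := v'P i.
exists v; split; try by move=> n; have [] := vP n.
move=> x a ag.
have [a0|a0] := ltP a 0.
  by exists 0%N; apply: (lt_le_trans a0); have [_ ->] := vP 0%N.
have [b [ab bg]] : exists b, a < b /\ (b%:E < g x)%E.
  case: (g x) ag => [r||]; rewrite ?lte_fin//.
  - move=> ar; exists ((a + r) / 2); rewrite lte_fin; split; lra.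
  - by exists (a + 1); rewrite ltry; split => //; rewrite ltrDl.
(* [q] only indexes the countable family. The minorant exhibited is [b] times a bump, which is at
   least [q > a] on a basic neighbourhood of [x]. *)
have [q /=] := rat_in_itvoo ab; rewrite in_itv/= => /andP[aq qb].
have bg0 : 0 <= b by apply: ltW; exact: le_lt_trans ab.
have oU : open [set y | (b%:E < g y)%E] by have /lower_semicontinuousP := lg; apply.
have [u [cu u01 ux uU]] := point_bump oU bg.
have [n [Bnx Bnu]] := bB x _ ux.
have gn : good (n, q) (fun y => b * u y).
  split.
  - exact: CcZ.
  - by move=> y; rewrite mulr_ge0//; have /andP[] := u01 y.
  - move=> y; have [|/negP] := boolP (b%:E < g y)%E.
      move/ltW; apply: le_trans; rewrite lee_fin ler_piMr//.
      by have /andP[] := u01 y.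
    by move/uU => ->; rewrite mulr0.
  - by move=> y /Bnu /= ->; rewrite mulr1 ltW.
exists (pickle (n, q)); rewrite /v pickleK.
have [_ _ _ H] := v'P (n, q).
have [_ _ _ /(_ x Bnx)] := H (ex_intro _ _ gn).
by apply: lt_le_trans.
Qed.

(** Starting from 0 makes the running maximum nonnegative whatever [v] is; the index is shifted, so
    stage [n] uses only [v 0], ..., [v (n-1)]. *)
Fixpoint cumul_max (T : Type) (v : nat -> T -> R) n : T -> R :=
  if n is m.+1 then fun x => Num.max (cumul_max v m x) (v m x) else fun=> 0.

Lemma cumul_max_ge0 T (v : nat -> T -> R) n x : 0 <= cumul_max v n x.
Proof. by elim: n => //= n IH; rewrite le_max IH. Qed.

Lemma cumul_max_le T (v : nat -> T -> R) n x : cumul_max v n x <= cumul_max v n.+1 x.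
Proof. by rewrite /= le_max lexx. Qed.

Lemma le_cumul_max T (v : nat -> T -> R) n x : v n x <= cumul_max v n.+1 x.
Proof. by rewrite /= le_max lexx orbT. Qed.

Lemma cumul_max_lee T (v : nat -> T -> R) (c : T -> \bar R) x : (0 <= c x)%E ->
  (forall n, ((v n x)%:E <= c x)%E) -> forall n, ((cumul_max v n x)%:E <= c x)%E.
Proof.
move=> c0 vc; elim=> //= n IH; rewrite EFin_max; by rewrite ge_max IH vc.
Qed.

Lemma lsc_approx (g : X -> \bar R) :
  (forall x, 0 <= g x)%E -> lower_semicontinuous g ->
  exists u : nat -> X -> R, [/\ forall n, Cc R X (u n),
    forall n x, 0 <= u n x, forall n x, u n x <= u n.+1 x,
    forall n x, ((u n x)%:E <= g x)%E &
    forall x (a : R), (a%:E < g x)%E -> exists n, a < u n x].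
Proof.
move=> g0 lg; have [v [cv v0 vg vlim]] := lsc_countable_minorants g0 lg.
exists (cumul_max v); split.
- elim=> [|n IH]; first exact: Cc0.
  exact: Cc_max.
- by move=> n x; exact: cumul_max_ge0.
- by move=> n x; exact: cumul_max_le.
- by move=> n x; apply: cumul_max_lee.
- move=> x a /vlim[n an]; exists n.+1; exact: lt_le_trans (le_cumul_max _ _ _).
Qed.

(** Minorants of product form are wanted, rather than test functions on [X * X]: integrating one in
    the second variable leaves a test function on [X] whose dependence on the measure is a single
    number. *)
Lemma kernel_approx (G : X * X -> \bar R) :
  (forall p, 0 <= G p)%E -> lower_semicontinuous G ->
  exists a b : nat -> X -> R, [/\
    forall n, Cc R X (a n) /\ Cc R X (b n),
    forall n x, 0 <= a n x /\ 0 <= b n x,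
    forall n p, ((a n p.1 * b n p.2)%:E <= G p)%E &
    forall p (c : R), (c%:E < G p)%E -> exists n, c < a n p.1 * b n p.2].
Proof.
move=> G0 lG; have [B bB] := countable_basis.
pose good (i : nat * nat * rat) (u : (X -> R) * (X -> R)) :=
  [/\ Cc R X u.1 /\ Cc R X u.2, forall x, 0 <= u.1 x /\ 0 <= u.2 x,
  forall p, ((u.1 p.1 * u.2 p.2)%:E <= G p)%E &
  forall p, B i.1.1 p.1 -> B i.1.2 p.2 -> ratr i.2 <= u.1 p.1 * u.2 p.2].
have ex i : exists u : (X -> R) * (X -> R),
   [/\ Cc R X u.1 /\ Cc R X u.2, forall x, 0 <= u.1 x /\ 0 <= u.2 x,
    forall p, ((u.1 p.1 * u.2 p.2)%:E <= G p)%E & (exists w, good i w) -> good i u].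
  have [[w gw]|H] := pselect (exists w, good i w).
    by have [? ? ? ?] := gw; exists w.
  exists (fun=> 0, fun=> 0); split => //=; first by split; exact: Cc0.
  by move=> p; rewrite mulr0.
pose v' i := projT1 (cid (ex i)).
have v'P i := projT2 (cid (ex i)).
pose v n : (X -> R) * (X -> R) := if unpickle n is Some i then v' i else (fun=> 0, fun=> 0).
have vP n : [/\ Cc R X (v n).1 /\ Cc R X (v n).2, forall x, 0 <= (v n).1 x /\ 0 <= (v n).2 x &
    forall p, (((v n).1 p.1 * (v n).2 p.2)%:E <= G p)%E].
  rewrite /v; case: unpickle => [i|]; first by have [] := v'P i.
  split => //=; first by split; exact: Cc0.
  by move=> p; rewrite mulr0.
exists (fun n => (v n).1), (fun n => (v n).2); split; try by move=> n; have [] := vP n.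
move=> p a ag.
have [a0|a0] := ltP a 0.
  exists 0%N; apply: (lt_le_trans a0); have [_ H _] := vP 0%N.
  by apply: mulr_ge0; [exact: (H p.1).1|exact: (H p.2).2].
have [b [ab bg]] : exists b, a < b /\ (b%:E < G p)%E.
  case: (G p) ag => [r||]; rewrite ?lte_fin//.
  - move=> ar; exists ((a + r) / 2); rewrite lte_fin; split; lra.
  - by exists (a + 1); rewrite ltry; split => //; rewrite ltrDl.
have [q /=] := rat_in_itvoo ab; rewrite in_itv/= => /andP[aq qb].
have bg0 : 0 <= b by apply: ltW; exact: le_lt_trans ab.
have : nbhs p [set y | (b%:E < G y)%E].
  by have [V Vp VG] := lG _ _ bg; apply: filterS Vp.
case=> -[/= U1 U2] [].
rewrite !nbhsE => -[V1 [oV1 V1p] V1U] [V2 [oV2 V2p] V2U] UG.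
have [u1 [cu1 u101 u1x u1U]] := point_bump oV1 V1p.
have [u2 [cu2 u201 u2x u2U]] := point_bump oV2 V2p.
have [n1 [Bn1x Bn1u]] := bB _ _ u1x.
have [n2 [Bn2x Bn2u]] := bB _ _ u2x.
have gn : good (n1, n2, q) (fun y => b * u1 y, u2).
  split => //=.
  - by split => //; exact: CcZ.
  - move=> y; rewrite mulr_ge0//; first by have /andP[] := u201 y.
    by have /andP[] := u101 y.
  - move=> y; have [[V1y V2y]|] := pselect (V1 y.1 /\ V2 y.2).
      have /ltW : (b%:E < G y)%E.
        have -> : y = (y.1, y.2) by case: y {V1y V2y}.
        by apply: UG; split; [exact: V1U|exact: V2U].
      apply: le_trans; rewrite lee_fin -mulrA ler_piMr//.
      have /andP[? ?] := u101 y.1; have /andP[? ?] := u201 y.2.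
      by rewrite mulr_ile1.
    move/not_andP => -[/u1U ->|/u2U ->]; by rewrite ?(mulr0, mul0r).
  - by move=> y /Bn1u /= -> /Bn2u ->; rewrite !mulr1 ltW.
exists (pickle (n1, n2, q)); rewrite /v pickleK.
have [_ _ _ H] := v'P (n1, n2, q).
have [_ _ _ /(_ p Bn1x Bn2x)] := H (ex_intro _ _ gn).
by apply: lt_le_trans.
Qed.

End LscApproximation.

(** * The lower integral with respect to a Borel measure *)

Section BorelIntegral.
Context {R : realType} {X : ptopologicalType}.
Implicit Types (f g h : X -> \bar R) (u v : X -> R).
Local Open Scope ereal_scope.

Lemma open_borel (U : set X) : open U -> measurable (U : set (borel X)).
Proof. by move=> oU; apply: sub_sigma_algebra. Qed.

Lemma closed_borel (F : set X) : closed F -> measurable (F : set (borel X)).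
Proof.
move=> cF; rewrite -(setCK F); apply: measurableC.
by apply: open_borel; rewrite openC.
Qed.

Lemma lsc_measurable g : lower_semicontinuous g ->
  measurable_fun [set: borel X] (g : borel X -> \bar R).
Proof.
move=> lg; apply: (measurability _ (ErealGenOInfty.measurableE R)).
move=> /= _ [_ [a ->]] <-; apply: measurableI => //.
by rewrite preimage_itvoy; apply: open_borel; have /lower_semicontinuousP := lg; apply.
Qed.

Lemma uscN h : upper_semicontinuous h -> lower_semicontinuous (fun x => - h x).
Proof.
move=> uh x a; rewrite lteNr => /uh[V xV VP].
by exists V => // y /VP; rewrite lteNr.
Qed.

Lemma usc_measurable h : upper_semicontinuous h ->
  measurable_fun [set: borel X] (h : borel X -> \bar R).
Proof.
move=> /uscN/lsc_measurable mh.
rewrite (_ : h = (fun x => - - h x)); last by apply/funext => x; rewrite oppeK.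
by apply: (measurableT_comp _ mh); exact: oppe_measurable.
Qed.

Lemma continuous_lsc u : continuous u -> lower_semicontinuous (EFin \o u).
Proof.
move=> cu x a /=; rewrite lte_fin => ax.
exists [set y | (a < u y)%R] => //.
by have := cu x _ (lt_nbhsr ax).
Qed.

Lemma continuous_usc u : continuous u -> upper_semicontinuous (EFin \o u).
Proof.
move=> cu x a /=; rewrite lte_fin => ax.
exists [set y | (u y < a)%R] => //.
by have := cu x _ (lt_nbhsl ax).
Qed.

Lemma continuous_borel u : continuous u ->
  measurable_fun [set: borel X] (fun x : borel X => (u x)%:E).
Proof. by move=> cu; exact: (lsc_measurable (continuous_lsc cu)). Qed.

Lemma lscD g1 g2 : (forall x, 0 <= g1 x) -> (forall x, 0 <= g2 x) ->
  lower_semicontinuous g1 -> lower_semicontinuous g2 ->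
  lower_semicontinuous (fun x => g1 x + g2 x).
Proof.
move=> g10 g20 l1 l2 x a ag.
have [b [c [bg cg abc]]] : exists b c : R, [/\ b%:E < g1 x, c%:E < g2 x & (a <= b + c)%R].
  case: (g1 x) (g10 x) ag => [r1||]//= r10; case: (g2 x) (g20 x) => [r2||]//= r20.
  - rewrite -EFinD lte_fin => ar.
    exists (r1 - (r1 + r2 - a)/2)%R, (r2 - (r1 + r2 - a)/2)%R; rewrite !lte_fin; split; lra.
  - by move=> _; exists (r1 - 1)%R, (a + 1 - r1)%R; clear; rewrite !lte_fin ltry; split => //; lra.
  - by move=> _; exists (a + 1 - r2)%R, (r2 - 1)%R; clear; rewrite !lte_fin ltry; split => //; lra.
  - by move=> _; exists a, 0%R; rewrite !ltry addr0; split.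
have [V xV VP] := l1 _ _ bg; have [W xW WP] := l2 _ _ cg.
exists (V `&` W); first exact: filterI.
move=> y [/VP by1 /WP cy]; apply: (@le_lt_trans _ _ (b%:E + c%:E)).
  by rewrite -EFinD lee_fin.
exact: lteD.
Qed.

Lemma lscB_continuous g u : lower_semicontinuous g -> continuous u ->
  lower_semicontinuous (fun x => g x - (u x)%:E).
Proof.
move=> lg cu x a; rewrite lteBrDr// -EFinD => /[dup] ag.
have [b [ab bg]] : exists b : R, (a + u x < b)%R /\ b%:E < g x.
  case: (g x) ag => [r||]//.
  - by rewrite lte_fin => ar; exists ((a + u x + r) / 2)%R; rewrite lte_fin; split; lra.
  - by move=> _; exists (a + u x + 1)%R; rewrite ltry; split => //; rewrite ltrDl.
move=> _; have [V xV VP] := lg x b bg.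
have [W xW WP] : exists2 W, nbhs x W & forall y, W y -> (u y)%:E < (b - a)%:E.
  by apply: (continuous_usc cu); rewrite /= lte_fin; lra.
exists (V `&` W); first exact: filterI.
move=> y [/VP bgy /WP]; rewrite lte_fin => uy; rewrite lteBrDr// -EFinD.
by apply: lt_trans bgy; rewrite lte_fin; lra.
Qed.

Lemma lsc_ereal_sup (I : Type) (g : I -> X -> \bar R) :
  (forall i, lower_semicontinuous (g i)) ->
  lower_semicontinuous (fun x => ereal_sup (range (g^~ x))).
Proof.
move=> lg x a /ereal_sup_gt[_ [i _ <-]] /lg[V xV VP].
exists V => // y /VP agy; apply: (lt_le_trans agy).
by apply: ereal_sup_ubound; exists i.
Qed.

Lemma lscZ g (c : R) : (0 <= c)%R -> (forall x, 0 <= g x) ->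
  lower_semicontinuous g -> lower_semicontinuous (fun x => c%:E * g x).
Proof.
rewrite le_eqVlt => /orP[/eqP <-|c0] g0 lg x a.
  rewrite mul0e => a0; exists setT; first exact: filterT.
  by move=> y _; rewrite mul0e.
rewrite -lte_pdivrMl// -EFinM => /lg[V xV VP]; exists V => // y /VP.
by rewrite EFinM lte_pdivrMl.
Qed.

Lemma open_indic_lsc (U : set X) : open U -> lower_semicontinuous (fun x => (\1_U x)%:E : \bar R).
Proof.
move=> oU x a; rewrite indicE; case: (boolP (x \in U)) => [/set_mem Ux|_] ax.
  exists U; first by apply: open_nbhs_nbhs.
  by move=> y Uy; rewrite indicE mem_set.
exists setT; first exact: filterT.
move=> y _; apply: (lt_le_trans ax); by rewrite indicE lee_fin ler0n.
Qed.

Section Lint.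
Variable m : {measure set (borel X) -> \bar R}.

(** The integral [rint] for an arbitrary Borel measure; on nonnegative functions that are not
    measurable it is a lower integral. *)
Definition lint f : \bar R := \int[m]_(x in [set: borel X]) f x.

Lemma lint_ge0 f : (forall x, 0 <= f x) -> 0 <= lint f.
Proof. by move=> f0; apply: integral_ge0. Qed.

(** No measurability is involved: every simple minorant of [f] is one of [g]. *)
Lemma le_lint f g : (forall x, 0 <= f x) -> (forall x, f x <= g x) -> lint f <= lint g.
Proof.
move=> f0 fg; rewrite /lint !ge0_integralTE//; last by move=> x; exact: le_trans (fg x).
apply: le_ereal_sup => _ [h /= hf <-]; exists h => //= x.
exact: le_trans (fg x).
Qed.

Lemma lintD f g : (forall x, 0 <= f x) -> (forall x, 0 <= g x) ->
  measurable_fun [set: borel X] f -> measurable_fun [set: borel X] g ->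
  lint (fun x => f x + g x) = lint f + lint g.
Proof. by move=> f0 g0 mf mg; rewrite /lint ge0_integralD. Qed.

Lemma lintZ f (c : R) : (forall x, 0 <= f x) -> (0 <= c)%R ->
  measurable_fun [set: borel X] f ->
  lint (fun x => c%:E * f x) = c%:E * lint f.
Proof. by move=> f0 c0 mf; rewrite /lint ge0_integralZl_EFin. Qed.

Lemma lint_indic (A : set (borel X)) : measurable A -> lint (fun x => (\1_A x)%:E) = m A.
Proof. by move=> mA; rewrite /lint integral_indic// setIT. Qed.

Lemma lint_sup (g : nat -> X -> \bar R) f :
  (forall n x, 0 <= g n x) -> (forall n, measurable_fun [set: borel X] (g n)) ->
  (forall n x, g n x <= g n.+1 x) ->
  (forall x, f x = ereal_sup (range (g ^~ x))) ->
  lint f = ereal_sup (range (fun n => lint (g n))).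
Proof.
move=> g0 mg ginc fE.
have ndg x : {homo g^~ x : n k / (n <= k)%N >-> n <= k}.
  by apply/nondecreasing_seqP => n; exact: ginc.
have -> : lint f = \int[m]_(x in [set: borel X]) limn (g^~ x).
  apply: eq_integral => x _; rewrite fE; apply/esym/cvg_lim => //.
  exact: ereal_nondecreasing_cvgn.
rewrite monotone_convergence//; apply/cvg_lim => //.
apply: ereal_nondecreasing_cvgn => a b ab; apply: le_lint => // x.
exact: ndg.
Qed.

End Lint.
End BorelIntegral.

Import HBNNSimple.

Section LowerIntegral.
Context {R : realType} {X : ptopologicalType}.
Implicit Types (f g h : X -> \bar R) (u v : X -> R).
Local Open Scope ereal_scope.

Lemma le_sup_range (I : Type) (F : I -> \bar R) (x : \bar R) (i : I) :
  x <= F i -> x <= ereal_sup (range F).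
Proof. by move/le_trans; apply; apply: ereal_sup_ubound; exists i. Qed.

Lemma lte_between (z y : \bar R) : z < y -> exists a : R, z < a%:E /\ a%:E < y.
Proof.
case: y z => [r||] [s||]//; rewrite ?lte_fin.
- by move=> rs; exists ((r + s) / 2)%R; rewrite !lte_fin; split; lra.
- by move=> _; exists (r - 1)%R; rewrite lte_fin ltNyr; split => //; lra.
- by move=> _; exists (s + 1)%R; rewrite lte_fin ltry; split => //; lra.
- by move=> _; exists 0%R; rewrite ltry ltNyr.
Qed.

Lemma lee_real (y z : \bar R) : (forall a : R, a%:E < y -> a%:E <= z) -> y <= z.
Proof.
move=> H; rewrite leNgt; apply/negP => /lte_between[a [za /H]].
by rewrite leNgt za.
Qed.

Lemma ereal_sup_approx (y : \bar R) (u : nat -> R) :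
  (forall n, (u n)%:E <= y) -> (forall a : R, a%:E < y -> exists n, (a < u n)%R) ->
  y = ereal_sup (range (fun n => (u n)%:E)).
Proof.
move=> uy yu; apply/eqP; rewrite eq_le; apply/andP; split.
  apply: lee_real => a /yu[n an]; apply: (le_sup_range (i := n)).
  by rewrite lee_fin ltW.
by apply: ub_ereal_sup => _ [n _ <-].
Qed.

Lemma measurable_sup_range d (T : measurableType d) (g : nat -> T -> \bar R) :
  (forall n, measurable_fun [set: T] (g n)) ->
  measurable_fun [set: T] (fun x => ereal_sup (range (g ^~ x))).
Proof.
move=> mg; rewrite (_ : (fun _ => _) = (fun x => esups (g ^~ x) 0%N)).
  exact: (@measurable_fun_esups _ T R setT g).
by apply/funext => x; rewrite /esups /sdrop; congr ereal_sup; apply/seteqP; split => _ [n ? <-]; exists n.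
Qed.

(* The library's integral of a nonnegative function that need not be
   measurable is a lower integral; it is attained by a measurable minorant. *)
Lemma lint_attained (m : {measure set (borel X) -> \bar R}) f : (forall x, 0 <= f x) ->
  exists h, [/\ measurable_fun [set: borel X] h, forall x, 0 <= h x,
    forall x, h x <= f x & lint m h = lint m f].
Proof.
move=> f0; rewrite {2}/lint ge0_integralTE//.
set S := [set _ | _ in _].
have S0 : S !=set0.
  have [h] : exists h : {nnsfun borel X >-> R}, forall x, (h x)%:E <= f x.
    by exists nnsfun0 => x.
  by exists (sintegral m h), h.
have /set0P S0' := S0.
have [s sS slim] := ereal_sup_seq S0'.
have hP n := sS n.
pose h n := projT1 (cid2 (hP n)).
have hf n x : (h n x)%:E <= f x by rewrite /h; case: cid2 => /= k.
have hs n : s n = lint m (EFin \o h n).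
  by rewrite /h; case: cid2 => /= k _ <-; rewrite /lint integralT_nnsfun.
exists (fun x => ereal_sup (range (fun n => (h n x)%:E))); split.
- apply: (@measurable_sup_range _ (borel X) (fun n x => (h n x)%:E)) => n.
  exact/measurable_EFinP.
- move=> x; apply: (le_sup_range (i := 0%N)).
  by rewrite lee_fin.
- by move=> x; apply: ub_ereal_sup => _ [n _ <-].
- apply/eqP; rewrite eq_le; apply/andP; split.
    rewrite -[leRHS]ge0_integralTE//; apply: le_lint.
      move=> x; apply: (le_sup_range (i := 0%N)).
      by rewrite lee_fin.
    by move=> x; apply: ub_ereal_sup => _ [n _ <-].
  rewrite -(cvg_lim _ slim)//; apply: lime_le.
    by apply/cvg_ex; eexists; exact: slim.
  apply: nearW => n; rewrite hs; apply: le_lint.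
    by move=> x; rewrite lee_fin.
  by move=> x; apply: (le_sup_range (i := n)).
Qed.

Section Combination.
Variables (s t : R) (s0 : (0 <= s)%R) (t0 : (0 <= t)%R).
Variables (m m1 m2 : {measure set (borel X) -> \bar R}).
Hypothesis mE : forall A : set (borel X), measurable A -> m A = s%:E * m1 A + t%:E * m2 A.

Lemma lint_comb f : measurable_fun [set: borel X] f -> (forall x, 0 <= f x) ->
  lint m f = s%:E * lint m1 f + t%:E * lint m2 f.
Proof.
move=> mf f0; pose s' := NngNum s0; pose t' := NngNum t0.
rewrite /lint (@eq_measure_integral _ _ _ _ (measure_add (mscale s' m1) (mscale t' m2))).
  by rewrite ge0_integral_measure_add// !ge0_integral_mscale.
by move=> A mA _; rewrite mE//; exact/esym/(measure_addE (mscale s' m1) (mscale t' m2) A).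
Qed.

(** Choose Borel minorants of [f] attaining the two lower integrals and integrate their maximum.
    This inequality suffices for perturbing and mixing measures when [f] is not Borel. *)
Lemma lint_comb_ge f : (forall x, 0 <= f x) ->
  s%:E * lint m1 f + t%:E * lint m2 f <= lint m f.
Proof.
move=> f0; have [h1 [mh1 h10 h1f <-]] := lint_attained m1 f0.
have [h2 [mh2 h20 h2f <-]] := lint_attained m2 f0.
pose h x := maxe (h1 x) (h2 x).
have mh : measurable_fun [set: borel X] h by exact: measurable_maxe.
have h0 x : 0 <= h x by rewrite le_max h10.
apply: (@le_trans _ _ (s%:E * lint m1 h + t%:E * lint m2 h)).
  apply: leeD; apply: lee_wpmul2l; rewrite ?lee_fin//; apply: le_lint => // x;
  by rewrite le_max lexx ?orbT.
rewrite -lint_comb//; apply: le_lint => // x.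
by rewrite ge_max h1f h2f.
Qed.

End Combination.

Lemma le_measure_lint (m1 m2 : {measure set (borel X) -> \bar R}) f :
  (forall A : set (borel X), measurable A -> m1 A <= m2 A) ->
  (forall x, 0 <= f x) -> lint m1 f <= lint m2 f.
Proof.
move=> m12 f0; have [h [mh h0 hf <-]] := lint_attained m1 f0.
apply: (@le_trans _ _ (lint m2 h)); last exact: le_lint.
exact: ge0_le_measure_integral.
Qed.

(** The bridge from q.e. inequalities to integrals, valid for lower integrals because a minorant of
    [f] may be cut off on [N]. *)
Lemma lint_null (m : {measure set (borel X) -> \bar R}) (N : set (borel X)) f g :
  measurable N -> m N = 0 -> (forall x, 0 <= f x) -> (forall x, 0 <= g x) ->
  (forall x, ~ N x -> f x <= g x) -> lint m f <= lint m g.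
Proof.
move=> mN N0 f0 g0 fg; have [h [mh h0 hf <-]] := lint_attained m f0.
rewrite /lint (ge0_negligible_integral mN)// integral_mkcond.
apply: le_lint => x; rewrite patchE; case: ifPn => // /set_mem[_ /fg].
by apply: le_trans.
Qed.

End LowerIntegral.

(** * Integrals of semicontinuous functions *)

Section LscIntegral.
Context {R : realType} {X : ptopologicalType}.
Implicit Types (f g h : X -> \bar R) (u v : X -> R).
Local Open Scope ereal_scope.
Hypothesis hX : hausdorff_space X.
Hypothesis lX : locally_compact [set: X].

Lemma usc_bounded (K : set X) h : compact K -> upper_semicontinuous h ->
  (forall x, h x < +oo) -> exists2 M : R, (0 <= M)%R & forall x, K x -> h x <= M%:E.
Proof.
move=> cK uh hoo.
apply: (compact_local_ind (P := fun A => exists2 M : R, (0 <= M)%R & forall x, A x -> h x <= M%:E) cK).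
- by exists 0%R.
- by move=> A B AB [M M0 MB]; exists M => // x /AB/MB.
- move=> A B [M M0 MA] [N N0 NB]; exists (Num.max M N) => [|x [/MA|/NB] H].
  + by rewrite le_max M0.
  + by rewrite EFin_max le_max H.
  + by rewrite EFin_max le_max H orbT.
- move=> x Kx; have [a a0 ha] : exists2 a : R, (0 <= a)%R & h x < a%:E.
    case: (h x) (hoo x) => [r||]// _.
    + exists (Num.max r 0 + 1)%R; first by rewrite addr_ge0// le_max lexx orbT.
      by rewrite lte_fin ltr_pwDr// le_max lexx.
    + by exists 0%R => //; rewrite ltNyr.
  have [V xV VP] := uh _ _ ha; exists V => //; by exists a => // y [/VP/ltW hy _].
Qed.

Lemma H0_le_Cc h : H0 h -> exists2 u : X -> R, Cc R X u & forall x, h x <= (u x)%:E.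
Proof.
move=> [h0 hoo uh /compact_supportP[K cK hK]].
have [M M0 hM] := usc_bounded cK uh hoo.
have [u [cu u01 uK _]] := compact_bump (R := R) hX lX cK openT (@subsetT _ K).
exists (fun x => (M * u x)%R); first exact: CcZ.
move=> x; have [Kx|/hK ->] := pselect (K x); first by rewrite uK// mulr1; exact: hM.
by rewrite lee_fin mulr_ge0//; have /andP[] := u01 x.
Qed.

Lemma Cc_lint_fin (m : {measure set (borel X) -> \bar R}) u :
  (forall K : set X, compact K -> m K < +oo) ->
  Cc R X u -> lint m (fun x => `|u x|%:E) < +oo.
Proof.
move=> mK cu; have [M M0 uM] := Cc_bounded cu.
have [_ /compact_supportP[K cK uK]] := cu.
have bK : measurable (K : set (borel X)) by apply: closed_borel; exact: compact_closed.
apply: (@le_lt_trans _ _ (lint m (fun x => M%:E * (\1_K x)%:E))).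
  apply: le_lint => x; first by rewrite lee_fin.
  rewrite -EFinM lee_fin indicE.
  case: (boolP (x \in K)) => [_|/negP xK]; rewrite ?mulr1//.
  by rewrite uK ?normr0 ?mulr0// => /mem_set.
rewrite lintZ//.
- rewrite lint_indic//; apply: lte_mul_pinfty => //; rewrite ?lee_fin//.
  exact: mK.
- by apply/measurable_EFinP; exact: measurable_indic.
Qed.

Hypothesis sX : @second_countable X.

(** One sequence serves all measures at once, which allows suprema over measures and over the
    sequence to be exchanged. *)
Lemma lsc_approx_sup g : (forall x, 0 <= g x) -> lower_semicontinuous g ->
  exists u : nat -> X -> R, [/\ forall n, Cc R X (u n),
    forall n x, (0 <= u n x)%R, forall n x, (u n x <= u n.+1 x)%R,
    forall x, g x = ereal_sup (range (fun n => (u n x)%:E)) &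
    forall m : {measure set (borel X) -> \bar R},
     lint m g = ereal_sup (range (fun n => lint m (EFin \o u n)))].
Proof.
move=> g0 lg; have [u [cu u0 uinc ug ulim]] := lsc_approx hX lX sX g0 lg.
have gE x : g x = ereal_sup (range (fun n => (u n x)%:E)).
  by apply: ereal_sup_approx => // a; exact: ulim.
exists u; split => // m; apply: lint_sup => //.
by move=> n; apply: continuous_borel; exact: (cu n).1.
Qed.

(** With a test function [w >= h], the function [w - h] is l.s.c. and nonnegative; subtract its
    increasing approximants from [w]. *)
Lemma H0_approx h : H0 h -> exists v : nat -> X -> R, [/\ forall n, Cc R X (v n),
  forall n x, h x <= (v n x)%:E, forall n x, (v n.+1 x <= v n x)%R &
  forall x (a : R), h x < a%:E -> exists n, (v n x < a)%R].
Proof.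
move=> Hh; have [h0 hoo uh _] := Hh; have [w cw hw] := H0_le_Cc Hh.
have hfin x : h x \is a fin_num by rewrite ge0_fin_numE.
have g0 x : 0 <= (w x)%:E - h x by rewrite sube_ge0 ?hw// hfin orbT.
have lg : lower_semicontinuous (fun x => (w x)%:E - h x).
  move=> x a aw.
  pose H x := fine (h x); have hE y : h y = (H y)%:E by rewrite fineK.
  rewrite hE -EFinB lte_fin in aw.
  pose d := ((w x - H x - a) / 2)%R; have d0 : (0 < d)%R by rewrite /d; lra.
  have [V xV VP] : exists2 V, nbhs x V & forall y, V y -> h y < (H x + d)%:E.
    by apply: uh; rewrite hE lte_fin ltrDl.
  have [|W xW WP] := continuous_lsc cw.1 (x := x) (a := (w x - d)%R).
    by rewrite lte_fin ltrBlDr ltrDl.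
  exists (V `&` W); first exact: filterI.
  move=> y [/VP + /WP]; rewrite hE -EFinB !lte_fin /= => hy wy.
  by rewrite /d in hy wy; lra.
have [u [cu u0 uinc ug ulim]] := lsc_approx hX lX sX g0 lg.
exists (fun n x => w x - u n x)%R; split.
- by move=> n; exact: CcB.
- move=> n x; have := ug n x; rewrite EFinB leeBrDl// => H.
  by rewrite leeBrDr// addeC.
- by move=> n x; rewrite lerB.
- move=> x a ha; have [|n an] := ulim x (w x - a)%R.
    rewrite -(fineK (hfin x)) in ha *; move: ha.
    by rewrite -EFinB !lte_fin ltrBlDr addrAC -ltrBlDr opprK; lra.
  by exists n; lra.
Qed.

End LscIntegral.

(** * Suprema, infima and series of extended reals *)

Section ExtendedReals.
Context {R : realType}.
Local Open Scope ereal_scope.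

(** The [e / 2^(n+1)] argument, abstracted because the Riesz outer measure and the upper capacity
    are both infima over majorants. *)
Lemma sigma_subadditive_inf (T : Type) (Phi : T -> \bar R) (S : nat -> set T)
    (y : \bar R) : (forall n g, S n g -> 0 <= Phi g) ->
  (forall g : nat -> T, (forall n, S n (g n)) -> y <= \sum_(n <oo) Phi (g n)) ->
  y <= \sum_(n <oo) ereal_inf [set Phi g | g in S n].
Proof.
move=> Phi0 H; pose a n := ereal_inf [set Phi g | g in S n].
have a0 n : 0 <= a n by apply: le_ereal_inf_tmp => _ [g /Phi0 ? <-].
rewrite -/(a _); change (y <= \sum_(n <oo) a n).
have [[i ioo]|] := pselect (exists i, a i = +oo).
  by rewrite (eseries_pinfty _ _ ioo) ?leey// => n _; rewrite -ltNye (lt_le_trans _ (a0 _)).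
rewrite -forallNE => aoo.
apply/lee_addgt0Pr => e e0.
apply: (le_trans _ (epsilon_trick _ a0 (ltW e0))).
have [g gP] : {g : nat -> T & forall n, S n (g n) /\ Phi (g n) <= a n + (e / (2 ^ n.+1)%:R)%:E}.
  apply: (@choice _ _ (fun n t => S n t /\ Phi t <= a n + (e / (2 ^ n.+1)%:R)%:E)) => n.
  have en : (0 < e / (2 ^ n.+1)%:R)%R by rewrite divr_gt0// ltr0n expn_gt0.
  have afin : a n \is a fin_num by rewrite ge0_fin_numE// ltey; apply/eqP; exact: aoo.
  have [_ [t St <-] /ltW Pt] := lb_ereal_inf_adherent en afin.
  by exists t.
apply: (le_trans (H g (fun n => (gP n).1))).
apply: lee_nneseries => n _; [move=> _; exact: Phi0 (gP n).1|exact: (gP n).2].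
Qed.

Lemma ereal_supD (a b : nat -> \bar R) :
  (forall n, 0 <= a n) -> (forall n, 0 <= b n) ->
  (forall n, a n <= a n.+1) -> (forall n, b n <= b n.+1) ->
  ereal_sup (range (fun n => a n + b n)) = ereal_sup (range a) + ereal_sup (range b).
Proof.
move=> a0 b0 /nondecreasing_seqP ai /nondecreasing_seqP bi.
have ca := ereal_nondecreasing_cvgn ai; have cb := ereal_nondecreasing_cvgn bi.
have cab : {homo (fun n => a n + b n) : n m / (n <= m)%N >-> n <= m}.
  by move=> n m nm; apply: leeD; [exact: ai|exact: bi].
rewrite -(cvg_lim _ (ereal_nondecreasing_cvgn cab))//; apply/cvg_lim => //.
apply: cvgeD => //; apply: ge0_adde_def; rewrite inE.
  by apply: le_trans (a0 0%N) _; exact: le_sup_range.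
by apply: le_trans (b0 0%N) _; exact: le_sup_range.
Qed.

Lemma ereal_sup_addr_le (a : nat -> \bar R) (c M : \bar R) :
  (forall n, 0 <= a n) -> (forall n, a n <= a n.+1) -> 0 <= c ->
  (forall n, a n + c <= M) -> ereal_sup (range a) + c <= M.
Proof.
move=> a0 ai c0 acM.
apply: (@le_trans _ _ (ereal_sup (range a) + ereal_sup (range (fun=> c) : set (\bar R)))).
  by rewrite leeD2l//; exact: (@le_sup_range _ nat (fun=> c) c 0%N).
rewrite -(@ereal_supD a (fun=> c))//.
by apply: ub_ereal_sup => _ [n _ <-].
Qed.

End ExtendedReals.

Section Exhaustion.
Context {R : realType} {X : ptopologicalType}.
Hypothesis hX : hausdorff_space X.
Hypothesis lX : locally_compact [set: X].
Hypothesis sX : @second_countable X.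

Lemma open_exhaustion (U : set X) : open U -> exists K : nat -> set X,
  [/\ forall n, compact (K n), forall n, K n `<=` K n.+1 & \bigcup_n K n = U].
Proof.
move=> oU; have i0 (x : X) : (0 <= (\1_U x)%:E :> \bar R)%E by rewrite lee_fin.
have [u [cu u0 ui ug ulim]] := lsc_approx hX lX sX i0 (open_indic_lsc oU).
(* Here [u] increases to the indicator of [U]: the closed superlevel sets lie in compact supports,
   and any level strictly between 0 and 1 would do. *)
exists (fun n => [set x | 1/2 <= u n x]); split.
- move=> n; have [cun /compact_supportP[K cK uK]] := cu n.
  apply: (subclosed_compact _ cK).
    have : closed (u n @^-1` [set r | 1/2 <= r]).
      by apply: closed_comp; [move=> x _; exact: cun|exact: closed_ge].
    by [].
  move=> x /=; apply: contraPP => /uK ->; lra.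
- by move=> n x /= H; exact: le_trans (ui n x).
- apply/seteqP; split => [x [n _] /= H|x Ux].
    apply: contrapT => nU; have := ug n x; rewrite indicE memNset// lee_fin /= => H'; lra.
  have [|n un] := ulim x (1/2); first by rewrite indicE mem_set// lte_fin /=; lra.
  by exists n => //=; exact: ltW.
Qed.

End Exhaustion.

(** * The Riesz representation theorem *)

Section DaniellExtension.
Context {R : realType} {X : ptopologicalType}.
Implicit Types (f g h : X -> \bar R) (u v : X -> R).
Hypothesis hX : hausdorff_space X.
Hypothesis lX : locally_compact [set: X].
Hypothesis sX : @second_countable X.

(** Working on this cone keeps all integrands nonnegative, where [lint] behaves well without
    integrability conditions. *)
Definition Ccp : set (X -> R) := [set u | Cc R X u /\ forall x, 0 <= u x].

Variable L : (X -> R) -> R.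
Hypothesis LD : forall u v, Ccp u -> Ccp v -> L (fun x => u x + v x) = L u + L v.
Hypothesis LZ : forall (c : R) u, 0 <= c -> Ccp u -> L (fun x => c * u x) = c * L u.
Hypothesis L_ge0 : forall u, Ccp u -> 0 <= L u.

Lemma CcpD u v : Ccp u -> Ccp v -> Ccp (fun x => u x + v x).
Proof. by move=> [cu u0] [cv v0]; split=> [|x]; [exact: CcD|rewrite addr_ge0]. Qed.

Lemma CcpZ (c : R) u : 0 <= c -> Ccp u -> Ccp (fun x => c * u x).
Proof. by move=> c0 [cu u0]; split=> [|x]; [exact: CcZ|rewrite mulr_ge0]. Qed.

Lemma CcpB u v : Ccp u -> Ccp v -> (forall x, v x <= u x) -> Ccp (fun x => u x - v x).
Proof. by move=> [cu u0] [cv v0] vu; split=> [|x]; [exact: CcB|rewrite subr_ge0]. Qed.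

Lemma Ccp0 : Ccp (fun=> 0).
Proof. by split => //; exact: Cc0. Qed.

Lemma Ccp_pos u : Cc R X u -> Ccp (fun x => Num.max (u x) 0).
Proof. by move=> cu; split=> [|x]; [exact: Cc_pos|rewrite le_max lexx orbT]. Qed.

Lemma Ccp_min_cst u (c : R) : 0 <= c -> Ccp u -> Ccp (fun x => Num.min (u x) c).
Proof.
by move=> c0 [cu u0]; split=> [|x]; [exact: Cc_min_cst|rewrite le_min u0].
Qed.

Lemma L_le u v : Ccp u -> Ccp v -> (forall x, u x <= v x) -> L u <= L v.
Proof.
move=> cu cv uv; have cw := CcpB cv cu uv.
have -> : v = (fun x => u x + (v x - u x)) by apply/funext => x; rewrite addrC subrK.
by rewrite LD// lerDl L_ge0.
Qed.

Local Open Scope ereal_scope.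

Definition daniell g : \bar R :=
  ereal_sup [set (L u)%:E | u in [set u | Ccp u /\ forall x, (u x)%:E <= g x]].

Lemma le_daniell f g : (forall x, f x <= g x) -> daniell f <= daniell g.
Proof.
move=> fg; apply: le_ereal_sup => _ [u [cu uf] <-]; exists u => //; split => // x.
exact: le_trans (fg x).
Qed.

Lemma daniell_ge0 g : (forall x, 0 <= g x) -> 0 <= daniell g.
Proof.
move=> g0; apply: (@le_trans _ _ (L (fun=> 0%R))%:E); first by rewrite lee_fin L_ge0//; exact: Ccp0.
by apply: ereal_sup_ubound; exists (fun=> 0%R) => //; split => //; exact: Ccp0.
Qed.

Lemma daniell_Ccp u : Ccp u -> daniell (EFin \o u) = (L u)%:E.
Proof.
move=> cu; apply/eqP; rewrite eq_le; apply/andP; split.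
  by apply: ub_ereal_sup => _ [v [cv vu] <-]; rewrite lee_fin; exact: L_le.
by apply: ereal_sup_ubound; exists u.
Qed.

Lemma daniell_Z_ge g (c : R) : (0 <= c)%R -> c%:E * daniell g <= daniell (fun x => c%:E * g x).
Proof.
rewrite le_eqVlt => /orP[/eqP<-|c0].
  by rewrite mul0e; apply: daniell_ge0 => x; rewrite mul0e.
rewrite -lee_pdivlMl//; apply: ub_ereal_sup => _ [u [cu ug] <-].
have cu' : Ccp (fun x => c * u x)%R by apply: CcpZ => //; exact: ltW.
rewrite lee_pdivlMl// -EFinM -(LZ (ltW c0) cu); apply: ereal_sup_ubound; exists (fun x => c * u x)%R => //.
by split=> // x; rewrite EFinM lee_pmul2l.
Qed.

(** Dini on the support of [u]: some [g n] exceeds [u - d] there, and the loss [d] is paid for by a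
    bump [w] equal to 1 on the support. *)
Lemma L_dini (g : nat -> X -> \bar R) u (e : R) : Ccp u -> (0 < e)%R ->
  (forall n x, 0 <= g n x) -> (forall n x, g n x <= g n.+1 x) ->
  (forall n, lower_semicontinuous (g n)) ->
  (forall x, (u x)%:E <= ereal_sup (range (g ^~ x))) ->
  exists n, (L u)%:E <= daniell (g n) + e%:E.
Proof.
move=> cu e0 g0 ginc lg ug; have [_ /compact_supportP[K cK uK]] := cu.1.
have [w [cw w01 wK _]] := compact_bump (R := R) hX lX cK openT (@subsetT _ K).
have cw' : Ccp w by split => // x; have /andP[] := w01 x.
(* Chosen so that [d * L w <= e]; the 1 keeps the denominator positive. *)
pose d := (e / (L w + 1))%R.
have Lw1 : (0 < L w + 1)%R by rewrite ltr_wpDl// L_ge0.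
have d0 : (0 < d)%R by rewrite divr_gt0.
have [n Kn] : exists n, K `<=` [set x | (u x - d)%:E < g n x].
  apply: (compact_increasing_cover cK).
  - by move=> n x /= /lt_le_trans; apply.
  - move=> n x _ /= ux.
    have [b [ub bg]] : exists b : R, (u x - d < b)%R /\ b%:E < g n x.
      case: (g n x) ux => [r||]//.
      + rewrite lte_fin => ur; exists ((u x - d + r) / 2)%R; rewrite lte_fin; split; lra.
      + by move=> _; exists (u x - d + 1)%R; rewrite ltry; split => //; rewrite ltrDl.
    have [V xV VP] := lg n _ _ bg.
    have [W xW WP] : exists2 W, nbhs x W & forall y, W y -> (u y)%:E < (b + d)%:E.
      by apply: (continuous_usc cu.1.1); rewrite /= lte_fin -ltrBlDr.
    exists (V `&` W); first exact: filterI.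
    move=> y [[/VP bg' /WP uyb]] _ /=; rewrite lte_fin -ltrBlDr in uyb.
    by apply: lt_trans bg'; rewrite lte_fin.
  - move=> x _; have /ereal_sup_gt[_ [n _ <-] ?] : (u x - d)%:E < ereal_sup (range (g^~ x)).
      by apply: (lt_le_trans _ (ug x)); rewrite lte_fin ltrBlDr ltrDl.
    by exists n.
exists n.
pose v x := Num.max (u x - d * w x)%R 0%R.
have cv : Ccp v by apply: Ccp_pos; apply: CcB => //; [exact: cu.1|exact: CcZ].
apply: (@le_trans _ _ (L (fun x => v x + d * w x)%R)%:E).
  rewrite lee_fin; apply: L_le => //; first by apply: CcpD => //; apply: CcpZ => //; exact: ltW.
  by move=> x; rewrite -lerBlDr le_max lexx.
rewrite LD//; last by apply: CcpZ => //; exact: ltW.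
rewrite EFinD; apply: leeD.
  apply: ereal_sup_ubound; exists v => //; split => // x.
  rewrite EFin_max ge_max g0 andbT.
  have [/[dup]/wK -> /Kn/ltW|nK] := pselect (K x); first by rewrite mulr1.
  rewrite uK// sub0r; apply: (le_trans _ (g0 n x)); rewrite lee_fin oppr_le0.
  by apply: mulr_ge0; [exact: ltW|exact: cw'.2].
rewrite (LZ (ltW d0) cw') lee_fin /d mulrAC ler_pdivrMr// ler_pM2l//.
by rewrite lerDl.
Qed.

Lemma daniell_sup (g : nat -> X -> \bar R) f :
  (forall n x, 0 <= g n x) -> (forall n x, g n x <= g n.+1 x) ->
  (forall n, lower_semicontinuous (g n)) ->
  (forall x, f x = ereal_sup (range (g ^~ x))) ->
  daniell f = ereal_sup (range (fun n => daniell (g n))).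
Proof.
move=> g0 ginc lg fE; apply/eqP; rewrite eq_le; apply/andP; split.
  apply: ub_ereal_sup => _ [u [cu uf] <-].
  apply/lee_addgt0Pr => e e0.
  have [x|n nP] := L_dini cu e0 g0 ginc lg; first by rewrite -fE.
  by apply: (le_trans nP); rewrite leeD2r//; exact: le_sup_range.
apply: ub_ereal_sup => _ [n _ <-]; apply: le_daniell => x.
by rewrite fE; exact: le_sup_range.
Qed.

Lemma daniell_approx g (u : nat -> X -> R) : (forall n, Cc R X (u n)) ->
  (forall n x, (0 <= u n x)%R) -> (forall n x, (u n x <= u n.+1 x)%R) ->
  (forall x, g x = ereal_sup (range (fun n => (u n x)%:E))) ->
  daniell g = ereal_sup (range (fun n => (L (u n))%:E)).
Proof.
move=> cu u0 ui ug; rewrite (@daniell_sup (fun n => EFin \o u n) g)//.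
- by congr ereal_sup; apply/seteqP; split => _ [n _ <-]; exists n => //; rewrite daniell_Ccp//; split.
- by move=> n; apply: continuous_lsc; exact: (cu n).1.
Qed.

Lemma daniellD f g : (forall x, 0 <= f x) -> (forall x, 0 <= g x) ->
  lower_semicontinuous f -> lower_semicontinuous g ->
  daniell (fun x => f x + g x) = daniell f + daniell g.
Proof.
move=> f0 g0 lf lg.
have [u [cu u0 ui uf _]] := lsc_approx_sup hX lX sX f0 lf.
have [v [cv v0 vi vg _]] := lsc_approx_sup hX lX sX g0 lg.
have pu n : Ccp (u n) by split.
have pv n : Ccp (v n) by split.
rewrite (daniell_approx cu u0 ui uf) (daniell_approx cv v0 vi vg).
rewrite (@daniell_approx _ (fun n x => u n x + v n x)%R).
- rewrite -ereal_supD//.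
  + by congr ereal_sup; apply/seteqP; split => _ [n _ <-]; exists n => //; rewrite LD.
  + by move=> n; rewrite lee_fin L_ge0.
  + by move=> n; rewrite lee_fin L_ge0.
  + by move=> n; rewrite lee_fin L_le.
  + by move=> n; rewrite lee_fin L_le.
- by move=> n; exact: CcD.
- by move=> n x; rewrite addr_ge0.
- by move=> n x; rewrite lerD.
- by move=> x; rewrite uf vg -ereal_supD// => n; rewrite lee_fin.
Qed.

Definition open_mass (U : set X) : \bar R := daniell (fun x => (\1_U x)%:E).

Definition riesz_outer (A : set X) : \bar R :=
  ereal_inf [set open_mass U | U in [set U | open U /\ A `<=` U]].

Lemma open_mass_ge0 U : 0 <= open_mass U.
Proof. by apply: daniell_ge0 => x; rewrite lee_fin. Qed.

Lemma le_open_mass (U V : set X) : U `<=` V -> open_mass U <= open_mass V.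
Proof.
move=> UV; apply: le_daniell => x; rewrite lee_fin !indicE ler_nat.
by case: (boolP (x \in U)) => // /set_mem/UV/mem_set ->.
Qed.

Lemma riesz_outer_open U : open U -> riesz_outer U = open_mass U.
Proof.
move=> oU; apply/eqP; rewrite eq_le; apply/andP; split.
  by apply: ereal_inf_lbound; exists U => //; split.
by apply: le_ereal_inf_tmp => _ [V [_ UV] <-]; exact: le_open_mass.
Qed.

Lemma riesz_outer_ge0 A : 0 <= riesz_outer A.
Proof. by apply: le_ereal_inf_tmp => _ [V _ <-]; exact: open_mass_ge0. Qed.

Lemma riesz_outer_le : {homo riesz_outer : A B / A `<=` B >-> A <= B}.
Proof.
move=> A B AB; apply: le_ereal_inf => _ [U [oU BU] <-]; exists U => //; split => //.
exact: subset_trans BU.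
Qed.

Lemma open_mass0 : open_mass set0 = 0.
Proof.
rewrite /open_mass (_ : (fun x => _) = EFin \o (fun=> 0%R)); last first.
  by apply/funext => x; rewrite indicE in_set0.
rewrite daniell_Ccp; last exact: Ccp0.
by have := LZ (lexx 0%R) Ccp0; rewrite !mul0r => ->.
Qed.

Lemma riesz_outer0 : riesz_outer set0 = 0.
Proof. by rewrite riesz_outer_open ?open_mass0//; exact: open0. Qed.

Lemma open_massU U V : open U -> open V -> open_mass (U `|` V) <= open_mass U + open_mass V.
Proof.
move=> oU oV; rewrite -daniellD; try exact: open_indic_lsc; try by move=> x; rewrite lee_fin.
apply: le_daniell => x; rewrite !indicE in_setU -EFinD lee_fin.
by case: (x \in U); case: (x \in V); rewrite ?addr0 ?add0r ?lerDl.
Qed.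

Lemma open_mass_bigcup (U : nat -> set X) : (forall n, open (U n)) ->
  open_mass (\bigcup_n U n) <= \sum_(n <oo) open_mass (U n).
Proof.
move=> oU; pose V n := \big[setU/set0]_(k < n) U k.
have VS n : V n.+1 = V n `|` U n by rewrite /V big_ord_recr.
have oV n : open (V n).
  by elim: n => [|n IH]; [rewrite /V big_ord0; exact: open0|rewrite VS; exact: openU].
rewrite {1}/open_mass (@daniell_sup (fun n x => (\1_(V n) x)%:E)).
- apply: ub_ereal_sup => _ [n _ <-].
  apply: (@le_trans _ _ (\sum_(0 <= k < n) open_mass (U k))); last first.
    by apply: nneseries_lim_ge => k _ _; exact: open_mass_ge0.
  rewrite big_mkord -/(open_mass (V n)); elim: n => [|n IH].
    by rewrite big_ord0 /V big_ord0 open_mass0.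
  rewrite big_ord_recr/= VS; apply: (le_trans (open_massU (oV n) (oU n))).
  by rewrite leeD2r.
- by move=> n x; rewrite lee_fin.
- move=> n x; rewrite lee_fin !indicE ler_nat VS in_setU.
  by case: (x \in V n).
- by move=> n; exact: open_indic_lsc.
- move=> x; apply/eqP; rewrite eq_le; apply/andP; split.
    have [[n _ Un]|nU] := pselect ((\bigcup_n U n) x).
      apply: (le_sup_range (i := n.+1)); rewrite lee_fin !indicE ler_nat VS in_setU (mem_set Un) orbT.
      by case: (_ \in _).
    rewrite indicE memNset//; apply: (le_sup_range (i := 0%N)); rewrite lee_fin.
    by [].
  apply: ub_ereal_sup => _ [n _ <-]; rewrite lee_fin !indicE ler_nat.
  case: (boolP (x \in V n)) => // /set_mem; rewrite /V -bigcup_mkord => -[k _ Uk].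
  by rewrite mem_set//; exists k.
Qed.

Lemma riesz_outer_sigma_subadditive : sigma_subadditive riesz_outer.
Proof.
move=> A; rewrite /riesz_outer; apply: sigma_subadditive_inf; first by move=> *; exact: open_mass_ge0.
move=> U UP; apply: (@le_trans _ _ (open_mass (\bigcup_n U n))).
  apply: ereal_inf_lbound; exists (\bigcup_n U n) => //; split.
    by apply: bigcup_open => n _; exact: (UP n).1.
  by move=> x [n _ An]; exists n => //; exact: (UP n).2.
by apply: open_mass_bigcup => n; exact: (UP n).1.
Qed.

HB.instance Definition _ := isOuterMeasure.Build R X riesz_outer
  riesz_outer0 riesz_outer_ge0 riesz_outer_le riesz_outer_sigma_subadditive.

(** The set where [g > r] is an open neighbourhood of [A] only for [r < 1], so the bound is proved
    up to the factor [r], and [r] tends to 1. *)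
Lemma riesz_outer_le_daniell A g : (forall x, 0 <= g x) -> lower_semicontinuous g ->
  (forall x, A x -> 1 <= g x) -> riesz_outer A <= daniell g.
Proof.
move=> g0 lg Ag; apply/(lee_mul01Pr _ (riesz_outer_ge0 A)) => r /andP[r0 r1].
pose U := [set x | r%:E < g x].
have oU : open U by have /lower_semicontinuousP := lg; apply.
apply: (@le_trans _ _ (r%:E * open_mass U)).
  apply: lee_wpmul2l; first by rewrite lee_fin ltW.
  apply: ereal_inf_lbound; exists U => //; split => // x /Ag; rewrite /U/=.
  by apply: lt_le_trans; rewrite lte_fin.
apply: (le_trans (daniell_Z_ge _ (ltW r0))); apply: le_daniell => x.
rewrite indicE; case: (boolP (x \in U)) => [/set_mem/ltW|_]; first by rewrite mule1.
by rewrite mule0.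
Qed.

(** By outer regularity it suffices to cut an open [Q]. If [u n] increases to the indicator of [Q]
    meet [U], then [1_Q - u n] is l.s.c. and at least 1 on [Q \ U]. So [L (u n)] plus the outer
    measure of [Q \ U] is at most the mass of [Q]. *)
Lemma open_caratheodory U : open U -> riesz_outer.-caratheodory U.
Proof.
move=> oU; apply: le_caratheodory_measurable => A.
apply: le_ereal_inf_tmp => _ [Q [oQ AQ] <-].
apply: (@le_trans _ _ (riesz_outer (Q `&` U) + riesz_outer (Q `&` ~` U))).
  by apply: leeD; apply: riesz_outer_le; exact: setSI.
have oQU : open (Q `&` U) by exact: openI.
rewrite (riesz_outer_open oQU).
have i0 (V : set X) (x : X) : 0 <= (\1_V x)%:E :> \bar R by rewrite lee_fin.
have [u [cu u0 ui uE _]] := lsc_approx_sup hX lX sX (i0 (Q `&` U)) (open_indic_lsc oQU).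
rewrite /open_mass (daniell_approx cu u0 ui uE).
have u1 n x : (u n x <= \1_(Q `&` U) x)%R.
  by rewrite -lee_fin uE; exact: le_sup_range.
have uQ n x : (u n x <= \1_Q x)%R.
  apply: (le_trans (u1 n x)); rewrite !indicE ler_nat in_setI.
  by case: (x \in Q); case: (x \in U).
have pu n : Ccp (u n) by split.
apply: ereal_sup_addr_le; last move=> n.
- by move=> n; rewrite lee_fin L_ge0.
- by move=> n; rewrite lee_fin L_le.
- exact: riesz_outer_ge0.
pose g x : \bar R := (\1_Q x)%:E + (- u n x)%:E.
have g0 x : 0 <= g x by rewrite /g -EFinD lee_fin subr_ge0.
have lg : lower_semicontinuous g.
  rewrite /g => x a ax.
  have [b [d [bx dx abd]]] : exists b d : R, [/\ (b < \1_Q x)%R, (d < - u n x)%R & (a <= b + d)%R].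
    move: ax; rewrite -EFinD lte_fin => ax.
    exists (\1_Q x - (\1_Q x - u n x - a) / 2)%R, (- u n x - (\1_Q x - u n x - a) / 2)%R.
    by split; lra.
  have [V xV VP] : exists2 V, nbhs x V & forall y, V y -> b%:E < (\1_Q y)%:E.
    by apply: open_indic_lsc => //; rewrite lte_fin.
  have [W xW WP] : exists2 W, nbhs x W & forall y, W y -> d%:E < (- u n y)%:E.
    apply: (@continuous_lsc R X (fun y => - u n y)%R) => /=; last by rewrite lte_fin.
    by move=> y; apply: cvgN; exact: (cu n).1.
  exists (V `&` W); first exact: filterI.
  move=> y [/VP + /WP]; rewrite -EFinD !lte_fin => by1 dy.
  by rewrite (le_lt_trans abd)// ltrD.
apply: (@le_trans _ _ ((L (u n))%:E + daniell g)).
  rewrite leeD2l//; apply: riesz_outer_le_daniell => // x [Qx nU].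
  rewrite /g indicE mem_set// -EFinD lee_fin lerDl oppr_ge0.
  by apply: (le_trans (u1 n x)); rewrite indicE memNset// => -[].
rewrite -(daniell_Ccp (pu n)) -daniellD//.
- apply: le_daniell => x; rewrite /g/= -!EFinD lee_fin; lra.
- by move=> x; rewrite lee_fin.
- exact: continuous_lsc (cu n).1.
Qed.

Lemma borel_caratheodory (A : set (borel X)) : measurable A -> riesz_outer.-caratheodory A.
Proof.
move: A; apply: smallest_sub; last exact: open_caratheodory.
split.
- exact: caratheodory_measurable_set0.
- by move=> A mA; rewrite setTD; exact: caratheodory_measurable_setC.
- by move=> A mA; exact: caratheodory_measurable_bigcup.
Qed.

(** The outer measure is kept on all sets, not only on Borel ones: this is what makes the last
    clause of [is_radon] hold for every set. *)
Definition riesz_measure : set (borel X) -> \bar R := riesz_outer.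

Lemma riesz_measure_sigma_additive : semi_sigma_additive riesz_measure.
Proof.
move=> F mF tF mUF.
apply: (@caratheodory_measure_sigma_additive R X riesz_outer F) => //.
  by move=> i; exact: borel_caratheodory.
exact: borel_caratheodory.
Qed.

HB.instance Definition _ := isMeasure.Build _ (borel X) R riesz_measure
  riesz_outer0 riesz_outer_ge0 riesz_measure_sigma_additive.

Lemma riesz_measure_compact (K : set X) : compact K -> riesz_measure K < +oo.
Proof.
move=> cK; have [w [cw w01 wK _]] := compact_bump (R := R) hX lX cK openT (@subsetT _ K).
have cw' : Ccp w by split => // x; have /andP[] := w01 x.
apply: (@le_lt_trans _ _ (daniell (EFin \o w))); last by rewrite daniell_Ccp// ltry.
apply: riesz_outer_le_daniell => //.
- by move=> x; rewrite lee_fin; exact: cw'.2.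
- exact: continuous_lsc cw.1.
- by move=> x /wK /= ->.
Qed.

Lemma riesz_is_radon : is_radon riesz_measure.
Proof.
split; first exact: riesz_measure_compact; last first.
  move=> A; transitivity (riesz_outer A) => //; congr ereal_inf.
  apply/seteqP; split => _ [U [oU AU] <-]; exists U => //;
    by have := riesz_outer_open oU.
move=> U oU.
apply/eqP; rewrite eq_le; apply/andP; split; last first.
  by apply: ub_ereal_sup => _ [K [_ KU] <-]; exact: riesz_outer_le.
have [K [cK Kinc KU]] := @open_exhaustion R X hX lX sX U oU.
have mK n : measurable (K n : set (borel X)) by apply: closed_borel; exact: compact_closed.
have : riesz_measure (K n) @[n --> \oo] --> riesz_measure (\bigcup_n K n).
  apply: nondecreasing_cvg_mu => //.
  - exact: bigcupT_measurable.
  - by apply/nondecreasing_seqP => n; apply/subsetPset; exact: Kinc.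
rewrite KU => Kcv.
have Kl : limn (fun n => riesz_measure (K n)) = riesz_measure U by apply/cvg_lim.
apply: (@le_trans _ _ (limn (fun n => riesz_measure (K n)))); first by rewrite Kl.
apply: lime_le.
  apply: ereal_nondecreasing_is_cvgn; apply/nondecreasing_seqP => n.
  exact: riesz_outer_le.
apply: nearW => n; apply: ereal_sup_ubound; exists (K n) => //; split => //.
by rewrite -KU; exact: bigcup_sup.
Qed.

Lemma riesz_lint_fin u : Ccp u -> lint riesz_measure (EFin \o u) \is a fin_num.
Proof.
move=> [cu u0]; rewrite ge0_fin_numE; last by apply: lint_ge0 => x; rewrite lee_fin.
apply: le_lt_trans (Cc_lint_fin hX riesz_measure_compact cu).
apply: le_lint => x; rewrite /= lee_fin//; exact: ler_norm.
Qed.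

Lemma riesz_superlevel (u : X -> R) (e : R) : Ccp u -> (0 <= e)%R ->
  open [set x | (e < u x)%R] /\ riesz_measure [set x | (e < u x)%R] \is a fin_num.
Proof.
move=> [cu u0] e0; split.
  have /lower_semicontinuousP := continuous_lsc cu.1.
  by move=> /(_ e); under eq_set do rewrite lte_fin.
have [_ /compact_supportP[K cK uK]] := cu.
rewrite ge0_fin_numE//; apply: le_lt_trans (riesz_measure_compact cK).
apply: riesz_outer_le => x /= ux; apply: contrapT => /uK uK0.
by move: ux; rewrite uK0 ltNge e0.
Qed.

(* Both functionals of [min u e] lie between [e] times the measures of
   [u > e] and of [u > 0]; peel off [min u e] and recurse on [u - e]. *)
Lemma riesz_integral_approx (e : R) (N : nat) u : (0 < e)%R -> Ccp u ->
  (forall x, (u x <= N%:R * e)%R) ->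
  (`|L u - fine (lint riesz_measure (EFin \o u))| <=
     e * fine (riesz_measure [set x | (0 < u x)%R]))%R.
Proof.
move=> e0; elim: N u => [|N IH] u cu uN.
  have u0 : u = fun=> 0%R.
    apply/funext => x; apply/eqP; rewrite eq_le cu.2 andbT.
    by have := uN x; rewrite mul0r.
  rewrite u0; have := LZ (lexx 0%R) Ccp0; rewrite !mul0r => ->.
  rewrite [X in fine X](_ : _ = 0) ?subrr ?normr0; last first.
    by rewrite /lint integral0_eq.
  by apply: mulr_ge0; [exact: ltW|exact: fine_ge0].
pose v x := Num.min (u x) e; pose w x := Num.max (u x - e)%R 0%R.
have cv : Ccp v by apply: Ccp_min_cst => //; exact: ltW.
have uvw x : u x = (v x + w x)%R.
  rewrite /v /w; case: (leP (u x) e) => ue.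
    by rewrite (max_r _) ?addr0// subr_le0.
  by rewrite (max_l _) ?subr_ge0 ?ltW// addrC subrK.
have wE : w = fun x => (u x - v x)%R by apply/funext => x; rewrite uvw addrC addKr.
have cw : Ccp w.
  by rewrite wE; apply: CcpB => // x; rewrite /v ge_min lexx.
have wN x : (w x <= N%:R * e)%R.
  rewrite /w ge_max (mulr_ge0 (ler0n _ _) (ltW e0)) andbT.
  by have := uN x; rewrite -natr1 mulrDl mul1r; lra.
have {IH} := IH w cw wN.
have w0 : [set x | (0 < w x)%R] = [set x | (e < u x)%R].
  by apply/seteqP; split => x /=; rewrite /w lt_max ltxx orbF subr_gt0.
rewrite w0.
have [oe fe] := riesz_superlevel cu (ltW e0).
have [op fp] := riesz_superlevel cu (lexx 0%R).
set a := fine (riesz_measure [set x | (e < u x)%R]).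
set b := fine (riesz_measure [set x | (0 < u x)%R]).
have aE : riesz_measure [set x | (e < u x)%R] = a%:E by rewrite fineK.
have bE : riesz_measure [set x | (0 < u x)%R] = b%:E by rewrite fineK.
have Lu : L u = (L v + L w)%R by rewrite -LD//; congr L; apply/funext => x; exact: uvw.
have mE z : Ccp z -> measurable_fun [set: borel X] (EFin \o z).
  by move=> cz; apply: continuous_borel; exact: cz.1.1.
have Iu : lint riesz_measure (EFin \o u) =
    lint riesz_measure (EFin \o v) + lint riesz_measure (EFin \o w).
  rewrite -lintD; [|by move=> x; rewrite /= lee_fin; exact: cv.2|
    by move=> x; rewrite /= lee_fin; exact: cw.2|exact: mE|exact: mE].
  by congr lint; apply/funext => x /=; rewrite uvw EFinD.
rewrite Iu (fineD (riesz_lint_fin cv) (riesz_lint_fin cw)) Lu.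
set Iv := fine (lint _ (EFin \o v)); set Iw := fine (lint _ (EFin \o w)).
have IvE : lint riesz_measure (EFin \o v) = Iv%:E by rewrite fineK//; exact: riesz_lint_fin.
have e00 := ltW e0.
have lev x : (e%:E * (\1_[set x | (e < u x)%R] x)%:E <= (v x)%:E :> \bar R).
  rewrite -EFinM lee_fin indicE; case: (boolP (x \in _)) => [/set_mem/= ux|_].
    by rewrite mulr1 /v le_min lexx ltW.
  by rewrite mulr0; exact: cv.2.
have vle x : ((v x)%:E <= e%:E * (\1_[set x | (0 < u x)%R] x)%:E :> \bar R).
  rewrite -EFinM lee_fin indicE; case: (boolP (x \in _)) => [_|/negP xu].
    by rewrite mulr1 /v ge_min lexx orbT.
  rewrite mulr0 /v ge_min leNgt; apply/orP; left; apply/negP => ux.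
  by apply: xu; exact/mem_set.
have i0 (V : set X) (x : X) : 0 <= (\1_V x)%:E :> \bar R by rewrite lee_fin.
have mi V : open V -> measurable_fun [set: borel X] (fun x => (\1_V x)%:E : \bar R).
  by move=> oV; exact: lsc_measurable (open_indic_lsc oV).
have li V : open V -> lint riesz_measure (fun x => e%:E * (\1_V x)%:E) = e%:E * riesz_measure V.
  move=> oV; rewrite lintZ//; last exact: mi.
  by rewrite lint_indic//; exact: open_borel.
have I1 : (e * a <= Iv)%R.
  rewrite -lee_fin EFinM -aE -IvE -li//; apply: le_lint => // x.
  by rewrite mule_ge0.
have I2 : (Iv <= e * b)%R.
  rewrite -lee_fin EFinM -bE -IvE -li//; apply: le_lint => // x.
  by rewrite lee_fin; exact: cv.2.
have L1 : (e * a <= L v)%R.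
  rewrite -lee_fin EFinM -aE -daniell_Ccp// /riesz_measure riesz_outer_open//.
  by apply: (le_trans (daniell_Z_ge _ e00)); exact: le_daniell.
have L2 : (L v <= e * b)%R.
  rewrite -lee_fin EFinM -bE /riesz_measure riesz_outer_open// -lee_pdivrMl//.
  rewrite -daniell_Ccp//; apply: le_trans (le_trans (daniell_Z_ge _ _) _) => //.
    by rewrite invr_ge0.
  apply: le_daniell => x /=; by rewrite lee_pdivrMl.
rewrite !ler_norml => /andP[? ?]; apply/andP; split; lra.
Qed.

Lemma riesz_integral u : Ccp u -> lint riesz_measure (EFin \o u) = (L u)%:E.
Proof.
move=> cu; rewrite -(fineK (riesz_lint_fin cu)); congr EFin.
apply/esym/eqP; rewrite -subr_eq0 -normr_le0; apply/ler_addgt0Pr => e e0.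
rewrite add0r.
have [M M0 uM] := Cc_bounded cu.1.
set b := fine (riesz_measure [set x | (0 < u x)%R]).
have b0 : (0 <= b)%R by rewrite fine_ge0.
(* The layer thickness gives a total error [d * b <= e]; about [M / d] layers exhaust a function
   bounded by [M]. *)
pose d := (e / (b + 1))%R; have d0 : (0 < d)%R by rewrite divr_gt0// ltr_wpDl.
have := @riesz_integral_approx d (Num.bound (M / d)) u d0 cu _.
move=> /(_ _)/le_trans; apply.
  move=> x; apply: (le_trans (ler_norm _)); apply: (le_trans (uM x)).
  rewrite -ler_pdivrMr//; apply/ltW/archi_boundP; rewrite divr_ge0// ltW//.
rewrite -/b /d mulrAC ler_pdivrMr ?ltr_wpDl// ler_pM2l//.
by rewrite lerDl.
Qed.

End DaniellExtension.

(** * Radon measures built from Borel measures, and Tonelli's theorem *)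

Section RadonConstructions.
Context {R : realType} {X : ptopologicalType}.
Implicit Types (f g h : X -> \bar R) (u v : X -> R) (mu nu : radon R X).
Hypothesis hX : hausdorff_space X.
Hypothesis lX : locally_compact [set: X].
Hypothesis sX : @second_countable X.
Local Open Scope ereal_scope.

Theorem riesz_representation (L : (X -> R) -> R) :
  (forall u v, Ccp u -> Ccp v -> L (fun x => u x + v x)%R = (L u + L v)%R) ->
  (forall (c : R) u, (0 <= c)%R -> Ccp u -> L (fun x => c * u x)%R = (c * L u)%R) ->
  (forall u, Ccp u -> (0 <= L u)%R) ->
  exists mu : radon R X, forall u, Ccp u -> lint mu (EFin \o u) = (L u)%:E.
Proof.
move=> LD LZ L0; exists (Radon (riesz_is_radon hX lX sX LD LZ L0)) => u cu.
exact: riesz_integral.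
Qed.

Lemma radon_compact mu (K : set X) : compact K -> mu K < +oo.
Proof. by case: (radon_measureP mu) => H _ _; apply: H. Qed.

Lemma lint_Ccp_fin (m : {measure set (borel X) -> \bar R}) u :
  (forall K : set X, compact K -> m K < +oo) -> Ccp u ->
  lint m (EFin \o u) \is a fin_num.
Proof.
move=> mK [cu u0]; rewrite ge0_fin_numE; last by apply: lint_ge0 => x; rewrite lee_fin.
apply: le_lt_trans (Cc_lint_fin hX mK cu).
by apply: le_lint => x; rewrite /= lee_fin//; exact: ler_norm.
Qed.

Lemma Ccp_measurable u : Ccp u -> measurable_fun [set: borel X] (EFin \o u).
Proof. by move=> cu; apply: continuous_borel; exact: cu.1.1. Qed.

Lemma lint_lsc_eq (m1 m2 : {measure set (borel X) -> \bar R}) :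
  (forall u, Ccp u -> lint m1 (EFin \o u) = lint m2 (EFin \o u)) ->
  forall g, (forall x, 0 <= g x) -> lower_semicontinuous g -> lint m1 g = lint m2 g.
Proof.
move=> m12 g g0 lg; have [u [cu u0 ui uE uI]] := lsc_approx_sup hX lX sX g0 lg.
by rewrite !uI; congr ereal_sup; apply/seteqP; split => _ [n _ <-]; exists n => //;
   rewrite m12//; split.
Qed.

Lemma open_cover_finite (m : {measure set (borel X) -> \bar R}) :
  (forall K : set X, compact K -> m K < +oo) ->
  exists V : nat -> set X, [/\ forall n, open (V n), \bigcup_n V n = setT &
   forall n, exists2 K, compact K & V n `<=` K].
Proof.
move=> mK.
(* Approximating the constant [+oo] gives test functions whose positivity sets cover [X], each
   contained in a compact support. *)
have [u [cu u0 ui ug ulim]] := lsc_approx hX lX sX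
  (fun x => le0y : 0 <= (fun=> +oo : \bar R) x)
  (fun x a ax => ex_intro2 _ _ setT filterT (fun y _ => ltry a)).
exists (fun n => [set x | (0 < u n x)%R]); split.
- move=> n; have /lower_semicontinuousP := continuous_lsc (cu n).1.
  by move=> /(_ 0%R); under eq_set do rewrite lte_fin.
- apply/seteqP; split => // x _; have [|n ?] := ulim x 0%R; first by rewrite ltry.
  by exists n.
- move=> n; have [_ /compact_supportP[K cK uK]] := cu n; exists K => // x /= ux.
  by apply: contrapT => /uK H; rewrite H ltxx in ux.
Qed.

Lemma borel_measure_unique (m1 m2 : {measure set (borel X) -> \bar R}) :
  (forall K : set X, compact K -> m1 K < +oo) ->
  (forall u, Ccp u -> lint m1 (EFin \o u) = lint m2 (EFin \o u)) ->
  forall A : set (borel X), measurable A -> m1 A = m2 A.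
Proof.
move=> m1K m12; have [V [oV VT VK]] := open_cover_finite m1K.
apply: (@g_sigma_algebra_measure_unique _ R (borel X) open _ V) => //.
- exact: open_borel.
- by move=> A B oA oB; exact: openI.
- move=> A oA; rewrite -(lint_indic m1 (open_borel oA)) -(lint_indic m2 (open_borel oA)).
  by apply: lint_lsc_eq => //; exact: open_indic_lsc.
- move=> n; have [K cK VKn] := VK n; apply: le_lt_trans (m1K K cK).
  apply: le_measure => //; rewrite inE; first exact: open_borel.
  by apply: closed_borel; exact: compact_closed.
Qed.

(** Sums, multiples and restrictions of Radon measures are controlled on Borel sets only;
    representing their integrals by Riesz gives a measure with the same Borel values that is regular
    on all sets. *)
Lemma radon_of_borel (m : {measure set (borel X) -> \bar R}) :
  (forall K : set X, compact K -> m K < +oo) ->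
  exists mu, forall A : set (borel X), measurable A -> mu A = m A.
Proof.
move=> mK; pose L u := fine (lint m (EFin \o u)).
have u0 u : Ccp u -> forall x, 0 <= (u x)%:E by move=> cu x; rewrite lee_fin; exact: cu.2.
have [| | |mu muL] := @riesz_representation L.
- move=> u v cu cv; rewrite /L -fineD; try exact: lint_Ccp_fin.
  congr fine; rewrite -lintD; try exact: Ccp_measurable; try exact: u0.
  by congr lint; apply/funext => x.
- move=> c u c0 cu; rewrite /L -[c in RHS]/(fine c%:E) -fineM//; last exact: lint_Ccp_fin.
  by congr fine; rewrite -lintZ//; [exact: u0|exact: Ccp_measurable].
- by move=> u cu; apply: fine_ge0; apply: lint_ge0; exact: u0.
exists mu; apply: borel_measure_unique => [K|u cu]; first exact: radon_compact.
by rewrite muL// /L fineK//; exact: lint_Ccp_fin.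
Qed.

Lemma radon_comb mu nu (s t : R) : (0 <= s)%R -> (0 <= t)%R ->
  exists rho : radon R X, forall A : set (borel X), measurable A ->
    rho A = s%:E * mu A + t%:E * nu A.
Proof.
move=> s0 t0; pose s' := NngNum s0; pose t' := NngNum t0.
have [K cK|rho rhoE] := @radon_of_borel (measure_add (mscale s' mu) (mscale t' nu)).
  apply: (@le_lt_trans _ _ (s%:E * mu K + t%:E * nu K)).
    by rewrite -(measure_addE (mscale s' mu) (mscale t' nu)).
  by apply: lte_add_pinfty; apply: lte_mul_pinfty => //; exact: radon_compact.
by exists rho => A mA; rewrite rhoE//; exact: (measure_addE (mscale s' mu) (mscale t' nu)).
Qed.

Lemma radon_scale mu (s : R) : (0 <= s)%R ->
  exists rho : radon R X, forall A : set (borel X), measurable A -> rho A = s%:E * mu A.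
Proof.
move=> s0; have [rho rhoE] := radon_comb mu mu s0 (lexx 0%R).
by exists rho => A mA; rewrite rhoE// mul0e adde0.
Qed.

Lemma radon_restr mu (D : set (borel X)) : measurable D ->
  exists rho : radon R X, forall A : set (borel X), measurable A -> rho A = mu (A `&` D).
Proof.
move=> mD; have [K cK|rho rhoE] := @radon_of_borel (mrestr mu mD).
  apply: le_lt_trans (radon_compact mu cK).
  have bK : measurable (K : set (borel X)) by apply: closed_borel; exact: compact_closed.
  by apply: le_measure => //; rewrite inE//; exact: measurableI.
by exists rho.
Qed.

Lemma lint_scale (m m' : {measure set (borel X) -> \bar R}) (s : R) f :
  (0 <= s)%R ->
  (forall A : set (borel X), measurable A -> m' A = s%:E * m A) ->
  measurable_fun [set: borel X] f -> (forall x, 0 <= f x) ->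
  lint m' f = s%:E * lint m f.
Proof.
move=> s0 m'E mf f0; rewrite (@lint_comb _ _ s 0%R s0 (lexx 0%R) m' m m)//.
  by rewrite mul0e adde0.
by move=> A mA; rewrite m'E// mul0e adde0.
Qed.

Lemma radon_sigma_finite mu : sigma_finite setT (mu : set (borel X) -> \bar R).
Proof.
have [V [oV VT VK]] := open_cover_finite (@radon_compact mu).
exists V => // n; split; first exact: open_borel.
have [K cK VKn] := VK n; apply: le_lt_trans (radon_compact mu cK).
apply: le_measure => //; rewrite inE; first exact: open_borel.
by apply: closed_borel; exact: compact_closed.
Qed.

Lemma sigma_finite_fubini (m1 m2 : {measure set (borel X) -> \bar R})
    (F : borel X * borel X -> \bar R) :
  sigma_finite setT m1 -> sigma_finite setT m2 ->
  measurable_fun setT F -> (forall p, 0 <= F p) ->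
  lint m1 (fun x => lint m2 (fun y => F (x, y))) =
  lint m2 (fun y => lint m1 (fun x => F (x, y))).
Proof.
case: m1 m2 => f1 c1 [f2 c2] s1 s2 mF F0.
pose m1 : {sigma_finite_measure set (borel X) -> \bar R} :=
  HB.pack f1 c1 (Measure_isSigmaFinite.Build _ _ _ (Measure.Pack c1) s1).
pose m2 : {sigma_finite_measure set (borel X) -> \bar R} :=
  HB.pack f2 c2 (Measure_isSigmaFinite.Build _ _ _ (Measure.Pack c2) s2).
have := @fubini_tonelli _ _ _ _ _ m1 m2 F mF F0.
rewrite /lint.
have E1 f : \int[m1]_x f x = \int[Measure.Pack c1]_x f x by apply: eq_measure_integral.
have E2 f : \int[m2]_x f x = \int[Measure.Pack c2]_x f x by apply: eq_measure_integral.
rewrite E1 E2.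
by under eq_integral do rewrite E2; under [RHS]eq_integral do rewrite E1.
Qed.

Lemma radon_fubini mu nu (F : borel X * borel X -> \bar R) :
  measurable_fun setT F -> (forall p, 0 <= F p) ->
  lint nu (fun x => lint mu (fun y => F (x, y))) =
  lint mu (fun y => lint nu (fun x => F (x, y))).
Proof. by move=> mF F0; apply: sigma_finite_fubini => //; exact: radon_sigma_finite. Qed.

End RadonConstructions.

Section RadonInt.
Context {R : realType} {X : ptopologicalType}.
Implicit Types (f g h : X -> \bar R) (u v : X -> R) (mu nu : radon R X).
Hypothesis hX : hausdorff_space X.

Definition radon_int mu u : R := fine (lint mu (EFin \o u)).

Lemma radon_intE mu u : Ccp u -> lint mu (EFin \o u) = (radon_int mu u)%:E.
Proof. by move=> cu; rewrite fineK//; apply: lint_Ccp_fin => //; exact: radon_compact. Qed.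

Lemma Ccp_lee0 u : Ccp u -> forall x, (0 <= (EFin \o u) x)%E.
Proof. by move=> cu x; rewrite lee_fin; exact: cu.2. Qed.

Lemma radon_int_ge0 mu u : Ccp u -> 0 <= radon_int mu u.
Proof. by move=> cu; apply: fine_ge0; apply: lint_ge0; exact: Ccp_lee0. Qed.

Lemma le_radon_int mu u v : Ccp u -> Ccp v -> (forall x, u x <= v x) ->
  radon_int mu u <= radon_int mu v.
Proof.
move=> cu cv uv; rewrite -lee_fin -!radon_intE//; apply: le_lint; first exact: Ccp_lee0.
by move=> x; rewrite lee_fin.
Qed.

Lemma radon_intD mu u v : Ccp u -> Ccp v ->
  radon_int mu (fun x => u x + v x) = radon_int mu u + radon_int mu v.
Proof.
move=> cu cv; apply/EFin_inj; rewrite EFinD -!radon_intE//; last exact: CcpD.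
by rewrite -lintD; [|exact: Ccp_lee0|exact: Ccp_lee0|exact: Ccp_measurable|exact: Ccp_measurable].
Qed.

Lemma radon_intZ mu (c : R) u : 0 <= c -> Ccp u ->
  radon_int mu (fun x => c * u x) = c * radon_int mu u.
Proof.
move=> c0 cu; apply/EFin_inj; rewrite EFinM -!radon_intE//; last exact: CcpZ.
by rewrite -lintZ//; [exact: Ccp_lee0|exact: Ccp_measurable].
Qed.

Lemma Ccp_max u v : Ccp u -> Ccp v -> Ccp (fun x => Num.max (u x) (v x)).
Proof. by move=> [cu u0] [cv v0]; split=> [|x]; [exact: Cc_max|rewrite le_max u0]. Qed.

End RadonInt.

(** * Maxima of tensor products and their potentials *)

Section KernelApproximation.
Context {R : realType} {X : ptopologicalType}.
Implicit Types (f g h : X -> \bar R) (u v : X -> R) (mu nu : radon R X).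
Hypothesis hX : hausdorff_space X.
Hypothesis lX : locally_compact [set: X].
Hypothesis sX : @second_countable X.
Variables a b : nat -> X -> R.
Hypothesis ca : forall n, Ccp (a n).
Hypothesis cb : forall n, Ccp (b n).

Definition tensor_max n (p : X * X) : R :=
  cumul_max (fun k p => a k p.1 * b k p.2) n p.

Lemma tensor_max_Ccp n x : Ccp (fun y => tensor_max n (x, y)).
Proof.
elim: n => [|n IH]; first exact: Ccp0.
exact: (Ccp_max hX IH (CcpZ hX ((ca n).2 x) (cb n))).
Qed.

Lemma tensor_max_support n : exists2 K, compact K & forall x y, ~ K x -> tensor_max n (x, y) = 0.
Proof.
elim: n => [|n [K cK IH]]; first by exists set0 => //; exact: compact0.
have [_ /compact_supportP[L cL aL]] := (ca n).1.
exists (K `|` L); first exact: compactU.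
move=> x y nKL; rewrite /tensor_max /= -/(tensor_max _ _) IH; last by move=> Kx; apply: nKL; left.
by rewrite aL ?mul0r ?maxxx// => Lx; apply: nKL; right.
Qed.

Lemma tensor_max_lip n x x' y :
  tensor_max n (x, y) <= tensor_max n (x', y) + \sum_(k < n) `|a k x - a k x'| * b k y.
Proof.
elim: n => [|n IH]; first by rewrite big_ord0 addr0.
rewrite big_ord_recr /tensor_max /= -!/(tensor_max _ _) ge_max; apply/andP; split.
  apply: (le_trans IH); apply: lerD; first by rewrite le_max lexx.
  by rewrite lerDl mulr_ge0//; exact: (cb n).2.
have -> : a n x * b n y = a n x' * b n y + (a n x - a n x') * b n y by ring.
apply: lerD; first by rewrite le_max lexx orbT.
rewrite -[leLHS]add0r; apply: lerD.
  by apply: sumr_ge0 => k _; rewrite mulr_ge0//; exact: (cb k).2.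
by apply: ler_wpM2r; [exact: (cb n).2|exact: ler_norm].
Qed.

Definition tensor_pot mu n x : R := radon_int mu (fun y => tensor_max n (x, y)).

Lemma tensor_pot_ge0 mu n x : 0 <= tensor_pot mu n x.
Proof. by apply: radon_int_ge0 => //; exact: tensor_max_Ccp. Qed.

Lemma Ccp_sum n (c : nat -> R) : (forall k, 0 <= c k) -> Ccp (fun y => \sum_(k < n) c k * b k y).
Proof.
move=> c0; elim: n => [|n IH]; first by under eq_fun do rewrite big_ord0; exact: Ccp0.
by under eq_fun do rewrite big_ord_recr/=; apply: CcpD => //; exact: CcpZ.
Qed.

Lemma radon_int_sum mu n (c : nat -> R) : (forall k, 0 <= c k) ->
  radon_int mu (fun y => \sum_(k < n) c k * b k y) = \sum_(k < n) c k * radon_int mu (b k).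
Proof.
move=> c0; elim: n => [|n IH].
  rewrite big_ord0 /radon_int/=; under eq_fun do rewrite big_ord0.
  by rewrite /lint integral0.
rewrite big_ord_recr/= -IH -radon_intZ// -radon_intD//; [|exact: Ccp_sum|exact: CcpZ].
by congr radon_int; apply/funext => y; rewrite big_ord_recr.
Qed.

Lemma tensor_pot_lip mu n x x' :
  tensor_pot mu n x <= tensor_pot mu n x' + \sum_(k < n) `|a k x - a k x'| * radon_int mu (b k).
Proof.
rewrite -(@radon_int_sum mu n (fun k => `|a k x - a k x'|))// -radon_intD//;
  [|exact: tensor_max_Ccp|exact: (@Ccp_sum n (fun k => `|a k x - a k x'|))].
apply: le_radon_int => //; first exact: tensor_max_Ccp.
  by apply: CcpD => //; [exact: tensor_max_Ccp|exact: (@Ccp_sum n (fun k => `|a k x - a k x'|))].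
by move=> y; exact: tensor_max_lip.
Qed.

(* The modulus of continuity depends on [mu] only through the integrals of
   the [b k], which makes these potentials equicontinuous along a vaguely
   convergent filter. *)
Lemma near_modulus n (B : nat -> R) x (e : R) : 0 < e -> (forall k, 0 <= B k) ->
  \forall x' \near x, \sum_(k < n) `|a k x - a k x'| * B k <= e.
Proof.
move=> e0 B0; elim: n e e0 => [|n IH] e e0.
  by near=> x'; rewrite big_ord0 ltW.
have e20 : 0 < e / 2 by rewrite divr_gt0.
have d0 : 0 < e / 2 / (B n + 1) by rewrite divr_gt0// ltr_wpDl.
have := (ca n).1.1 x => /cvgrPdist_le/(_ _ d0) an.
near=> x'; rewrite big_ord_recr/= (splitr e); apply: lerD.
  by near: x'; exact: IH.
have an' : `|a n x - a n x'| <= e / 2 / (B n + 1) by near: x'; exact: an.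
apply: (le_trans (ler_wpM2r (B0 n) an')).
rewrite mulrAC ler_pdivrMr ?ltr_wpDl// ler_pM2l//.
by rewrite lerDl.
Unshelve. all: by end_near. Qed.

Lemma tensor_pot_Ccp mu n : Ccp (tensor_pot mu n).
Proof.
split; last exact: tensor_pot_ge0.
split.
  move=> x; apply/cvgrPdist_le => e e0.
  have := @near_modulus n (fun k => radon_int mu (b k)) x e e0 _.
  move=> /(_ (fun k => radon_int_ge0 mu (cb k))); apply: filterS => x' H.
  rewrite ler_distl; apply/andP; split.
    rewrite lerBlDr; apply: (le_trans (tensor_pot_lip mu n x' x)); rewrite lerD2l.
    by under eq_bigr do rewrite distrC.
  by apply: (le_trans (tensor_pot_lip mu n x x')); rewrite lerD2l.
have [K cK KP] := tensor_max_support n.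
apply: (has_compact_supportW hX cK) => x nK.
rewrite /tensor_pot /radon_int (_ : EFin \o _ = cst 0%E) ?/lint ?integral0//.
by apply/funext => y /=; rewrite KP.
Qed.

Lemma tensor_max_measurable n :
  measurable_fun [set: borel X * borel X] (fun p => (tensor_max n p)%:E).
Proof.
apply/measurable_EFinP; elim: n => [|n IH]; first exact: measurable_cst.
apply: measurable_maxr => //; apply: measurable_funM.
- apply: (measurableT_comp (f := (a n : borel X -> R))) => //.
  by apply/measurable_EFinP; exact: Ccp_measurable.
- apply: (measurableT_comp (f := (b n : borel X -> R))) => //.
  by apply/measurable_EFinP; exact: Ccp_measurable.
Qed.

End KernelApproximation.

(** * The vague topology and compactness of energy balls *)

Section VagueTopology.
Context {R : realType} {X : ptopologicalType}.
Implicit Types (u v : X -> R) (mu nu : radon R X).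
Hypothesis hX : hausdorff_space X.

Lemma initial_cvgP (S : choiceType) (T : topologicalType) (f : S -> T)
    (F : set_system S) (s : S) : Filter F ->
  (F --> (s : initial_topology f)) <-> (f @ F --> f s).
Proof.
move=> FF; split.
  by move=> Fs A fsA; apply: Fs; exact: (@initial_continuous S T f s A fsA).
move=> Ffs U; rewrite (@nbhsE (initial_topology f)) => -[V [[W oW <-] Ws] VU].
apply: filterS VU _; apply: Ffs.
by apply: open_nbhs_nbhs; split.
Qed.

Lemma vague_cvgP (F : set_system (radon R X)) mu : Filter F ->
  (F --> mu) <-> (forall phi : test_function R X,
    test_integral phi nu @[nu --> F] --> test_integral phi mu).
Proof.
move=> FF; split.
  move=> Fmu phi; apply/initial_cvgP.
  by have /cvg_sup/(_ phi) := Fmu.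
move=> H; apply/cvg_sup => phi; apply/initial_cvgP; exact: H.
Qed.

Lemma vague_cvg_Ccp (F : set_system (radon R X)) mu u : Filter F ->
  F --> mu -> Ccp u -> radon_int nu u @[nu --> F] --> radon_int mu u.
Proof. by move=> FF /vague_cvgP H [cu u0]; exact: (H (exist _ u cu)). Qed.

Lemma vague_cvg_from_Ccp (F : set_system (radon R X)) mu : Filter F ->
  (forall u, Ccp u -> radon_int nu u @[nu --> F] --> radon_int mu u) -> F --> mu.
Proof.
move=> FF H; apply/vague_cvgP => -[u cu].
pose up x := Num.max (u x) 0; pose un x := Num.max (- u x) 0.
have cN : Cc R X (fun x => - u x).
  by have := CcZ hX (-1) cu; under eq_fun do rewrite mulN1r.
have cp : Ccp up by exact: Ccp_pos.
have cn : Ccp un by exact: Ccp_pos.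
have E nu : test_integral (exist _ u cu) nu = radon_int nu up - radon_int nu un.
  rewrite /test_integral /Rintegral /= integralE.
  have -> : ((fun x => (u x)%:E)^\+)%E = EFin \o up.
    by apply/funext => x; rewrite /up /= funeposE EFin_max.
  have -> : ((fun x => (u x)%:E)^\-)%E = EFin \o un.
    by apply/funext => x; rewrite /un /= funenegE EFin_max.
  by rewrite -!/(lint _ _) !radon_intE// -EFinB.
by under eq_fun do rewrite E; rewrite E; apply: cvgB; exact: H.
Qed.

End VagueTopology.

Section Kernel.
Context {R : realType} {X : ptopologicalType}.
Implicit Types (f g h : X -> \bar R) (u v : X -> R) (mu nu : radon R X).
Hypothesis hX : hausdorff_space X.
Hypothesis lX : locally_compact [set: X].
Hypothesis sX : @second_countable X.
Variable G : X * X -> \bar R.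
Hypothesis kG : is_kernel G.
Local Open Scope ereal_scope.

Lemma kernel_ge0 p : 0 <= G p. Proof. by case: kG. Qed.
Lemma kernel_sym x y : G (x, y) = G (y, x). Proof. by case: kG. Qed.

Lemma kernel_tensor : exists a b : nat -> X -> R,
  [/\ forall n, Ccp (a n), forall n, Ccp (b n) &
   forall p, G p = ereal_sup (range (fun n => (tensor_max a b n p)%:E))].
Proof.
have [G0 lG _ _] := kG.
have [a [b [cab ab0 abG abl]]] := kernel_approx hX lX sX G0 lG.
exists a, b; split.
- by move=> n; split; [exact: (cab n).1|move=> x; exact: (ab0 n x).1].
- by move=> n; split; [exact: (cab n).2|move=> x; exact: (ab0 n x).2].
- move=> p; apply: ereal_sup_approx.
    by move=> n; apply: cumul_max_lee => // k; exact: abG.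
  move=> c /abl[n cn]; exists n.+1; apply: (lt_le_trans cn).
  exact: (le_cumul_max (fun k p => (a k p.1 * b k p.2)%R)).
Qed.

Section Tensor.
Variables a b : nat -> X -> R.
Hypothesis ca : forall n, Ccp (a n).
Hypothesis cb : forall n, Ccp (b n).
Hypothesis GE : forall p, G p = ereal_sup (range (fun n => (tensor_max a b n p)%:E)).

Lemma potential_sup mu x :
  potential G mu x = ereal_sup (range (fun n => (tensor_pot a b mu n x)%:E)).
Proof.
rewrite /potential /rint -/(lint _ _) (@lint_sup _ _ _ (fun n y => (tensor_max a b n (x, y))%:E)).
- congr ereal_sup; apply/seteqP; split => _ [n _ <-]; exists n => //;
  by rewrite -radon_intE//; exact: tensor_max_Ccp.
- by move=> n y; rewrite lee_fin; exact: cumul_max_ge0.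
- by move=> n; apply: Ccp_measurable; exact: tensor_max_Ccp.
- by move=> n y; rewrite lee_fin; exact: cumul_max_le.
- by move=> y; exact: GE.
Qed.

Lemma tensor_pot_le mu n x : (tensor_pot a b mu n x <= tensor_pot a b mu n.+1 x)%R.
Proof.
apply: le_radon_int => //; try exact: tensor_max_Ccp.
by move=> y; exact: cumul_max_le.
Qed.

Lemma mutual_energy_sup mu nu :
  rint nu (potential G mu) = ereal_sup (range (fun n => (radon_int nu (tensor_pot a b mu n))%:E)).
Proof.
rewrite /rint -/(lint _ _) (@lint_sup _ _ _ (fun n x => (tensor_pot a b mu n x)%:E)).
- congr ereal_sup; apply/seteqP; split => _ [n _ <-]; exists n => //;
  by rewrite -radon_intE//; exact: tensor_pot_Ccp.
- by move=> n x; rewrite lee_fin; exact: tensor_pot_ge0.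
- by move=> n; apply: Ccp_measurable; exact: tensor_pot_Ccp.
- by move=> n y; rewrite lee_fin; exact: tensor_pot_le.
- by move=> y; exact: potential_sup.
Qed.

Lemma kernel_measurable_tensor : measurable_fun [set: borel X * borel X] G.
Proof.
rewrite (_ : G = fun p => ereal_sup (range (fun n => (tensor_max a b n p)%:E))).
  apply: (@measurable_sup_range _ _ (borel X * borel X)%type
    (fun n p => (tensor_max a b n p)%:E)) => n.
  exact: tensor_max_measurable.
by apply/funext.
Qed.

End Tensor.

Lemma potential_ge0 mu x : 0 <= potential G mu x.
Proof. by apply: integral_ge0 => y _; exact: kernel_ge0. Qed.

Lemma potential_lsc mu : lower_semicontinuous (potential G mu).
Proof.
have [a [b [ca cb GE]]] := kernel_tensor.
rewrite (_ : potential G mu = fun x => ereal_sup (range (fun n => (tensor_pot a b mu n x)%:E))).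
  by apply: lsc_ereal_sup => n; apply: continuous_lsc; exact: (tensor_pot_Ccp hX ca cb mu n).1.1.
by apply/funext => x; exact: potential_sup.
Qed.

Lemma potential_measurable mu : measurable_fun [set: borel X] (potential G mu).
Proof. by apply: lsc_measurable; exact: potential_lsc. Qed.

(** Tonelli needs [G] measurable for the product of the Borel sigma-algebras; the tensor
    approximation provides this. *)
Lemma mutual_energy_sym mu nu : rint nu (potential G mu) = rint mu (potential G nu).
Proof.
have [a [b [ca cb GE]]] := kernel_tensor.
rewrite /rint /potential /rint -!/(lint _ _).
rewrite [RHS](_ : _ = lint mu (fun y => lint nu (fun x => G (x, y)))).
  by apply: radon_fubini => //; [exact: (kernel_measurable_tensor ca cb GE)|exact: kernel_ge0].
congr lint; apply/funext => y; congr lint; apply/funext => x; exact: kernel_sym.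
Qed.

Lemma energy_ge0 mu nu : 0 <= rint nu (potential G mu).
Proof. by apply: integral_ge0 => x _; exact: potential_ge0. Qed.

Lemma enorm_sqr mu : enorm G mu ^+ 2 = rint mu (potential G mu).
Proof. by rewrite sqr_sqrte// energy_ge0. Qed.

Lemma enorm_ge0 mu : 0 <= enorm G mu.
Proof. exact: sqrte_ge0. Qed.

Lemma enorm_le mu (r : R) : (0 <= r)%R ->
  (enorm G mu <= r%:E) = (rint mu (potential G mu) <= (r ^+ 2)%:E).
Proof.
move=> r0; rewrite -[r%:E]gee0_abs ?lee_fin// -sqrte_sqr lee_sqrt//.
by rewrite -EFin_expe lee_fin sqr_ge0.
Qed.

(* [G(x,x) > 0] bounds the mass that a measure of bounded energy puts near x. *)
Lemma energy_ball_mass (r : R) (K : set X) : (0 <= r)%R -> compact K ->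
  exists2 B : R, (0 <= B)%R & forall mu, enorm G mu <= r%:E -> mu K <= B%:E.
Proof.
move=> r0 cK.
(* The local induction runs through arbitrary subsets of [K], so the mass is bounded on a Borel set
   containing them. *)
suff [B [S [B0 mS KS SB]]] : exists (B : R) (S : set (borel X)),
    [/\ (0 <= B)%R, measurable S, K `<=` S & forall mu, enorm G mu <= r%:E -> mu S <= B%:E].
  exists B => // mu /SB; apply: le_trans; apply: le_measure => //; rewrite inE//.
  by apply: closed_borel; exact: compact_closed.
apply: (compact_local_ind (P := fun K => exists (B : R) (S : set (borel X)),
    [/\ (0 <= B)%R, measurable S, K `<=` S & forall mu, enorm G mu <= r%:E -> mu S <= B%:E]) cK).
- by exists 0%R, set0; split => // mu _; rewrite measure0.
- by move=> A C AC [B [S [? ? CS ?]]]; exists B, S; split => //; exact: subset_trans CS.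
- move=> A1 A2 [B1 [S1 [? ? ? H1]]] [B2 [S2 [? ? ? H2]]].
  exists (B1 + B2)%R, (S1 `|` S2); split.
  + exact: addr_ge0.
  + exact: measurableU.
  + exact: setUSS.
  + move=> mu muE; apply: (le_trans (measureU2 _ _ _)) => //.
    by rewrite EFinD; apply: leeD; [exact: H1|exact: H2].
- move=> x Kx; have [_ lG _ Gxx] := kG.
  have [d [d0 dG]] : exists d : R, (0 < d)%R /\ d%:E < G (x, x).
    case: (G (x, x)) (Gxx x) => [s||]//.
    + rewrite lte_fin => s0; exists (s / 2)%R; rewrite lte_fin; split; lra.
    + by move=> _; exists 1%R; rewrite ltry.
  have d00 := ltW d0; have [V xV VP] := lG _ _ dG.
  case: xV => -[/= U1 U2] [].
  rewrite !nbhsE => -[V1 [oV1 V1x] V1U] [V2 [oV2 V2x] V2U] UV.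
  pose W := V1 `&` V2.
  have oW : open W by exact: openI.
  have mW : measurable (W : set (borel X)) by exact: open_borel.
  exists W; first by exists W.
  (* From [d * mu(W)^2 <= r^2]; this bound [C + 1] avoids a square root, since
     [d (C + 1)^2 > d C = r^2]. *)
  exists (r ^+ 2 / d + 1)%R, W.
  have C0 : (0 <= r ^+ 2 / d)%R by rewrite divr_ge0 ?sqr_ge0// ltW.
  split => //; first exact: addr_ge0.
  move=> mu; rewrite enorm_le// => muE; rewrite leNgt; apply/negP => muW.
  have : d%:E * (mu W * mu W) <= (r ^+ 2)%:E.
    apply: le_trans muE; rewrite muleA.
    have muW0 := measure_ge0 mu W.
    rewrite /rint -/(lint _ _).
    apply: (@le_trans _ _ (lint mu (fun x => (d%:E * mu W) * (\1_W x)%:E))).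
      rewrite /lint ge0_integralZl//.
      + by rewrite integral_indic// setIT.
      + by apply/measurable_EFinP; exact: measurable_indic.
      + by rewrite mule_ge0// lee_fin ltW.
    apply: le_lint => y; first by rewrite mule_ge0// mule_ge0// lee_fin ltW.
    rewrite indicE; case: (boolP (y \in W)) => [/set_mem[V1y _]|_]; last by rewrite mule0 potential_ge0.
    rewrite mule1 /potential /rint -/(lint _ _) -lint_indic// -lintZ//.
      apply: le_lint => z; first by rewrite mule_ge0// lee_fin.
      rewrite indicE; case: (boolP (z \in W)) => [/set_mem[_ V2z]|_]; last by rewrite mule0 kernel_ge0.
      by rewrite mule1; apply/ltW/VP/UV; split; [exact: V1U|exact: V2U].
    by apply/measurable_EFinP; exact: measurable_indic.
  apply/negP; rewrite -ltNge.
  apply: (@lt_le_trans _ _ (d%:E * ((r ^+ 2 / d + 1)%:E * (r ^+ 2 / d + 1)%:E))).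
    rewrite -!EFinM lte_fin; set C := (r ^+ 2 / d)%R.
    have -> : (r ^+ 2 = d * C)%R by rewrite /C mulrC divfK// gt_eqF.
    rewrite ltr_pM2l//; have : (0 <= C)%R by []; nra.
  apply: lee_wpmul2l; first by rewrite lee_fin ltW.
  by apply: lee_pmul; rewrite ?lee_fin ?addr_ge0// ltW.
Qed.

End Kernel.

Lemma ultra_bounded_cvg (R : realType) (T : Type) (F : set_system T) (f : T -> R) (B : R) :
  UltraFilter F -> F [set t | 0 <= f t <= B] -> exists l : R, f @ F --> l.
Proof.
move=> FU FB; have FP := @ultra_proper _ _ FU.
have FB' : (f @ F) (`[0, B]%classic).
  by rewrite set_itvE; exact: FB.
have [l [_ cl]] := @segment_compact R 0 B (f @ F) _ FB'.
exists l => A /= lA; have [//|nA] := in_ultra_setVsetC (f @^-1` A) FU.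
have [y [nAy Ay]] : (~` A) `&` A !=set0 by apply: cl => //; exact: nA.
by [].
Qed.

(** * Lower semicontinuity of the energy and compactness of its balls *)

Section EnergyBall.
Context {R : realType} {X : ptopologicalType}.
Implicit Types (f g h : X -> \bar R) (u v : X -> R) (mu nu : radon R X).
Hypothesis hX : hausdorff_space X.
Hypothesis lX : locally_compact [set: X].
Hypothesis sX : @second_countable X.

Lemma radon_int_continuous u : Ccp u -> continuous (fun mu : radon R X => radon_int mu u).
Proof. by move=> cu mu; apply: (@vague_cvg_Ccp R X (nbhs mu) mu u) => //; exact: cvg_id. Qed.

Variable G : X * X -> \bar R.
Hypothesis kG : is_kernel G.

(** For each tensor stage, integrand and measure move together. Since [P nu] eventually exceeds
    [P mu - d] uniformly on the compact set [K] that carries it, [int P mu dmu] is close to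
    [int P mu dnu], which is at most [int P nu dnu + d int w dnu], hence about [r^2]. *)
Lemma enorm_vague_lsc (F : set_system (radon R X)) mu (r : R) : ProperFilter F -> 0 <= r ->
  F --> mu -> F [set nu | enorm G nu <= r%:E]%E -> (enorm G mu <= r%:E)%E.
Proof.
move=> FF r0 Fmu Fr; rewrite enorm_le//.
have [a [b [ca cb GE]]] := kernel_tensor hX lX sX kG.
rewrite (mutual_energy_sup hX ca cb GE); apply: ub_ereal_sup => _ [n _ <-].
rewrite lee_fin; apply/ler_addgt0Pr => e e0.
pose P nu x := tensor_pot a b nu n x.
have cP nu : Ccp (P nu) by exact: tensor_pot_Ccp.
have [K cK KP] := tensor_max_support b ca n.
have [w [cw w01 wK _]] := compact_bump (R := R) hX lX cK openT (@subsetT _ K).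
have cw' : Ccp w by split => // x; have /andP[] := w01 x.
(* Eventually [int w dnu <= int w dmu + 1], so the uniform error costs at most [e / 2]. *)
pose d := (e / 2 / (radon_int mu w + 1)).
have w0 : 0 <= radon_int mu w by exact: radon_int_ge0.
have d0 : 0 < d by rewrite !divr_gt0// ltr_wpDl.
have cvg (u : X -> R) : Ccp u -> forall e' : R, 0 < e' -> F [set nu | `|radon_int mu u - radon_int nu u| <= e'].
  move=> cu e' e'0.
  have FF' : Filter F by exact: filter_filter.
  by have /cvgrPdist_le := vague_cvg_Ccp FF' Fmu cu; apply.
have unif : F [set nu | forall x, K x -> P mu x <= P nu x + d].
  apply: (compact_local_ind (P := fun S => F [set nu | forall x, S x -> P mu x <= P nu x + d]) cK).
  - by apply: (filterS _ filterT) => nu _ x [].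
  - by move=> A B AB; apply: filterS => nu H x /AB; exact: H.
  - by move=> A B FA FB; apply: filterS (filterI FA FB) => nu [H1 H2] x [/H1|/H2].
  - move=> x Kx.
    (* The margin 1 makes [B k] bound the integrals of [b k] for [mu] and for [nu] near [mu], so one
       neighbourhood of [x] serves both moduli. *)
    pose B k := radon_int mu (b k) + 1.
    have B0 k : 0 <= B k by rewrite addr_ge0// radon_int_ge0.
    have d30 : 0 < d / 3 by rewrite divr_gt0.
    have M1 := near_modulus ca n x d30 B0.
    exists [set x' | \sum_(k < n) `|a k x - a k x'| * B k <= d / 3] => //.
    have FB m : F [set nu | forall k, (k < m)%N -> radon_int nu (b k) <= B k].
      elim: m => [|m IH]; first by apply: (filterS _ filterT) => nu _ k.
      apply: filterS (filterI IH (cvg _ (cb m) 1 ltr01)) => nu [H1 H2] k; rewrite ltnS leq_eqVlt => /orP[/eqP ->|]; last exact: H1.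
      move: H2 => /=; rewrite ler_distl => /andP[+ _]; rewrite lerBlDr /B; exact: id.
    have FD := cvg _ (tensor_max_Ccp hX ca cb n x) _ d30.
    apply: filterS (filterI (FB n) FD) => nu [H1 H2] x' [/= Hx' Kx'].
    have sumB (rho : radon R X) : (forall k, (k < n)%N -> radon_int rho (b k) <= B k) ->
       \sum_(k < n) `|a k x - a k x'| * radon_int rho (b k) <= d / 3.
      move=> rB; apply: le_trans Hx'; apply: ler_sum => k _; apply: ler_wpM2l => //.
      exact: rB.
    have L1 := tensor_pot_lip hX ca cb mu n x' x.
    have L2 := tensor_pot_lip hX ca cb nu n x x'.
    have S2 := sumB nu H1.
    have S1 : \sum_(k < n) `|a k x' - a k x| * radon_int mu (b k) <= d / 3.
      under eq_bigr do rewrite distrC.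
      by apply: sumB => k _; rewrite lerDl.
    move: H2 => /=; rewrite ler_distl -!/(tensor_pot _ _ _ _ _) => /andP[_ H2].
    rewrite /P; lra.
have cwe : F [set nu | `|radon_int mu w - radon_int nu w| <= 1] by exact: cvg.
have cPe : F [set nu | `|radon_int mu (P mu) - radon_int nu (P mu)| <= e / 2].
  by apply: cvg => //; rewrite divr_gt0.
have [nu [[[Hr Hu] Hw] HP]] := filter_ex (filterI (filterI (filterI Fr unif) cwe) cPe).
have E1 : radon_int nu (P nu) <= r ^+ 2.
  rewrite -lee_fin; move: Hr; rewrite /= enorm_le// (mutual_energy_sup hX ca cb GE).
  by apply: le_trans; exact: (@le_sup_range _ nat (fun n => (radon_int nu (tensor_pot a b nu n))%:E) _ n).
have E2 : radon_int nu (P mu) <= radon_int nu (P nu) + d * radon_int nu w.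
  rewrite -radon_intZ ?(ltW d0)// -radon_intD//; last by apply: CcpZ => //; exact: ltW.
  apply: le_radon_int => //.
    by apply: CcpD => //; apply: CcpZ => //; exact: ltW.
  move=> x; have [Kx|nK] := pselect (K x); first by rewrite wK// mulr1; exact: Hu.
  have -> : P mu x = 0.
    rewrite /P /tensor_pot /radon_int (_ : EFin \o _ = cst 0%E) ?/lint ?integral0//.
    by apply/funext => y /=; rewrite KP.
  by apply: addr_ge0; [exact: (cP nu).2|apply: mulr_ge0; [exact: ltW|exact: cw'.2]].
have E3 : d * radon_int nu w <= e / 2.
  have : radon_int nu w <= radon_int mu w + 1.
    by move: Hw => /=; rewrite ler_distl => /andP[+ _]; rewrite lerBlDr.
  move=> /(ler_wpM2l (ltW d0))/le_trans; apply.
  by rewrite /d divfK// gt_eqF// ltr_wpDl.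
move: HP => /=; rewrite ler_distl => /andP[_ HP].
rewrite -/(P mu); lra.
Qed.

(** Along an ultrafilter in the ball, integrals of test functions are bounded by the mass estimate
    and so converge; the limit is a positive functional, and Riesz turns it into the limit
    measure. *)
Theorem energy_ball_compact (r : R) : 0 <= r ->
  compact [set mu : radon R X | (enorm G mu <= r%:E)%E].
Proof.
move=> r0; rewrite compact_ultra => F FU Fr; have FP := @ultra_proper _ _ FU.
have ex u : Ccp u -> exists l : R, radon_int nu u @[nu --> F] --> l.
  move=> cu; have [M M0 uM] := Cc_bounded cu.1.
  have [_ /compact_supportP[K cK uK]] := cu.1.
  have [B B0 KB] := energy_ball_mass hX kG r0 cK.
  apply: (@ultra_bounded_cvg R _ F _ (M * B)) => //.
  apply: filterS Fr => nu /KB nuK /=; rewrite radon_int_ge0//=.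
  rewrite -lee_fin -radon_intE//.
  have mK : measurable (K : set (borel X)) by apply: closed_borel; exact: compact_closed.
  apply: (@le_trans _ _ (lint nu (fun x => M%:E * (\1_K x)%:E)%E)).
    apply: le_lint; first exact: Ccp_lee0.
    move=> x; rewrite /= -EFinM lee_fin indicE; case: (boolP (x \in K)) => [_|/negP nK].
      by rewrite mulr1; exact: le_trans (ler_norm _) (uM x).
    by rewrite mulr0 uK// => Kx; apply: nK; exact/mem_set.
  rewrite lintZ//.
    by rewrite lint_indic// EFinM; apply: lee_wpmul2l; rewrite ?lee_fin.
  by apply/measurable_EFinP; exact: measurable_indic.
pose L u : R := lim (radon_int nu u @[nu --> F]).
have LP u : Ccp u -> radon_int nu u @[nu --> F] --> L u.
  by move=> /ex[l Fl]; rewrite /L (cvg_lim _ Fl).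
have [| | |mu muL] := @riesz_representation R X hX lX sX L.
- move=> u v cu cv; apply/cvg_lim => //.
  rewrite (_ : (fun nu => _) = (fun nu : radon R X => radon_int nu u + radon_int nu v)).
    by apply: cvgD; exact: LP.
  by apply/funext => nu; exact: radon_intD.
- move=> c u c0 cu; apply/cvg_lim => //.
  rewrite (_ : (fun nu => _) = (fun nu : radon R X => c * radon_int nu u)).
    by apply: cvgM; [exact: cvg_cst|exact: LP].
  by apply/funext => nu; exact: radon_intZ.
- move=> u cu; apply: limr_ge; first by apply/cvg_ex; exists (L u); exact: LP.
  by apply: nearW => nu; exact: radon_int_ge0.
have Fmu : F --> mu.
  apply: vague_cvg_from_Ccp => // u cu; rewrite (_ : radon_int mu u = L u).
    exact: LP.
  by rewrite /radon_int muL.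
by exists mu; split => //=; exact: enorm_vague_lsc Fr.
Qed.

End EnergyBall.

(** * Energy capacity *)

Section Capacity.
Context {R : realType} {X : ptopologicalType}.
Implicit Types (f g h : X -> \bar R) (u v : X -> R) (mu nu rho : radon R X).
Hypothesis hX : hausdorff_space X.
Hypothesis lX : locally_compact [set: X].
Hypothesis sX : @second_countable X.
Variable G : X * X -> \bar R.
Hypothesis kG : is_kernel G.
Local Open Scope ereal_scope.

Lemma kernel_section_lsc x : lower_semicontinuous (fun y => G (x, y)).
Proof.
move=> y a ag; have [_ lG _ _] := kG; have [V xyV VP] := lG _ _ ag.
case: xyV => -[/= U1 U2] [/nbhs_singleton U1x yU2] UV.
by exists U2 => // z U2z; apply: VP; apply: UV.
Qed.

Lemma energy_scale mu rho (s : R) : (0 <= s)%R ->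
  (forall A : set (borel X), measurable A -> rho A = s%:E * mu A) ->
  enorm G rho = s%:E * enorm G mu.
Proof.
move=> s0 rhoE.
have potE x : potential G rho x = s%:E * potential G mu x.
  rewrite /potential /rint -!/(lint _ _); apply: lint_scale => //.
    by apply: lsc_measurable; exact: kernel_section_lsc.
  by move=> y; exact: kernel_ge0.
rewrite /enorm /rint -!/(lint _ _).
have pm : measurable_fun [set: borel X] (potential G rho) by exact: potential_measurable.
rewrite (lint_scale s0 rhoE)//; last by move=> x; exact: potential_ge0.
have -> : lint mu (potential G rho) = s%:E * lint mu (potential G mu).
  rewrite -lintZ//; [|by move=> x; exact: potential_ge0|exact: potential_measurable].
  by congr lint; apply/funext.
rewrite muleA -EFinM -expr2 sqrteM ?lee_fin ?sqr_ge0//.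
by rewrite EFin_expe sqrte_sqr gee0_abs.
Qed.

Lemma unit_energy0 : exists mu : radon R X,
  [/\ enorm G mu = 0 & forall A : set (borel X), measurable A -> mu A = 0].
Proof.
have [K cK|mu muE] := @radon_of_borel R X hX lX sX mzero; first exact: (ltry 0%R).
exists mu; split=> //.
(* The null measure is 0 times itself, so scaling gives its norm. *)
rewrite (@energy_scale mu mu 0%R) ?mul0e// => A mA.
by rewrite mul0e muE.
Qed.

Lemma Ccp_C0plus u : Ccp u -> C0plus (EFin \o u).
Proof.
move=> [[cu su] u0]; split; split.
- by move=> x; rewrite lee_fin.
- exact: continuous_lsc.
- by move=> x; rewrite lee_fin.
- by move=> x; rewrite ltry.
- exact: continuous_usc.
- have [K cK uK] := compact_supportP su.
  by apply: (has_compact_supportW hX cK) => x /uK /= ->.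
Qed.

Lemma le_cap_C0 f g : (forall x, 0 <= f x) -> (forall x, f x <= g x) ->
  cap_C0 G f <= cap_C0 G g.
Proof.
move=> f0 fg; apply: ub_ereal_sup => _ [mu muE <-].
apply: (@le_trans _ _ (rint mu g)); first exact: le_lint.
by apply: ereal_sup_ubound; exists mu.
Qed.

Lemma rint_le_cap_C0 f mu : unit_energy G mu -> rint mu f <= cap_C0 G f.
Proof. by move=> muE; apply: ereal_sup_ubound; exists mu. Qed.

Lemma cap_C0_ge0 f : (forall x, 0 <= f x) -> 0 <= cap_C0 G f.
Proof.
move=> f0; have [mu [mu0 _]] := unit_energy0.
apply: (@le_trans _ _ (rint mu f)); first exact: lint_ge0.
by apply: rint_le_cap_C0; rewrite /unit_energy/= mu0.
Qed.

(** Two suprema are exchanged: over the measures of the unit ball, and over the test functions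
    increasing to [g]. *)
Lemma cap_GlscE g : Glsc g -> cap_Glsc G g = cap_C0 G g.
Proof.
move=> [g0 lg]; apply/eqP; rewrite eq_le; apply/andP; split.
  by apply: ub_ereal_sup => _ [phi [[[phi0 _] _] phig] <-]; exact: le_cap_C0.
apply: ub_ereal_sup => _ [mu muE <-].
have [u [cu u0 ui uE uI]] := lsc_approx_sup hX lX sX g0 lg.
rewrite /rint -/(lint mu g) uI; apply: ub_ereal_sup => _ [n _ <-].
apply: (@le_trans _ _ (cap_C0 G (EFin \o u n))); first exact: rint_le_cap_C0.
apply: ereal_sup_ubound; exists (EFin \o u n) => //; split.
  by apply: Ccp_C0plus; split.
by move=> x; rewrite uE; exact: (@le_sup_range _ _ (fun n => (u n x)%:E) _ n).
Qed.

Lemma cap_C0Z g (c : R) : (0 <= c)%R -> (forall x, 0 <= g x) ->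
  measurable_fun [set: borel X] g ->
  cap_C0 G (fun x => c%:E * g x) <= c%:E * cap_C0 G g.
Proof.
move=> c0 g0 mg; apply: ub_ereal_sup => _ [mu muE <-].
rewrite /rint -/(lint _ _) lintZ//; apply: lee_wpmul2l; first by rewrite lee_fin.
exact: rint_le_cap_C0.
Qed.

(** Monotone convergence for a decreasing sequence, applied to the increasing differences
    [v 0 - v n]; finiteness of the integral of [v 0] allows the subtraction. *)
Lemma lint_H0_approx (m : radon R X) h (v : nat -> X -> R) (a : R) : H0 h ->
  (forall n, Cc R X (v n)) -> (forall n x, h x <= (v n x)%:E) ->
  (forall n x, (v n.+1 x <= v n x)%R) ->
  (forall x (a : R), h x < a%:E -> exists n, (v n x < a)%R) ->
  lint m h < a%:E -> exists n, (radon_int m (v n) < a)%R.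
Proof.
move=> Hh cv hv vi vl L2; have [h0 hoo uh _] := Hh.
have pv n : Ccp (v n) by split => // x; rewrite -lee_fin; exact: le_trans (hv n x).
have hfin x : h x \is a fin_num by rewrite ge0_fin_numE.
have hE x : h x = (fine (h x))%:E by rewrite fineK.
have mh : measurable_fun [set: borel X] h by exact: usc_measurable.
apply: contrapT => nP.
have av n : (a <= radon_int m (v n))%R.
  by rewrite leNgt; apply/negP => ?; apply: nP; exists n.
have d0 n x : (0 <= v 0%N x - v n x)%R.
  by rewrite subr_ge0; elim: n => // n; apply: le_trans.
have cd n : Ccp (fun x => v 0%N x - v n x)%R.
  by split => //; apply: CcB => //; exact: cv.
have dE x : (v 0%N x)%:E - h x = ereal_sup (range (fun n => (v 0%N x - v n x)%:E)).
  apply: ereal_sup_approx => [n|c].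
    by rewrite EFinB leeB// hv.
  rewrite hE -EFinB lte_fin => cx; have [|n vn] := vl x (v 0%N x - c)%R.
    by rewrite hE lte_fin; lra.
  by exists n; lra.
have : lint m (fun x => (v 0%N x)%:E - h x) <= (radon_int m (v 0%N) - a)%:E.
  rewrite (@lint_sup _ _ _ (fun n x => (v 0%N x - v n x)%:E))//.
  - apply: ub_ereal_sup => _ [n _ <-]; rewrite -/(EFin \o _) radon_intE// lee_fin.
    have := radon_intD hX m (cd n) (pv n).
    rewrite (_ : (fun x => _) = v 0%N); last by apply/funext => x; rewrite subrK.
    by have := av n; lra.
  - by move=> n; exact: Ccp_measurable.
  - by move=> n x; rewrite lee_fin; apply: lerB.
have dh0 x : 0 <= (v 0%N x)%:E - h x by rewrite hE -EFinB lee_fin subr_ge0 -lee_fin -hE.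
have mvh : measurable_fun [set: borel X] (fun x => (v 0%N x)%:E - h x).
  apply: emeasurable_funB => //; exact: Ccp_measurable.
have : lint m (EFin \o v 0%N) = lint m (fun x => (v 0%N x)%:E - h x) + lint m h.
  rewrite -lintD//; congr lint; apply/funext => x.
  by rewrite /= hE -EFinB -EFinD subrK.
rewrite radon_intE// => E1 L1.
have : (radon_int m (v 0%N))%:E < (radon_int m (v 0%N) - a)%:E + a%:E.
  by rewrite E1; apply: lee_ltD => //; rewrite ge0_fin_numE ?lint_ge0//; exact: le_lt_trans L1 (ltry _).
by rewrite -EFinD subrK ltxx.
Qed.

(* The minimax identity for upper semicontinuous functions: Dini's theorem
   on the vaguely compact unit ball. *)
Lemma cap_H0_le h : H0 h -> cap_H0 G h <= cap_C0 G h.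
Proof.
move=> Hh; have [h0 hoo uh _] := Hh.
rewrite leNgt; apply/negP => /lte_between[a [ha aH]].
have [v [cv hv vi vl]] := H0_approx hX lX sX Hh.
have pv n : Ccp (v n) by split => // x; rewrite -lee_fin; exact: le_trans (hv n x).
have [n Pn] : exists n, [set mu | unit_energy G mu] `<=` [set mu | (radon_int mu (v n) < a)%R].
  apply: compact_increasing_cover.
  - exact: (energy_ball_compact hX lX sX kG ler01).
  - by move=> n mu /=; apply: le_lt_trans; apply: le_radon_int.
  - move=> n mu _ /= mua.
    exists [set nu | (radon_int nu (v n) < a)%R]; last by move=> nu [].
    exact: (@radon_int_continuous R X _ (pv n) mu _ (lt_nbhsl mua)).
  - move=> mu muE; apply: (lint_H0_approx Hh) => //.
    by apply: le_lt_trans ha; exact: rint_le_cap_C0.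
move: aH; apply/negP; rewrite -leNgt.
apply: (@le_trans _ _ (cap_C0 G (EFin \o v n))).
  by apply: ereal_inf_lbound; exists (EFin \o v n) => //; split; [exact: Ccp_C0plus|exact: hv].
apply: ub_ereal_sup => _ [mu /Pn muE <-].
by rewrite /rint -/(lint _ (EFin \o v n)) radon_intE// lee_fin ltW.
Qed.

Lemma upper_cap_ge0 f : 0 <= upper_cap G f.
Proof.
apply: le_ereal_inf_tmp => _ [g [Gg _] <-]; rewrite cap_GlscE//.
exact: cap_C0_ge0 Gg.1.
Qed.

Lemma le_upper_cap f g : (forall x, f x <= g x) -> upper_cap G f <= upper_cap G g.
Proof.
move=> fg; apply: le_ereal_inf => _ [k [Gk gk] <-]; exists k => //; split => // x.
exact: le_trans (gk x).
Qed.

Lemma upper_cap_le_lsc f g : Glsc g -> (forall x, f x <= g x) -> upper_cap G f <= cap_C0 G g.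
Proof. by move=> Gg fg; rewrite -cap_GlscE//; apply: ereal_inf_lbound; exists g. Qed.

Lemma upper_cap_ltP f (c : \bar R) : upper_cap G f < c ->
  exists g, [/\ Glsc g, forall x, f x <= g x & cap_C0 G g < c].
Proof.
move=> /ereal_inf_lt[_ [g [Gg fg] <-]]; rewrite cap_GlscE// => gc.
by exists g.
Qed.

(** Rescale [nu] into the unit ball; superadditivity of the lower integral bounds the rescaled
    integral from below, which is the direction needed. *)
Lemma rint_le_cap_enorm f nu (c : R) : (forall x, 0 <= f x) -> finite_energy G nu ->
  cap_C0 G f <= c%:E -> rint nu f <= c%:E * enorm G nu.
Proof.
move=> f0 nuE fc.
have c0 : (0 <= c)%R by rewrite -lee_fin; apply: le_trans fc; exact: cap_C0_ge0.
have scale (s : R) : (0 <= s)%R -> s%:E * enorm G nu <= 1 -> s%:E * rint nu f <= c%:E.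
  move=> s0 s1; have [rho rhoE] := radon_scale hX lX sX nu s0.
  apply: le_trans fc; apply: le_trans (@rint_le_cap_C0 f rho _); last first.
    by rewrite /unit_energy/= (energy_scale s0 rhoE).
  have := @lint_comb_ge R X s 0%R s0 (lexx _) rho nu nu _ f f0.
  rewrite mul0e adde0; apply=> A mA; by rewrite rhoE// mul0e adde0.
have e0 := enorm_ge0 G nu.
move: nuE; rewrite /finite_energy/=; move: e0 scale.
case: (enorm G nu) => [e||]//; rewrite lee_fin le_eqVlt => /orP[/eqP <-|e0] scale _.
  (* If [|nu| = 0], all multiples of [nu] stay in the ball. A positive [a] below the integral would
     give more than [c] after scaling by [(c + 1) / a]. *)
  rewrite mule0; apply: lee_real => a ar; rewrite lee_fin leNgt; apply/negP => a0.
  have := scale ((c + 1) / a)%R _ _; rewrite mule0 lee01 => /(_ _ isT).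
  have d0 : (0 <= (c + 1) / a)%R by rewrite divr_ge0 ?addr_ge0// ltW.
  move=> /(_ d0); apply/negP; rewrite -ltNge.
  apply: (@lt_le_trans _ _ (((c + 1) / a)%:E * a%:E)).
    by rewrite -EFinM divfK ?gt_eqF// lte_fin ltrDl.
  by apply: lee_wpmul2l; rewrite ?lee_fin// ltW.
have := scale (e^-1)%R; rewrite invr_ge0 ltW// => /(_ isT).
by rewrite -EFinM mulVf ?gt_eqF// lexx => /(_ isT); rewrite lee_pdivrMl// muleC.
Qed.

Lemma Glsc_series (g : nat -> X -> \bar R) : (forall n, Glsc (g n)) ->
  Glsc (fun x => \sum_(n <oo) g n x).
Proof.
move=> Gg; split.
  by move=> x; apply: nneseries_ge0 => n _ _; exact: (Gg n).1.
have ls n : lower_semicontinuous (fun x => \sum_(0 <= k < n) g k x).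
  elim: n => [|n IH].
    under eq_fun do rewrite big_geq//.
    by move=> x a a0; exists setT; [exact: filterT|].
  under eq_fun do rewrite big_nat_recr//=.
  apply: lscD => //; [|exact: (Gg n).1|exact: (Gg n).2].
  by move=> x; apply: sume_ge0 => k _; exact: (Gg k).1.
rewrite (_ : (fun x => _) = fun x => ereal_sup (range (fun n => \sum_(0 <= k < n) g k x))).
  exact: lsc_ereal_sup.
apply/funext => x; apply/cvg_lim => //; apply: ereal_nondecreasing_cvgn.
by apply: ereal_nondecreasing_series => k _ _; exact: (Gg k).1.
Qed.

Lemma upper_cap_series f (F : nat -> X -> \bar R) : (forall n x, 0 <= F n x) ->
  (forall x, f x <= \sum_(n <oo) F n x) ->
  upper_cap G f <= \sum_(n <oo) upper_cap G (F n).
Proof.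
move=> F0 fF; apply: sigma_subadditive_inf.
  by move=> n g [Gg _]; rewrite cap_GlscE//; exact: cap_C0_ge0 Gg.1.
move=> g gP; have Gg n : Glsc (g n) := (gP n).1.
apply: (@le_trans _ _ (cap_C0 G (fun x => \sum_(n <oo) g n x))).
  apply: upper_cap_le_lsc; first exact: Glsc_series.
  move=> x; apply: (le_trans (fF x)); apply: lee_nneseries => n _; first by move=> _; exact: F0.
  exact: (gP n).2.
apply: ub_ereal_sup => _ [mu muE <-].
rewrite /rint integral_nneseries//.
- apply: lee_nneseries => n _; first by move=> _; apply: lint_ge0; exact: (Gg n).1.
  by rewrite cap_GlscE//; exact: rint_le_cap_C0.
- by move=> n; apply: lsc_measurable; exact: (Gg n).2.
- by move=> n x _; exact: (Gg n).1.
Qed.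

Lemma upper_cap0 : upper_cap G (fun=> 0) = 0.
Proof.
apply/eqP; rewrite eq_le upper_cap_ge0 andbT.
have Gg : @Glsc R X (fun=> 0).
  by split => // x a a0; exists setT; [exact: filterT|].
apply: (le_trans (@upper_cap_le_lsc _ (fun=> 0) Gg (fun=> lexx _))).
by apply: ub_ereal_sup => _ [mu _ <-]; rewrite /rint integral0.
Qed.

Lemma upper_capD f f1 f2 : (forall x, 0 <= f1 x) -> (forall x, 0 <= f2 x) ->
  (forall x, f x <= f1 x + f2 x) -> upper_cap G f <= upper_cap G f1 + upper_cap G f2.
Proof.
move=> f10 f20 ff; pose F n x := match n with 0%N => f1 x | 1%N => f2 x | _ => 0 end.
have two (H : nat -> \bar R) : (forall n, H n.+2 = 0) -> \sum_(n <oo) H n = H 0%N + H 1%N.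
  move=> H0; apply/cvg_lim => //; apply: cvg_near_cst; near=> n.
  rewrite (@big_cat_nat _ _ _ 2)//=; last by near: n; exists 2%N.
  rewrite big_nat_recl// big_nat1 big_nat big1 ?adde0// => -[|[|i]]// _.
have := @upper_cap_series f F; rewrite two; last by move=> n; exact: upper_cap0.
apply.
- by move=> [|[|n]] x //=.
- by move=> x; rewrite two.
Unshelve. all: by end_near. Qed.

(** Mostly used as a Chebyshev inequality, with [f] the indicator of a superlevel set of [g] and [r]
    the inverse of the level. *)
Lemma upper_cap_le_scale f g (r c : R) : (0 < r)%R ->
  (forall x, f x <= r%:E * g x) -> upper_cap G g < c%:E -> upper_cap G f <= (r * c)%:E.
Proof.
move=> r0 fg /upper_cap_ltP[k [[k0 lk] gk kc]].
have Gk : Glsc (fun x => r%:E * k x).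
  split; first by move=> x; rewrite mule_ge0// lee_fin ltW.
  by apply: lscZ => //; exact: ltW.
apply: (@le_trans _ _ (cap_C0 G (fun x => r%:E * k x))).
  apply: upper_cap_le_lsc => // x; apply: (le_trans (fg x)).
  by rewrite lee_pmul2l.
apply: (@le_trans _ _ (r%:E * cap_C0 G k)).
  apply: cap_C0Z => //; first exact: ltW.
  by apply: lsc_measurable.
by rewrite EFinM lee_pmul2l// ltW.
Qed.

Lemma upper_cap_set_open (V : set X) (c : R) : upper_cap_set G V < c%:E ->
  exists W, [/\ open W, V `<=` W & upper_cap_set G W <= (2 * c)%:E].
Proof.
(* The majorant is at least 1 on [V]; the open set where it exceeds [1/2] therefore contains [V], at
   the price of the factor 2. *)
move=> /upper_cap_ltP[g [[g0 lg] Vg gc]].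
exists [set x | (1/2)%:E < g x]; split.
- by have /lower_semicontinuousP := lg; apply.
- move=> x Vx /=; apply: lt_le_trans (Vg x); rewrite indicE mem_set// lte_fin /=; lra.
- apply: (@upper_cap_le_scale _ g) => //; last by apply: le_lt_trans gc; apply: upper_cap_le_lsc.
  move=> x; rewrite indicE; case: (boolP (x \in _)) => [/set_mem/= xg|_]; last by rewrite mule_ge0.
  apply: (@le_trans _ _ (2%:E * (1/2)%:E)); first by rewrite -EFinM lee_fin /=; lra.
  by rewrite lee_pmul2l// ltW.
Qed.

(** Adding this to the right-hand side turns an inequality off [E] into an inequality everywhere. *)
Definition oo_on (E : set X) (x : X) : \bar R := if x \in E then +oo else 0.

Lemma oo_on_ge0 E x : 0 <= oo_on E x.
Proof. by rewrite /oo_on; case: ifP. Qed.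

(** [oo_on E] is the sum of countably many copies of the indicator of [E]. *)
Lemma upper_cap_oo_on (E : set X) : upper_cap_set G E = 0 -> upper_cap G (oo_on E) = 0.
Proof.
move=> E0; apply/eqP; rewrite eq_le upper_cap_ge0 andbT.
have := @upper_cap_series (oo_on E) (fun _ x => (\1_E x)%:E).
rewrite [X in _ <= X](_ : _ = 0); last first.
  by rewrite eseries0// => n _ _; exact: E0.
apply; first by move=> n x; rewrite lee_fin.
move=> x; rewrite /oo_on indicE; case: ifPn => [xE|_]; last first.
  by apply: nneseries_ge0 => n _ _; rewrite lee_fin.
apply: lee_real => a _; apply: (@le_trans _ _ (\sum_(0 <= i < Num.bound a) (1%R)%:E)).
  by rewrite sumEFin lee_fin sumr_const_nat subn0; apply/ltW/unstable.ltr_bound.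
by apply: nneseries_lim_ge => n _ _; rewrite lee_fin.
Qed.

Lemma qe_le_upper_cap f g : (forall x, 0 <= g x) -> qe G (fun x => f x <= g x) ->
  upper_cap G f <= upper_cap G g.
Proof.
move=> g0 [E E0 fg].
rewrite -[leRHS]adde0 -(upper_cap_oo_on E0); apply: upper_capD => //; first exact: oo_on_ge0.
move=> x; rewrite /oo_on; case: ifPn => [_|/negP xE].
  by rewrite addey ?leey// gt_eqF// (lt_le_trans _ (g0 x)).
by rewrite adde0; apply: fg => Ex; apply: xE; exact/mem_set.
Qed.

Lemma upper_cap_set_null_bigcup (E : nat -> set X) :
  (forall n, upper_cap_set G (E n) = 0) -> upper_cap_set G (\bigcup_n E n) = 0.
Proof.
move=> E0; apply/eqP; rewrite eq_le upper_cap_ge0 andbT.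
have := @upper_cap_series (fun x => (\1_(\bigcup_n E n) x)%:E) (fun n x => (\1_(E n) x)%:E).
rewrite [X in _ <= X](_ : _ = 0); last first.
  by rewrite eseries0// => n _ _; exact: E0.
apply; first by move=> n x; rewrite lee_fin.
move=> x; rewrite indicE; case: (boolP (x \in _)) => [/set_mem[n _ En]|_]; last first.
  by apply: nneseries_ge0 => n _ _; rewrite lee_fin.
apply: (@le_trans _ _ (\sum_(0 <= i < n.+1) (\1_(E i) x)%:E)); last first.
  by apply: nneseries_lim_ge => k _ _; rewrite lee_fin.
by rewrite big_nat_recr//= indicE mem_set//= leeDr// sume_ge0.
Qed.

Lemma le_upper_cap_set (A B : set X) : A `<=` B -> upper_cap_set G A <= upper_cap_set G B.
Proof.
move=> AB; apply: le_upper_cap => x; rewrite lee_fin !indicE ler_nat.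
by case: (boolP (x \in A)) => // /set_mem/AB/mem_set ->.
Qed.

Lemma upper_cap_setU (A B : set X) :
  upper_cap_set G (A `|` B) <= upper_cap_set G A + upper_cap_set G B.
Proof.
apply: upper_capD => [x|x|x]; [by rewrite lee_fin|by rewrite lee_fin|].
rewrite -EFinD lee_fin !indicE in_setU.
by case: (x \in A); case: (x \in B); rewrite ?addr0 ?add0r ?lerDl.
Qed.

Lemma qe_forall (P : nat -> X -> Prop) : (forall n, qe G (P n)) -> qe G (fun x => forall n, P n x).
Proof.
move=> H; pose E n := projT1 (cid2 (H n)).
exists (\bigcup_n E n).
  by apply: upper_cap_set_null_bigcup => n; rewrite /E; case: cid2.
move=> x nE n; have : ~ E n x by move=> ?; apply: nE; exists n.
by rewrite /E; case: cid2 => /= ? _; apply.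
Qed.

Lemma qe_and (P Q : X -> Prop) : qe G P -> qe G Q -> qe G (fun x => P x /\ Q x).
Proof.
move=> qP qQ; have [E E0 EP] := @qe_forall (fun n => if n is 0%N then P else Q)
  (fun n => match n with 0%N => qP | _ => qQ end).
by exists E => // x /EP H; split; [exact: (H 0%N)|exact: (H 1%N)].
Qed.

Lemma qe_imp (P Q : X -> Prop) : (forall x, P x -> Q x) -> qe G P -> qe G Q.
Proof. by move=> PQ [E E0 EP]; exists E => // x /EP/PQ. Qed.

(** [E] need not be Borel. An l.s.c. majorant of [oo_on E] of capacity below 1 has finite
    [nu]-integral, so the Borel set where it is infinite is negligible. *)
Lemma null_negligible (E : set X) nu : finite_energy G nu -> upper_cap_set G E = 0 ->
  exists N : set (borel X), [/\ measurable N, E `<=` N & nu N = 0].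
Proof.
move=> nuE E0; have /upper_cap_ltP[g [[g0 lg] Eg g1]] : upper_cap G (oo_on E) < 1%:E.
  by rewrite upper_cap_oo_on// lte_fin.
have mg : measurable_fun [set: borel X] g by apply: lsc_measurable.
exists [set x | g x = +oo]; split.
- rewrite (_ : [set x | _] = setT `&` [set x : borel X | +oo <= g x]).
    exact: emeasurable_fun_c_infty.
  by rewrite setTI; apply/seteqP; split => x /=; rewrite leye_eq => /eqP.
- by move=> x Ex /=; apply/eqP; rewrite -leye_eq; apply: le_trans (Eg x); rewrite /oo_on mem_set.
- set N := (X in nu X = 0).
  have mN : measurable (N : set (borel X)).
    rewrite (_ : N = setT `&` [set x : borel X | +oo <= g x]).
      exact: emeasurable_fun_c_infty.
    by rewrite setTI; apply/seteqP; split => x /=; rewrite leye_eq => /eqP.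
  have gfin : lint nu g < +oo.
    apply: le_lt_trans (rint_le_cap_enorm g0 nuE (ltW g1)) _.
    by rewrite mul1e.
  apply/eqP; rewrite eq_le measure_ge0 andbT leNgt; apply/negP => N0.
  move: gfin; apply/negP; rewrite -leNgt -(gt0_mulye N0).
  rewrite -(lint_indic nu mN) /lint -ge0_integralZl//; last first.
    by apply/measurable_EFinP; exact: measurable_indic.
  apply: le_lint => x; first by rewrite mule_ge0.
  rewrite indicE; case: (boolP (x \in N)) => [/set_mem ->|_]; first by rewrite mule1.
  by rewrite mule0.
Qed.

End Capacity.

(** * Quasi semicontinuity of potentials *)

Section QuasiTopology.
Context {R : realType} {X : ptopologicalType}.
Implicit Types (f g h phi : X -> \bar R) (u v : X -> R) (mu nu rho lam : radon R X).
Hypothesis hX : hausdorff_space X.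
Hypothesis lX : locally_compact [set: X].
Hypothesis sX : @second_countable X.
Variable G : X * X -> \bar R.
Hypothesis kG : is_kernel G.
Local Open Scope ereal_scope.

Lemma lt_add_invS (x y : \bar R) : 0 <= x -> x < y ->
  exists n, x + (n.+1%:R^-1)%:E <= y.
Proof.
case: x => [r||]// _; last by rewrite ltNge leey.
case: y => [s||]//; last by move=> _; exists 0%N; rewrite -EFinD leey.
rewrite lte_fin -subr_gt0 => rs; exists (Num.bound (s - r)^-1).
rewrite -EFinD lee_fin -lerBrDl -[leRHS]invrK lef_pV2 ?posrE// ?invr_gt0//.
apply/ltW/(lt_le_trans (unstable.ltr_bound _)); by rewrite ler_nat.
Qed.

Lemma Glsc_potential mu : Glsc (potential G mu).
Proof. by split; [move=> x; exact: potential_ge0|exact: potential_lsc]. Qed.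

(** As in Egorov's theorem: off a set of small capacity, [f] is a uniform limit of the continuous
    functions [u k]. *)
Lemma approx_quasi_usc f : Fplus f ->
  (forall e : R, (0 < e)%R -> exists u : X -> R, [/\ Ccp u, forall x, (u x)%:E <= f x &
     upper_cap G (fun x => f x - (u x)%:E) < e%:E]) -> quasi_usc G f.
Proof.
move=> f0 H; split=> // e e0.
(* Chebyshev at level [1 / (k + 1)] costs the factor [k + 1]; what remains sums to [e / 2], leaving
   room for the strict inequality. *)
have d0 (k : nat) : (0 < e / 2 / (2 ^ k.+1)%:R / k.+1%:R)%R by rewrite !divr_gt0// ltr0n expn_gt0.
pose u k := projT1 (cid (H _ (d0 k))).
have uP k : [/\ Ccp (u k), forall x, (u k x)%:E <= f x &
     upper_cap G (fun x => f x - (u k x)%:E) < (e / 2 / (2 ^ k.+1)%:R / k.+1%:R)%:E].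
  exact: projT2 (cid (H _ (d0 k))).
pose V k := [set x | (k.+1%:R^-1)%:E < f x - (u k x)%:E].
have V1 k : upper_cap_set G (V k) <= (e / 2 / (2 ^ k.+1)%:R)%:E.
  have [_ uf ucap] := uP k.
  have k0 : (0 < k.+1%:R :> R)%R by rewrite ltr0n.
  have := @upper_cap_le_scale R X hX lX sX G (fun x => (\1_(V k) x)%:E) _ _ _ k0 _ ucap.
  rewrite (_ : (k.+1%:R * _)%R = (e / 2 / (2 ^ k.+1)%:R)%R); last by rewrite mulrC divfK ?gt_eqF.
  apply.
  move=> x; rewrite indicE; case: (boolP (x \in _)) => [/set_mem/ltW Vx|_]; last first.
    by rewrite mule_ge0// sube_ge0 ?uf.
  apply: (@le_trans _ _ (k.+1%:R%:E * (k.+1%:R^-1)%:E)).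
    by rewrite -EFinM mulfV ?pnatr_eq0.
  by rewrite lee_pmul2l// ltW.
exists (\bigcup_k V k).
  apply: (@le_lt_trans _ _ (\sum_(k <oo) upper_cap_set G (V k))).
    apply: upper_cap_series => //.
    move=> x; rewrite indicE; case: (boolP (x \in _)) => [/set_mem[n _ Vn]|_]; last first.
      by apply: nneseries_ge0 => n _ _; rewrite lee_fin.
    apply: (@le_trans _ _ (\sum_(0 <= i < n.+1) (\1_(V i) x)%:E)); last first.
      by apply: nneseries_lim_ge => k _ _; rewrite lee_fin.
    by rewrite big_nat_recr//= indicE mem_set//= leeDr// sume_ge0.
  apply: (@le_lt_trans _ _ (e / 2)%:E); last by rewrite lte_fin; lra.
  apply: (@le_trans _ _ (\sum_(k <oo) (e / 2 / (2 ^ k.+1)%:R)%:E)).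
    by apply: lee_nneseries => k _; [move=> _; exact: upper_cap_ge0|exact: V1].
  by apply: epsilon_trick0; lra.
move=> x a fa; have [Vx|nVx] := pselect ((\bigcup_k V k) x).
  (* Points of the exceptional set are isolated for the [subspace] topology. *)
  exists [set x] => //.
  rewrite /nbhs/= -nbhs_subspace_out//=.
  by move=> y /= ->.
have [F fxE] : exists F : R, f x = F%:E.
  by exists (fine (f x)); rewrite fineK// ge0_fin_numE//; exact: lt_trans (ltry a).
have fm : f x < ((F + a) / 2)%:E.
  by move: fa; rewrite fxE !lte_fin /=; lra.
have [k] := lt_add_invS (f0 x) fm.
have [cu uf _] := uP k.
rewrite fxE; set q : R := (k.+1%:R^-1)%R; rewrite -EFinD lee_fin => ka.
have fa' : (F < a)%R by rewrite fxE lte_fin in fa.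
have ux : (EFin \o u k) x < (a - q)%:E.
  apply: (le_lt_trans (uf x)); rewrite fxE lte_fin.
  by rewrite ltrBrDr; apply: (le_lt_trans ka); case: (midf_lt fa').
have [N xN NP] := continuous_usc cu.1.1 ux.
exists (N `&` ~` (\bigcup_k V k)).
  rewrite /nbhs/= -nbhs_subspace_in//.
  by apply: filterS xN => y Ny nVy; split.
move=> y [/NP uy nVy].
have : f y - (u k y)%:E <= q%:E.
  by rewrite leNgt; apply/negP => Vy; apply: nVy; exists k.
rewrite leeBlDr// => /le_lt_trans; apply.
move: uy; rewrite /= -EFinD !lte_fin; lra.
Qed.

(** An open exceptional set makes the superlevel sets of [f] closed once it is removed. *)
Lemma quasi_usc_open f (e : R) : quasi_usc G f -> (0 < e)%R ->
  exists V : set X, [/\ open V, upper_cap_set G V <= e%:E &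
    forall x (a : R), ~ V x -> f x < a%:E ->
      exists2 N, nbhs x N & forall y, N y -> ~ V y -> f y < a%:E].
Proof.
move=> [f0 H] e0; have [|V Ve uV] := H (e / 2)%R; first by rewrite divr_gt0.
have [W [oW VW We]] := upper_cap_set_open hX lX sX Ve.
exists W; split => //; first by rewrite mulrC divfK in We.
move=> x a nWx fxa; have nVx : ~ V x by move=> /VW.
have [N] := uV x a fxa; rewrite /nbhs/= -nbhs_subspace_in// => xN NP.
exists [set y | ~ V y -> N y]; first exact: xN.
by move=> y Ny nWy; apply: NP; apply: Ny => /VW.
Qed.

Lemma H0_indic_compact (K : set X) : compact K -> H0 (fun x => (\1_K x)%:E : \bar R).
Proof.
move=> cK; split.
- by move=> x; rewrite lee_fin.
- by move=> x; rewrite ltry.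
- move=> x a; rewrite indicE; case: (boolP (x \in K)) => [_|/negP xK] ax.
    exists setT; first exact: filterT.
    by move=> y _; apply: le_lt_trans ax; rewrite lee_fin indicE lern1 leq_b1.
  exists (~` K).
    apply: open_nbhs_nbhs; split; first by rewrite openC; exact: compact_closed.
    by move=> Kx; apply: xK; exact/mem_set.
  by move=> y Ky; rewrite indicE memNset.
- apply: (has_compact_supportW hX cK) => x nK; by rewrite indicE memNset.
Qed.

Lemma upper_cap_le_H0 h : upper_cap G h <= cap_H0 G h.
Proof.
apply: le_ereal_inf => _ [phi [[Gphi Hphi] hphi] <-]; exists phi; first by split.
exact: cap_GlscE.
Qed.

Lemma mutual_energy_mono mu nu : (forall A : set (borel X), measurable A -> nu A <= mu A) ->
  enorm G nu <= enorm G mu.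
Proof.
move=> numu; rewrite lee_sqrt; last exact: energy_ge0.
apply: (@le_trans _ _ (rint nu (potential G mu))); last first.
  by apply: le_measure_lint => // x; exact: potential_ge0.
apply: le_lint => x; first exact: potential_ge0.
by apply: le_measure_lint => // y; exact: kernel_ge0.
Qed.

Hypothesis cG : consistent G.

(** Where consistency enters: on the compact unit ball, the integrals of [G lam - u n] are
    continuous in the measure and decrease to 0, so by Dini they are uniformly small, which is a
    capacity bound. *)
Lemma potential_approx lam (e : R) : finite_energy G lam -> (0 < e)%R ->
  exists u : X -> R, [/\ Ccp u, forall x, (u x)%:E <= potential G lam x &
    cap_C0 G (fun x => potential G lam x - (u x)%:E) <= e%:E].
Proof.
move=> lamE e0; have [Pfin Pcont] := cG lamE.
have P0 x := potential_ge0 kG lam x.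
have mP := potential_measurable hX lX sX kG lam.
have [u [cu u0 ui uE uI]] := lsc_approx_sup hX lX sX P0 (@potential_lsc R X hX lX sX G kG lam).
have pu n : Ccp (u n) by split.
have up n x : (u n x)%:E <= potential G lam x.
  by rewrite uE; exact: (@le_sup_range _ _ (fun n => (u n x)%:E) _ n).
have dE n mu : unit_energy G mu ->
    lint mu (fun x => potential G lam x - (u n x)%:E) = rint mu (potential G lam) - (radon_int mu (u n))%:E.
  move=> muE.
  have -> : rint mu (potential G lam) = lint mu (fun x => potential G lam x - (u n x)%:E) + (radon_int mu (u n))%:E.
    rewrite -radon_intE// -lintD//.
    - by apply: eq_integral => x _; rewrite -[RHS]/(potential G lam x - (u n x)%:E + (u n x)%:E) subeK.
    - by move=> x; rewrite sube_ge0 ?up.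
    - exact: Ccp_lee0.
    - by apply: emeasurable_funB => //; exact: Ccp_measurable.
    - exact: Ccp_measurable.
  by rewrite addeK.
have [n Pn] : exists n, [set mu | unit_energy G mu] `<=`
    [set mu | rint mu (potential G lam) < (e + radon_int mu (u n))%:E].
  apply: compact_increasing_cover.
  - exact: (energy_ball_compact hX lX sX kG ler01).
  - move=> n mu /= /lt_le_trans; apply; rewrite lee_fin lerD2l.
    exact: le_radon_int.
  (* The real [a] splits the inequality into two open conditions on the measure, the second of them
     open only within the unit ball. *)
  - move=> n mu muE /= /lte_between[a [ra]]; rewrite lte_fin -ltrBlDl => au.
    have N1 : nbhs mu [set nu : radon R X | (a - e < radon_int nu (u n))%R].
      exact: (@radon_int_continuous R X _ (pu n) mu _ (lt_nbhsr au)).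
    have N2 : nbhs mu [set nu : radon R X | unit_energy G nu -> rint nu (potential G lam) < a%:E].
      have /subspace_continuousP Pc := Pcont; have Pm := Pc mu muE.
      have Na : nbhs (rint mu (potential G lam)) [set y | y < a%:E].
        by apply: open_nbhs_nbhs; split; [exact: open_ereal_lt_ereal|].
      exact: (Pm _ Na).
    exists [set nu | (a - e < radon_int nu (u n))%R /\ (unit_energy G nu -> rint nu (potential G lam) < a%:E)].
      exact: filterI N1 N2.
    move=> nu [[H1 H2] /H2 /lt_le_trans]; apply; rewrite lee_fin -lerBlDl; exact: ltW.
  - move=> mu muE; have := Pfin mu muE; rewrite /rint -/(lint _ _) => fin.
    have rE : lint mu (potential G lam) = (fine (lint mu (potential G lam)))%:E.
      by rewrite fineK// ge0_fin_numE//; exact: lint_ge0.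
    have : (fine (lint mu (potential G lam)) - e)%:E < lint mu (potential G lam).
      by rewrite rE lte_fin /=; lra.
    rewrite {2}uI => /ereal_sup_gt[_ [n _ <-]]; rewrite radon_intE// lte_fin => H.
    by exists n => /=; rewrite /rint -/(lint _ _) rE lte_fin; lra.
exists (u n); split => //.
apply: ub_ereal_sup => _ [mu muE <-]; rewrite /rint -/(lint _ _) dE// leeBlDr// -EFinD.
by apply: ltW; exact: Pn.
Qed.

Lemma Glsc_subCcp g u : Glsc g -> Ccp u -> (forall x, (u x)%:E <= g x) ->
  Glsc (fun x => g x - (u x)%:E).
Proof.
move=> [g0 lg] cu ug; split; first by move=> x; rewrite sube_ge0 ?ug.
by apply: lscB_continuous => //; exact: cu.1.1.
Qed.

Lemma potential_approx_upper lam (e : R) : finite_energy G lam -> (0 < e)%R ->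
  exists u : X -> R, [/\ Ccp u, forall x, (u x)%:E <= potential G lam x &
    upper_cap G (fun x => potential G lam x - (u x)%:E) < e%:E].
Proof.
move=> lamE e0; have [|u [cu up uc]] := @potential_approx lam (e / 2) lamE.
  by rewrite divr_gt0.
exists u; split => //; apply: (@le_lt_trans _ _ (e / 2)%:E); last by rewrite lte_fin; lra.
apply: le_trans uc; apply: upper_cap_le_lsc => //.
by apply: Glsc_subCcp => //; exact: Glsc_potential.
Qed.

Lemma potential_quasi_usc lam : finite_energy G lam -> quasi_usc G (potential G lam).
Proof.
move=> lamE; apply: approx_quasi_usc; first by move=> x; exact: potential_ge0.
by move=> e e0; exact: potential_approx_upper.
Qed.

Lemma H0star_approx f : Fplus f ->
  (forall e : R, (0 < e)%R -> exists h, [/\ H0 h, forall x, h x <= f x &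
     upper_cap G (fun x => f x - h x) < e%:E]) -> H0star G f.
Proof.
move=> f0 H; split=> //; apply/eqP; rewrite eq_le; apply/andP; split; last first.
  by apply: le_ereal_inf_tmp => _ [h _ <-]; exact: upper_cap_ge0.
apply/lee_addgt0Pr => e /H[h [Hh hf he]]; rewrite add0e.
apply: le_trans (ltW he); apply: ereal_inf_lbound; exists h => //; by split.
Qed.

Lemma H0star_approxE f : H0star G f ->
  forall e : R, (0 < e)%R -> exists h, [/\ H0 h, forall x, h x <= f x &
     upper_cap G (fun x => f x - h x) < e%:E].
Proof.
move=> [f0 inf0] e e0.
have /ereal_inf_lt[_ [h [Hh hf] <-] he] : ereal_inf [set upper_cap G (f \- h) | h in
    [set h | H0 h /\ forall x, h x <= f x]] < e%:E by rewrite inf0 lte_fin.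
by exists h.
Qed.

Lemma potential_H0star lam : finite_energy G lam -> H0star G (potential G lam).
Proof.
move=> lamE; apply: H0star_approx; first by move=> x; exact: potential_ge0.
move=> e /(potential_approx_upper lamE)[u [cu up uc]].
by exists (EFin \o u); split => //; have [_ ?] := Ccp_C0plus hX cu.
Qed.

Lemma Ccp_H0star u : Ccp u -> H0star G (EFin \o u).
Proof.
move=> cu; apply: H0star_approx; first exact: Ccp_lee0.
move=> e e0; exists (EFin \o u); split => //; first by have [_ ?] := Ccp_C0plus hX cu.
under eq_fun do rewrite subee//.
by rewrite upper_cap0// lte_fin.
Qed.

Lemma Ccp_quasi_usc u : Ccp u -> quasi_usc G (EFin \o u).
Proof.
move=> cu; apply: approx_quasi_usc; first exact: Ccp_lee0.
move=> e e0; exists u; split => //.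
under eq_fun do rewrite subee//.
by rewrite upper_cap0// lte_fin.
Qed.

(* If [h >= G mu + d] on a compact [K], testing the inequality against the
   restriction to [K] of any measure of the unit ball shows that it does not
   charge [K]. *)
Lemma test_compact_null h mu (K : set X) (d : R) : Fplus h -> finite_energy G mu ->
  (forall nu, finite_energy G nu -> rint nu h <= rint nu (potential G mu)) ->
  (0 < d)%R -> compact K -> (forall x, K x -> potential G mu x + d%:E <= h x) ->
  upper_cap_set G K = 0.
Proof.
move=> h0 muE test d0 cK Kh.
have mK : measurable (K : set (borel X)) by apply: closed_borel; exact: compact_closed.
apply/eqP; rewrite eq_le upper_cap_ge0// andbT.
apply: (le_trans (upper_cap_le_H0 _)); apply: (le_trans (cap_H0_le hX lX sX kG (H0_indic_compact cK))).
apply: ub_ereal_sup => _ [nu nuE <-].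
have [rho rhoE] := radon_restr hX lX sX nu mK.
have rhonu (A : set (borel X)) : measurable A -> rho A <= nu A.
  by move=> mA; rewrite rhoE//; apply: le_measure => //; rewrite inE//; exact: measurableI.
have rho1 : unit_energy G rho by exact: le_trans (mutual_energy_mono rhonu) nuE.
have rhoF : finite_energy G rho by rewrite /finite_energy/=; exact: le_lt_trans rho1 (ltry 1).
have p0 x := potential_ge0 kG mu x.
have mp := @potential_measurable R X hX lX sX G kG mu.
have Pfin : rint rho (potential G mu) < +oo by case: (cG muE) => H _; exact: H.
have PE : lint rho (potential G mu) \is a fin_num by rewrite ge0_fin_numE//; exact: lint_ge0.
have d00 := ltW d0.
have : lint rho (fun x => potential G mu x + d%:E) <= lint rho (potential G mu).
  apply: le_trans (test _ rhoF).
  apply: (@lint_null _ _ rho (~` K)) => //.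
  - exact: measurableC.
  - by rewrite rhoE ?setICl ?measure0//; exact: measurableC.
  - by move=> x; rewrite adde_ge0.
  - by move=> x /contrapT/Kh.
rewrite lintD//.
rewrite -leeBrDl// subee// => H.
have : lint rho (fun=> d%:E) = d%:E * rho [set: borel X].
  rewrite -(@lint_indic R X rho setT)// -lintZ//; last first.
    by apply/measurable_EFinP; exact: measurable_indic.
  by congr lint; apply/funext => x; rewrite indicE in_setT mule1.
move=> E; rewrite E in H; rewrite /rint -/(lint _ _) lint_indic//.
move: H; rewrite rhoE// setTI pmule_rle0// => H; exact: H.
Qed.

(** Off a small open [V], the set where [h >= G mu + 1/(n+1)] is closed, [h] being u.s.c. there and
    [G mu] l.s.c. It is then a countable union of compact sets, each of capacity 0 by
    [test_compact_null]. *)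
Lemma qe_le_potential h mu : quasi_usc G h -> finite_energy G mu ->
  (forall nu, finite_energy G nu -> rint nu h <= rint nu (potential G mu)) ->
  qe G (fun x => h x <= potential G mu x).
Proof.
move=> qh muE test; have [h0 _] := qh.
pose E n := [set x | potential G mu x + (n.+1%:R^-1)%:E <= h x].
suff E0 n : upper_cap_set G (E n) = 0.
  exists (\bigcup_n E n); first exact: upper_cap_set_null_bigcup.
  move=> x nE; rewrite leNgt; apply/negP => /(lt_add_invS (potential_ge0 kG mu x))[n Hn].
  by apply: nE; exists n.
apply/eqP; rewrite eq_le upper_cap_ge0// andbT; apply/lee_addgt0Pr => e e0; rewrite add0e.
have [V [oV Ve VP]] := quasi_usc_open qh e0.
have d0 : (0 < n.+1%:R^-1 :> R)%R by rewrite invr_gt0.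
have cF : closed (E n `\` V).
  rewrite -(setCK (E n `\` V)) closedC openE => x /= nF.
  have [Vx|nVx] := pselect (V x).
    apply: (@filterS _ _ _ V); first by move=> y Vy [_ nVy].
    exact: open_nbhs_nbhs.
  have : h x < potential G mu x + (n.+1%:R^-1)%:E.
    by rewrite ltNge; apply/negP => Ex; apply: nF.
  move=> /lte_between[a [ha aP]].
  have [N xN NP] := VP x a nVx ha.
  have [M xM MP] : exists2 M, nbhs x M & forall y, M y -> (a - n.+1%:R^-1)%:E < potential G mu y.
    by apply: potential_lsc => //; rewrite EFinB lteBlDr.
  apply: (@filterS _ _ _ (N `&` M)); last exact: filterI.
  move=> y [Ny My] [Ey nVy].
  have := NP y Ny nVy; apply/negP; rewrite -leNgt; apply: le_trans Ey.
  by have := MP y My; rewrite EFinB lteBlDr// => /ltW.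
have [K [cK _ KT]] := @open_exhaustion R X hX lX sX _ openT.
have F0 : upper_cap_set G (\bigcup_k ((E n `\` V) `&` K k)) = 0.
  apply: upper_cap_set_null_bigcup => // k.
  apply: (@test_compact_null h mu _ (n.+1%:R^-1)%R) => //.
    by rewrite setIC; exact: compact_closedI.
  by move=> x [[Ex _] _].
apply: (@le_trans _ _ (upper_cap_set G ((\bigcup_k ((E n `\` V) `&` K k)) `|` V))).
  apply: le_upper_cap_set => x Ex; have [Vx|nVx] := pselect (V x); [by right|left].
  have : (\bigcup_n K n) x by rewrite KT.
  by move=> [k _ Kx]; exists k.
by apply: (le_trans (upper_cap_setU hX lX sX kG _ _)); rewrite F0 add0e.
Qed.

End QuasiTopology.

(** * Capacitary measures and envelopes *)

Section CapacitaryMeasures.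
Context {R : realType} {X : ptopologicalType}.
Implicit Types (f g h phi : X -> \bar R) (u v : X -> R) (mu nu rho lam : radon R X).
Hypothesis hX : hausdorff_space X.
Hypothesis lX : locally_compact [set: X].
Hypothesis sX : @second_countable X.
Variable G : X * X -> \bar R.
Hypothesis kG : is_kernel G.
Local Open Scope ereal_scope.

(** Vague upper semicontinuity on an energy ball. For [h] in [H0] it comes from test functions
    decreasing to [h]; in general [h <= k + g], where the l.s.c. [g] contributes at most its
    capacity times [r]. *)
Lemma le_cap_energy_H0star h (F : set_system (radon R X)) mu (r s : R) :
  ProperFilter F -> (0 <= r)%R -> F --> mu -> H0star G h ->
  F [set nu | enorm G nu <= r%:E] -> F [set nu | s%:E <= rint nu h] ->
  s%:E <= rint mu h.
Proof.
move=> FF r0 Fmu Hh Fr Fs; have [h0 _] := Hh.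
apply/lee_addgt0Pr => e e0.
have d0 : (0 < e / (r + 1))%R by rewrite divr_gt0// ltr_wpDl.
have [k [Hk kh kcap]] := H0star_approxE Hh d0.
have [k0 koo uk _] := Hk.
have kfin x : k x \is a fin_num by rewrite ge0_fin_numE.
have mk : measurable_fun [set: borel X] k by apply: usc_measurable.
have [g [[g0 lg] hkg gd]] := upper_cap_ltP hX lX sX kcap.
have Fk : F [set nu | (s - e)%:E <= lint nu k].
  apply: filterS (filterI Fr Fs) => nu [/= nur nus].
  have nuF : finite_energy G nu by rewrite /finite_energy/=; exact: le_lt_trans nur (ltry r).
  have : rint nu h <= lint nu k + lint nu g.
    rewrite -lintD//; last by apply: lsc_measurable.
    by apply: le_lint => // x; have := hkg x; rewrite leeBlDl.
  move=> /(le_trans nus) H.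
  have L1 : lint nu g <= e%:E.
    apply: (le_trans (rint_le_cap_enorm hX lX sX kG g0 nuF (ltW gd))).
    apply: (@le_trans _ _ ((e / (r + 1))%:E * r%:E)).
      by apply: lee_wpmul2l => //; rewrite lee_fin ltW.
    rewrite -EFinM lee_fin mulrAC ler_pdivrMr ?ltr_wpDl// ler_pM2l//.
    by rewrite lerDl.
  rewrite EFinB leeBlDr//; apply: (le_trans H); exact: leeD.
suff : (s - e)%:E <= lint mu k.
  rewrite EFinB leeBlDr// => /le_trans; apply.
  by rewrite leeD2r//; exact: le_lint.
rewrite leNgt; apply/negP => kmu.
have [v [cv kv vi vl]] := H0_approx hX lX sX Hk.
have [n vn] := lint_H0_approx hX Hk cv kv vi vl kmu.
have pv : Ccp (v n) by split => // x; rewrite -lee_fin; exact: le_trans (kv n x).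
have Fv : F [set nu | (radon_int nu (v n) < s - e)%R].
  have FF' : Filter F by exact: filter_filter.
  exact: (vague_cvg_Ccp FF' Fmu pv (lt_nbhsl vn)).
have [nu [/= Hk' Hv]] := filter_ex (filterI Fk Fv).
move: Hv; apply/negP; rewrite -leNgt -lee_fin -radon_intE//.
by apply: (le_trans Hk'); apply: le_lint => //; exact: kv.
Qed.

(** An ultrafilter finer than the tails of the sequence plays the role of a convergent
    subsequence. *)
Lemma energy_ball_seq (mu : nat -> radon R X) (r : R) : (0 <= r)%R ->
  (forall n, enorm G (mu n) <= r%:E) ->
  exists (F : set_system (radon R X)) lam, [/\ ProperFilter F, F --> lam,
    enorm G lam <= r%:E & forall N, F [set mu n | n in [set n | (N <= n)%N]]].
Proof.
move=> r0 muE; pose F0 : set_system (radon R X) := mu n @[n --> \oo].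
have F0P : ProperFilter F0 by exact: fmap_proper_filter.
have [F [FU F0F]] := ultraFilterLemma F0P.
have FP := @ultra_proper _ _ FU.
have := energy_ball_compact hX lX sX kG r0; rewrite compact_ultra.
have Fr : F [set mu | enorm G mu <= r%:E].
  by apply: F0F; exists 0%N => // n _ /=; exact: muE.
move=> /(_ F FU Fr)[lam [lamE Flam]].
exists F, lam; split => // N; apply: F0F; exists N => // n /= Nn; by exists n.
Qed.

Hypothesis cG : consistent G.
Hypothesis pG : positive_definite G.

Lemma enorm_fin mu : finite_energy G mu -> exists2 a : R, (0 <= a)%R & enorm G mu = a%:E.
Proof.
rewrite /finite_energy/= => muE; exists (fine (enorm G mu)).
  by apply: fine_ge0; exact: enorm_ge0.
by rewrite fineK// ge0_fin_numE// enorm_ge0.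
Qed.

Lemma ball_finite_energy mu (r : R) : enorm G mu <= r%:E -> finite_energy G mu.
Proof. by rewrite /finite_energy/= => /le_lt_trans; apply; rewrite ltry. Qed.

Lemma mutual_fin mu nu : finite_energy G mu -> finite_energy G nu ->
  exists2 a : R, (0 <= a)%R & rint nu (potential G mu) = a%:E.
Proof.
move=> muE nuE; have := pG muE nuE.
have [a a0 ->] := enorm_fin muE; have [b b0 ->] := enorm_fin nuE; rewrite -EFinM => H.
have e0 := energy_ge0 kG mu nu.
exists (fine (rint nu (potential G mu))); first exact: fine_ge0.
by rewrite fineK// ge0_fin_numE//; exact: le_lt_trans H (ltry _).
Qed.

Lemma energy_comb mu nu rho (s t : R) : (0 <= s)%R -> (0 <= t)%R ->
  (forall A : set (borel X), measurable A -> rho A = s%:E * mu A + t%:E * nu A) ->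
  rint rho (potential G rho) =
   (s ^+ 2)%:E * rint mu (potential G mu) + (2 * s * t)%:E * rint nu (potential G mu) +
   (t ^+ 2)%:E * rint nu (potential G nu).
Proof.
move=> s0 t0 rhoE.
have p0 (m : radon R X) x : 0 <= potential G m x := potential_ge0 kG m x.
have mp (m : radon R X) := @potential_measurable R X hX lX sX G kG m.
have potE x : potential G rho x = s%:E * potential G mu x + t%:E * potential G nu x.
  rewrite /potential /rint -!/(lint _ _); apply: lint_comb => //.
    by apply: lsc_measurable; exact: kernel_section_lsc.
  by move=> y; exact: kernel_ge0.
have intE (m : radon R X) :
    rint m (potential G rho) = s%:E * rint m (potential G mu) + t%:E * rint m (potential G nu).
  rewrite /rint -!/(lint _ _) -lintZ// -lintZ// -lintD//; try by move=> x; rewrite mule_ge0.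
  - by apply: eq_integral => x _; exact: potE.
  - by apply: measurable_funeM.
  - by apply: measurable_funeM.
transitivity (s%:E * rint mu (potential G rho) + t%:E * rint nu (potential G rho)).
  exact: (lint_comb s0 t0 rhoE).
rewrite !intE (mutual_energy_sym hX lX sX kG nu mu).
have e0 (m m' : radon R X) : 0 <= rint m (potential G m') := energy_ge0 kG m' m.
move: (e0 mu mu) (e0 nu mu) (e0 nu nu).
move: (rint mu _) (rint nu _) (rint nu _) => x y z x0 y0 z0.
rewrite !ge0_muleDr; try by rewrite mule_ge0// lee_fin.
rewrite !muleA -!EFinM -!expr2 (mulrC t s) addeA; congr (_ + _).
rewrite -addeA; congr (_ + _).
by rewrite -ge0_muleDl ?lee_fin ?mulr_ge0// -EFinD; congr (_%:E * _); ring.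
Qed.

(** Brings integral and norm down to real numbers, so that the quadratic inequalities below are
    plain real algebra. *)
Lemma rint_energy_fin h (c : R) nu : Fplus h -> cap_C0 G h = c%:E -> finite_energy G nu ->
  exists a b : R, [/\ rint nu h = a%:E, enorm G nu = b%:E, (0 <= a)%R, (0 <= b)%R & (a <= c * b)%R].
Proof.
move=> h0 hc nuE; have hle : cap_C0 G h <= c%:E by rewrite hc.
have := rint_le_cap_enorm hX lX sX kG h0 nuE hle.
have [b b0 nub] := enorm_fin nuE; rewrite nub -EFinM => H.
have a0 : 0 <= rint nu h by exact: lint_ge0.
have afin : rint nu h \is a fin_num by rewrite ge0_fin_numE//; exact: le_lt_trans H (ltry _).
exists (fine (rint nu h)), b; split => //; first by rewrite fineK.
  exact: fine_ge0.
by rewrite -lee_fin fineK.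
Qed.

Lemma rint_scale_ge h mu rho (c : R) : (0 <= c)%R ->
  (forall A : set (borel X), measurable A -> rho A = c%:E * mu A) ->
  Fplus h -> c%:E * rint mu h <= rint rho h.
Proof.
move=> c0 rhoE h0.
have rhoE' (A : set (borel X)) : measurable A -> rho A = c%:E * mu A + 0%:E * mu A.
  by move=> mA; rewrite mul0e adde0 rhoE.
by have := lint_comb_ge c0 (lexx 0%R) rhoE' h0; rewrite mul0e adde0.
Qed.

Lemma cap_attained h (c : R) : H0star G h -> cap_C0 G h = c%:E ->
  exists2 mu, unit_energy G mu & c%:E <= rint mu h.
Proof.
move=> Hh hc.
have apx n : exists mu, unit_energy G mu /\ (c - n.+1%:R^-1)%:E <= rint mu h.
  have : (c - n.+1%:R^-1)%:E < cap_C0 G h by rewrite hc lte_fin ltrBlDr ltrDl invr_gt0.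
  by move=> /ereal_sup_gt[_ [mu muE <-] H]; exists mu; split => //; exact: ltW.
pose mu n := projT1 (cid (apx n)).
have muP n : unit_energy G (mu n) /\ (c - n.+1%:R^-1)%:E <= rint (mu n) h.
  by rewrite /mu; case: cid.
have [F [lam [FP Flam lamE FN]]] := energy_ball_seq ler01 (fun n => (muP n).1).
exists lam => //; apply/lee_addgt0Pr => e e0; rewrite -leeBlDr// -EFinB.
apply: (le_cap_energy_H0star FP ler01 Flam Hh).
  by apply: filterS (FN 0%N) => _ [n _ <-]; exact: (muP n).1.
apply: filterS (FN (Num.bound e^-1)) => _ [n /= Nn <-]; apply: le_trans (muP n).2.
rewrite lee_fin lerD2l lerN2 invf_ple ?posrE//; apply: ltW.
apply: (lt_le_trans (archi_boundP _)); first by rewrite invr_ge0 ltW.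
by rewrite ler_nat (leq_trans Nn).
Qed.

(** The maximum of [2 int h dnu - |nu|^2] is [c^2], reached at [c] times a maximizer of the unit
    ball. For a maximizer [mu], [c^2 <= 2 c |mu| - |mu|^2] forces [|mu| = c]. *)
Lemma M_capP h (c : R) mu : H0star G h -> cap_C0 G h = c%:E ->
  M_cap G h mu <-> enorm G mu <= c%:E /\ (c ^+ 2)%:E <= rint mu h.
Proof.
move=> Hh hc; have [h0 _] := Hh.
have c0 : (0 <= c)%R by rewrite -lee_fin -hc; exact: (cap_C0_ge0 hX lX sX kG).
split=> [[muE mumax]|[muc cmu]].
  have [mu1 mu1E mu1h] := cap_attained Hh hc.
  have [rho rhoE] := radon_scale hX lX sX mu1 c0.
  have rhoe := energy_scale hX lX sX kG c0 rhoE.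
  have rhoc : enorm G rho <= c%:E.
    by rewrite rhoe -[leRHS]mule1; apply: lee_wpmul2l; rewrite ?lee_fin.
  have rhoF := ball_finite_energy rhoc.
  have rhoh : (c * c)%:E <= rint rho h.
    rewrite EFinM; apply: (@le_trans _ _ (c%:E * rint mu1 h)).
      by apply: lee_wpmul2l; rewrite ?lee_fin.
    exact: (rint_scale_ge c0 rhoE h0).
  have [a [m [ha hm a0 m0 acm]]] := rint_energy_fin h0 hc muE.
  have [a' [b [ha' hb _ b0 _]]] := rint_energy_fin h0 hc rhoF.
  have := mumax rho rhoF.
  move: rhoc rhoh; rewrite ha hm ha' hb -!EFin_expe -!EFinM -!EFinB !lee_fin => bc ca'.
  move=> H; have bc2 : (b ^+ 2 <= c ^+ 2)%R by rewrite lerXn2r ?nnegrE.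
  have mc : m = c.
    apply/eqP; rewrite -subr_eq0 -sqrf_eq0 eq_le sqr_ge0 andbT sqrrB; nra.
  by rewrite mc; split => //; nra.
split=> [|nu nuE]; first exact: ball_finite_energy muc.
have [a [m [ha hm a0 m0 acm]]] := rint_energy_fin h0 hc (ball_finite_energy muc).
have [a' [b [-> -> _ b0 acb]]] := rint_energy_fin h0 hc nuE.
move: muc cmu; rewrite ha hm -!EFin_expe -!EFinM -!EFinB !lee_fin => mc ca.
have mc2 : (m ^+ 2 <= c ^+ 2)%R by rewrite lerXn2r ?nnegrE.
have := sqr_ge0 (c - b); rewrite sqrrB; nra.
Qed.

Lemma M_cap_nonempty h (c : R) : H0star G h -> cap_C0 G h = c%:E -> M_cap G h !=set0.
Proof.
move=> Hh hc; have [h0 _] := Hh.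
have c0 : (0 <= c)%R by rewrite -lee_fin -hc; exact: (cap_C0_ge0 hX lX sX kG).
have [mu1 mu1E mu1h] := cap_attained Hh hc.
have [rho rhoE] := radon_scale hX lX sX mu1 c0.
exists rho; apply/(M_capP rho Hh hc); split.
  rewrite (energy_scale hX lX sX kG c0 rhoE) -[leRHS]mule1.
  by apply: lee_wpmul2l; rewrite ?lee_fin.
rewrite expr2 EFinM; apply: (@le_trans _ _ (c%:E * rint mu1 h)).
  by apply: lee_wpmul2l; rewrite ?lee_fin.
exact: (rint_scale_ge c0 rhoE h0).
Qed.

Lemma M_cap_compact h (c : R) : H0star G h -> cap_C0 G h = c%:E -> compact (M_cap G h).
Proof.
move=> Hh hc; have [h0 _] := Hh.
have c0 : (0 <= c)%R by rewrite -lee_fin -hc; exact: (cap_C0_ge0 hX lX sX kG).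
rewrite compact_ultra => F FU FM; have FP := @ultra_proper _ _ FU.
have Fc : F [set mu | enorm G mu <= c%:E].
  by apply: filterS FM => mu /(M_capP mu Hh hc)[].
have Fh : F [set mu | (c ^+ 2)%:E <= rint mu h].
  by apply: filterS FM => mu /(M_capP mu Hh hc)[].
have := energy_ball_compact hX lX sX kG c0; rewrite compact_ultra => /(_ F FU Fc)[lam [lamE Flam]].
exists lam; split => //; apply/(M_capP lam Hh hc); split => //.
exact: (le_cap_energy_H0star FP c0 Flam Hh).
Qed.

Lemma M_cap_convex h (c : R) : H0star G h -> cap_C0 G h = c%:E -> convex_radon (M_cap G h).
Proof.
move=> Hh hc mu nu /(M_capP mu Hh hc)[muc muh] /(M_capP nu Hh hc)[nuc nuh] t /andP[t0 t1].
have [h0 _] := Hh.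
have c0 : (0 <= c)%R by rewrite -lee_fin -hc; exact: (cap_C0_ge0 hX lX sX kG).
have t1' : (0 <= 1 - t)%R by rewrite subr_ge0.
have [rho rhoE] := radon_comb hX lX sX mu nu t0 t1'.
exists rho => //; apply/(M_capP rho Hh hc).
have muF := ball_finite_energy muc; have nuF := ball_finite_energy nuc.
split.
  rewrite (enorm_le _ _ c0)// (energy_comb t0 t1' rhoE).
  rewrite -!(enorm_sqr kG); have := pG muF nuF.
  have [m m0 hm] := enorm_fin muF; have [n n0 hn] := enorm_fin nuF.
  have [a a0 ->] := mutual_fin muF nuF.
  move: muc nuc; rewrite hm hn -!EFin_expe -!EFinM -!EFinD !lee_fin => mc nc amn.
  have m2 : (m ^+ 2 <= c ^+ 2)%R by rewrite lerXn2r ?nnegrE.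
  have n2 : (n ^+ 2 <= c ^+ 2)%R by rewrite lerXn2r ?nnegrE.
  have ac : (a <= c ^+ 2)%R by apply: (le_trans amn); rewrite expr2 ler_pM.
  (* Expanding [(t + (1 - t))^2] lets the three energies be compared with [c^2] one by one. *)
  rewrite (_ : c ^+ 2 = t ^+ 2 * c ^+ 2 + 2 * t * (1 - t) * c ^+ 2 + (1 - t) ^+ 2 * c ^+ 2)%R; last by ring.
  by rewrite !lerD// ler_wpM2l ?sqr_ge0// ?mulr_ge0.
apply: le_trans (lint_comb_ge t0 t1' rhoE h0).
apply: (@le_trans _ _ (t%:E * (c ^+ 2)%:E + (1 - t)%:E * (c ^+ 2)%:E)).
  by rewrite -!EFinM -EFinD lee_fin -mulrDl addrC subrK mul1r.
by rewrite leeD// lee_wpmul2l ?lee_fin.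
Qed.

(** Comparing [mu] with [mu + t nu] gives [2 int h dnu <= 2 int G mu dnu + t |nu|^2]; let [t] tend
    to 0. *)
Lemma M_cap_variation h (c : R) mu nu : H0star G h -> cap_C0 G h = c%:E ->
  M_cap G h mu -> finite_energy G nu -> rint nu h <= rint nu (potential G mu).
Proof.
move=> Hh hc [muF mumax] nuF; have [h0 _] := Hh.
have [a [m [ha hm a0 m0 _]]] := rint_energy_fin h0 hc muF.
have [b [n [hb hn b0 n0 _]]] := rint_energy_fin h0 hc nuF.
have [d d0 hd] := mutual_fin muF nuF; rewrite hb hd lee_fin.
suff H t : (0 < t)%R -> (2 * b <= 2 * d + t * n ^+ 2)%R.
  apply/ler_addgt0Pr => e e0.
  have t0 : (0 < 2 * e / (n ^+ 2 + 1))%R by rewrite divr_gt0 ?mulr_gt0// ltr_wpDl ?sqr_ge0.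
  have := H _ t0; suff : (2 * e / (n ^+ 2 + 1) * n ^+ 2 <= 2 * e)%R by lra.
  rewrite mulrAC ler_pdivrMr ?ltr_wpDl ?sqr_ge0// ler_pM2l ?mulr_gt0//.
  by rewrite lerDl.
move=> t0; have [rho rhoE] := radon_comb hX lX sX mu nu ler01 (ltW t0).
have re := energy_comb ler01 (ltW t0) rhoE.
have rh : 1%:E * rint mu h + t%:E * rint nu h <= rint rho h := lint_comb_ge ler01 (ltW t0) rhoE h0.
rewrite -!(enorm_sqr kG) hm hn hd -!EFin_expe -!EFinM -!EFinD in re.
have rhoF : finite_energy G rho.
  rewrite /finite_energy/= ltNge leye_eq; apply/eqP => E; move: re; rewrite E.
  by rewrite expe2 mulyy.
have [a' [m' [ha' hm' _ _ _]]] := rint_energy_fin h0 hc rhoF.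
have := mumax rho rhoF; move: re rh.
rewrite ha hb ha' hm hm' -!EFin_expe -!EFinM -!EFinB -!EFinD !lee_fin => -[re] rh.
rewrite re => H; suff : (t * (2 * b) <= t * (2 * d + t * n ^+ 2))%R by rewrite ler_pM2l.
nra.
Qed.

End CapacitaryMeasures.

(** * Envelopes of functions of finite upper capacity *)

Section EnvelopeCapacity.
Context {R : realType} {X : ptopologicalType}.
Implicit Types (f g h phi fs : X -> \bar R) (u v : X -> R) (mu nu rho lam : radon R X).
Hypothesis hX : hausdorff_space X.
Hypothesis lX : locally_compact [set: X].
Hypothesis sX : @second_countable X.
Variable G : X * X -> \bar R.
Hypothesis kG : is_kernel G.
Hypothesis cG : consistent G.
Hypothesis pG : positive_definite G.
Local Open Scope ereal_scope.

(** The equality case of an integral inequality, for [f] possibly not Borel: a Borel minorant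
    attaining the integral of [f], capped by [g], still has the integral of [g], so it equals [g]
    almost everywhere. *)
Lemma lint_le_ae (m : {measure set (borel X) -> \bar R}) (N : set (borel X)) f g :
  measurable N -> m N = 0 -> (forall x, ~ N x -> f x <= g x) -> (forall x, 0 <= f x) ->
  (forall x, 0 <= g x) -> measurable_fun [set: borel X] g ->
  lint m g < +oo -> lint m g <= lint m f ->
  exists N' : set (borel X), [/\ measurable N', m N' = 0 & forall x, ~ N' x -> g x <= f x].
Proof.
move=> mN N0 fg f0 g0 mg goo gf.
have [h [mh h0 hf hE]] := lint_attained m f0.
pose k x := mine (h x) (g x).
have mk : measurable_fun [set: borel X] k by exact: measurable_mine.
have k0 x : 0 <= k x by rewrite le_min h0 g0.
have gk : lint m g <= lint m k.
  apply: (le_trans gf); rewrite -hE; apply: (lint_null mN N0) => // x Nx.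
  by rewrite le_min lexx (le_trans (hf x))// fg.
have kfin : lint m k \is a fin_num.
  rewrite ge0_fin_numE ?lint_ge0//; apply: le_lt_trans goo.
  by apply: le_lint => // x; rewrite ge_min lexx orbT.
pose D n : set (borel X) := [set x | k x + (n.+1%:R^-1)%:E <= g x].
have mD n : measurable (D n).
  rewrite -[D n]setTI; apply: measurable_lee => //.
  exact: emeasurable_funD.
have D0 n : m (D n) = 0.
  have e0 : (0 < n.+1%:R^-1 :> R)%R by rewrite invr_gt0.
  have : lint m (fun x => k x + (n.+1%:R^-1)%:E * (\1_(D n) x)%:E) <= lint m g.
    apply: le_lint => x; first by rewrite adde_ge0// mule_ge0// lee_fin ltW.
    rewrite indicE; case: (boolP (x \in D n)) => [/set_mem Dx|_]; first by rewrite mule1.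
    by rewrite mule0 adde0 ge_min lexx orbT.
  have mi : measurable_fun [set: borel X] (fun x : borel X => (\1_(D n) x)%:E : \bar R).
    by apply/measurable_EFinP; exact: measurable_indic.
  rewrite lintD//; last exact: measurable_funeM.
  rewrite lintZ ?(ltW e0)// lint_indic// => /le_trans/(_ gk).
  rewrite addeC -leeBrDr// subee// => Dle; apply/eqP; rewrite eq_le measure_ge0 andbT.
  by rewrite -(@lee_pmul2l _ (n.+1%:R^-1)%:E) ?lte_fin// mule0.
exists (\bigcup_n D n); split.
- exact: bigcup_measurable.
- apply/negligibleP; first exact: bigcup_measurable.
  by apply: negligible_bigcup => n; exists (D n); split.
move=> x nD; rewrite leNgt; apply/negP => fgx.
have : k x < g x by rewrite gt_min (le_lt_trans (hf x)).
by move=> /(lt_add_invS (k0 x))[n ?]; apply: nD; exists n.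
Qed.

(** For [k >= n], [int u n dnu <= int u k dnu <= int G (mu k) dnu = int G nu d(mu k)]. The last
    integrand does not depend on [k], so the inequality survives the limit in [k]. *)
Lemma lsc_le_potential g (c : R) : Glsc g -> cap_C0 G g = c%:E ->
  exists2 lam, enorm G lam <= c%:E & qe G (fun x => g x <= potential G lam x).
Proof.
move=> [g0 lg] gc.
have c0 : (0 <= c)%R by rewrite -lee_fin -gc; exact: (cap_C0_ge0 hX lX sX kG).
have [u [cu u0 ui ug _]] := lsc_approx_sup hX lX sX g0 lg.
have pu n : Ccp (u n) by split.
have Hu n := @Ccp_H0star R X hX lX sX G kG (u n) (pu n).
have une x n : (u n x)%:E <= g x by rewrite ug; apply: ereal_sup_ubound; exists n.
have u0e n x : 0 <= (EFin \o u n) x by rewrite lee_fin.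
have uc n : exists2 d : R, cap_C0 G (EFin \o u n) = d%:E & (d <= c)%R.
  have d0 := cap_C0_ge0 hX lX sX kG (u0e n).
  have dc : cap_C0 G (EFin \o u n) <= c%:E by rewrite -gc; apply: le_cap_C0 => // x; exact: une.
  exists (fine (cap_C0 G (EFin \o u n))).
    by rewrite fineK// ge0_fin_numE//; exact: le_lt_trans dc (ltry _).
  by rewrite -lee_fin fineK// ge0_fin_numE//; exact: le_lt_trans dc (ltry _).
have ex n : exists mu, enorm G mu <= c%:E /\ M_cap G (EFin \o u n) mu.
  have [d hd dc] := uc n; have [mu muM] := M_cap_nonempty hX lX sX kG (Hu n) hd.
  exists mu; split => //; have [mud _] := (M_capP hX lX sX kG mu (Hu n) hd).1 muM.
  by apply: le_trans mud _; rewrite lee_fin.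
pose mu n := projT1 (cid (ex n)).
have muP n : enorm G (mu n) <= c%:E /\ M_cap G (EFin \o u n) (mu n).
  by rewrite /mu; case: cid.
have [F [lam [FP Flam lamE FN]]] := energy_ball_seq hX lX sX kG c0 (fun n => (muP n).1).
exists lam => //; have lamF := ball_finite_energy lamE.
have [uN] : qe G (fun x => forall n, (u n x)%:E <= potential G lam x).
  apply: (qe_forall hX lX sX kG) => n.
  apply: (qe_le_potential hX lX sX kG cG (h := EFin \o u n)) => //.
    exact: Ccp_quasi_usc.
  move=> nu nuF; have [d hd dc] := uc n.
  have [a [b [ha _ _ _ _]]] := rint_energy_fin hX lX sX kG (u0e n) hd nuF.
  rewrite ha (mutual_energy_sym hX lX sX kG).
  apply: (le_cap_energy_H0star hX lX sX kG FP c0 Flam (potential_H0star hX lX sX kG cG nuF)).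
    by apply: filterS (FN 0%N) => _ [k _ <-]; exact: (muP k).1.
  apply: filterS (FN n) => _ [k /= nk <-]; rewrite -ha.
  have [d' hd' _] := uc k.
  have := M_cap_variation hX lX sX kG pG (Hu k) hd' (muP k).2 nuF.
  rewrite (mutual_energy_sym hX lX sX kG); apply: le_trans.
  apply: le_lint => // x; rewrite lee_fin.
  by have /nondecreasing_seqP/(_ n k nk) : forall i, (u i x <= u i.+1 x)%R by [].
move=> uN0 H; exists uN => // x /H ux; rewrite ug; apply: ub_ereal_sup => _ [n _ <-].
exact: ux.
Qed.

(** With a test function [u] close to [G lam] from below, cut [phi] off at [u] and at the bad set
    [V]. Off [V] the loss is at most [G lam - u]; on [V] it is at most [(G lam - u) + M]. *)
Lemma quasi_usc_H0star phi lam : quasi_usc G phi -> finite_energy G lam ->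
  qe G (fun x => phi x <= potential G lam x) -> H0star G phi.
Proof.
move=> qphi lamF [E E0 phiE]; have [phi0 _] := qphi.
apply: H0star_approx => // e e0.
have d0 : (0 < e / 4)%R by rewrite divr_gt0.
have [u [cu up uc]] := potential_approx_upper hX lX sX kG cG lamF d0.
have [[cu1 su] u0] := cu; have [M M0 uM] := Cc_bounded cu.1.
have M1 : (0 < M + 1)%R by rewrite ltr_wpDl.
have [|V [oV Ve phiV]] := @quasi_usc_open R X hX lX sX G phi (e / 4 / (M + 1))%R qphi.
  by rewrite divr_gt0.
(* The value 0 on the open set [V] preserves upper semicontinuity everywhere, and [h <= u] gives
   finiteness and compact support. *)
pose h x := if x \in V then 0 else mine (phi x) (u x)%:E.
have u0e x : 0 <= (u x)%:E by rewrite lee_fin.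
have h0 x : 0 <= h x by rewrite /h; case: ifP => // _; rewrite le_min phi0 u0e.
have hu x : h x <= (u x)%:E by rewrite /h; case: ifP => // _; rewrite ge_min lexx orbT.
have hphi x : h x <= phi x by rewrite /h; case: ifP => // _; rewrite ge_min lexx.
exists h; split => //.
  split => //.
  - by move=> x; apply: le_lt_trans (hu x) (ltry _).
  - move=> x a ha; case: (boolP (x \in V)) => [/set_mem Vx|/negP xV].
      exists V; first exact: open_nbhs_nbhs.
      by move=> y /mem_set yV; rewrite /h yV; apply: le_lt_trans ha.
    have nV : ~ V x by move=> /mem_set.
    have a0 : 0 < a%:E by apply: le_lt_trans ha.
    move: (ha); rewrite {1}/h (negbTE (introN idP xV)) gt_min => /orP[pa|ua].
      have [N Nx NP] := phiV x a nV pa; exists N => // y Ny.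
      rewrite /h; case: ifPn => // /negP yV; rewrite gt_min NP// => /mem_set.
      exact: yV.
    exists [set y | (u y < a)%R].
      by apply: (cu1 x [set z | (z < a)%R]); move: ua; rewrite lte_fin; exact: lt_nbhsl.
    by move=> y /= ya; apply: le_lt_trans (hu y) _; rewrite lte_fin.
  have [K cK uK] := compact_supportP su; apply: (has_compact_supportW hX cK) => x Kx.
  by apply/le_anti; rewrite h0 andbT (le_trans (hu x))// uK.
have p0 x : 0 <= potential G lam x - (u x)%:E by rewrite sube_ge0 ?up.
have V0 x : 0 <= (M + 1)%:E * (\1_V x)%:E by rewrite mule_ge0// lee_fin// ltW.
have := @upper_capD R X hX lX sX G kG (fun x => phi x - h x)
  (fun x => potential G lam x - (u x)%:E) (fun x => (M + 1)%:E * (\1_V x)%:E + oo_on E x).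
move=> /(_ p0)/(_ (fun x => adde_ge0 (V0 x) (oo_on_ge0 _ _))) Hle.
(* The bounds add up to [3 e / 4]; the factor 2 provides the strict bound on the capacity of [V]
   that [upper_cap_le_scale] asks for. *)
apply: (@le_lt_trans _ _ ((e / 4)%:E + (M + 1)%:E * (2 * (e / 4 / (M + 1)))%:E)); last first.
  have M10 : (M + 1 != 0)%R by rewrite gt_eqF.
  by rewrite -EFinM -EFinD lte_fin mulrCA (mulrC (M + 1)%R) divfK//; lra.
apply: (le_trans (Hle _)); last first.
  apply: leeD; first exact: ltW.
  apply: (le_trans (@upper_capD R X hX lX sX G kG _ (fun x => (M + 1)%:E * (\1_V x)%:E)
    (oo_on E) _ _ (fun=> lexx _))) => //.
    exact: oo_on_ge0.
  rewrite upper_cap_oo_on// adde0 -EFinM.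
  apply: (upper_cap_le_scale hX lX sX M1 (fun=> lexx _)).
  apply: le_lt_trans Ve _; rewrite lte_fin; have : (0 < e / 4 / (M + 1))%R by rewrite divr_gt0.
  lra.
move=> x; case: (boolP (x \in E)) => [xE|/negP xE].
  have noo (y : \bar R) : 0 <= y -> y + +oo = +oo by case: y.
  by rewrite /oo_on xE !noo ?leey.
have nE : ~ E x by move=> /mem_set.
have := phiE x nE; rewrite /oo_on (negbTE (introN idP xE)) adde0 indicE /h => pG'.
case: (boolP (x \in V)) => xV.
  rewrite mule1 sube0; apply: (le_trans pG').
  rewrite -addeA -[leLHS]adde0 leeD2l// -EFinN -EFinD lee_fin.
  have := uM x; have := ler_norm (u x); lra.
rewrite mule0 adde0; case: (leP (phi x) (u x)%:E) => pu.
  rewrite subee//; rewrite ge0_fin_numE//; exact: le_lt_trans pu (ltry _).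
exact: leeB.
Qed.

Lemma cap_C0_le_upper h : (forall x, 0 <= h x) -> cap_C0 G h <= upper_cap G h.
Proof.
move=> h0; apply: le_ereal_inf_tmp => _ [g [Gg hg] <-].
by rewrite cap_GlscE//; exact: le_cap_C0.
Qed.

(** [cap_C0 G h] lies between the two capacities, and a minorant [k] in [H0] with [h - k] of
    capacity below [e] brings them within [e]. *)
Lemma H0star_cap h : H0star G h -> lower_cap G h = upper_cap G h.
Proof.
move=> Hh; have [h0 _] := Hh; apply/eqP; rewrite eq_le; apply/andP; split.
  apply: ub_ereal_sup => _ [k [Hk kh] <-].
  apply: (le_trans (cap_H0_le hX lX sX kG Hk)).
  by apply: le_trans (cap_C0_le_upper h0); apply: le_cap_C0 => //; case: Hk.
apply/lee_addgt0Pr => e e0; have [k [Hk kh kcap]] := H0star_approxE Hh e0.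
have [k0 koo _ _] := Hk.
have kfin x : k x \is a fin_num by rewrite ge0_fin_numE.
apply: (le_trans (@upper_capD R X hX lX sX G kG h k (fun x => h x - k x) _ _ _)) => //.
- by move=> x; rewrite sube_ge0 ?kh// kfin.
- by move=> x; rewrite addeC subeK.
apply: leeD; last exact: ltW.
apply: (@le_trans _ _ (cap_H0 G k)); first exact: upper_cap_le_H0.
by apply: ereal_sup_ubound; exists k.
Qed.

Lemma upper_cap_lt_potential f (a : \bar R) : upper_cap G f < a ->
  exists lam, [/\ finite_energy G lam, enorm G lam <= a & qe G (fun x => f x <= potential G lam x)].
Proof.
move=> /(upper_cap_ltP hX lX sX)[g [Gg fg ga]].
have g0 := cap_C0_ge0 hX lX sX kG Gg.1.
have gfin : cap_C0 G g \is a fin_num by rewrite ge0_fin_numE//; exact: lt_le_trans ga (leey _).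
have [|lam lamE gl] := @lsc_le_potential g (fine (cap_C0 G g)) Gg; first by rewrite fineK.
exists lam; split.
- exact: ball_finite_energy lamE.
- by apply: (le_trans lamE); rewrite fineK// ltW.
- by apply: qe_imp gl => x; exact: le_trans (fg x).
Qed.

Lemma upper_cap_potential lam : finite_energy G lam -> upper_cap G (potential G lam) <= enorm G lam.
Proof.
move=> lamF; apply: (@le_trans _ _ (cap_C0 G (potential G lam))).
  by apply: upper_cap_le_lsc => //; exact: Glsc_potential.
apply: ub_ereal_sup => _ [nu nuE <-].
have nuF : finite_energy G nu := ball_finite_energy nuE.
apply: (le_trans (pG lamF nuF)); rewrite -[leRHS]mule1.
by apply: lee_wpmul2l => //; exact: enorm_ge0.
Qed.

Lemma envelope_le_potential f fs lam : is_envelope G f fs -> finite_energy G lam ->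
  qe G (fun x => f x <= potential G lam x) -> qe G (fun x => fs x <= potential G lam x).
Proof.
by move=> [_ H] lamF fl; apply: H; split => //; exact: potential_quasi_usc.
Qed.

Lemma envelope_cap f fs : is_envelope G f fs -> upper_cap G f < +oo ->
  H0star G fs /\ upper_cap G fs = upper_cap G f.
Proof.
move=> fsE foo; have [[qfs ffs] _] := fsE; have [fs0 _] := qfs; split.
  have [lam [lamF _ fl]] := upper_cap_lt_potential foo.
  exact: quasi_usc_H0star qfs lamF (envelope_le_potential fsE lamF fl).
apply/eqP; rewrite eq_le; apply/andP; split; last exact: qe_le_upper_cap.
rewrite leNgt; apply/negP => /lte_between[a [/upper_cap_lt_potential]].
move=> [lam [lamF lama fl]]; apply/negP; rewrite -leNgt.
apply: le_trans (le_trans (upper_cap_potential lamF) lama).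
apply: qe_le_upper_cap => //; first by move=> x; exact: potential_ge0.
exact: envelope_le_potential fl.
Qed.

Lemma envelope_Gamma f fs : is_envelope G f fs -> Gamma_upper G f = Gamma_upper G fs.
Proof.
move=> fsE; apply/seteqP; split => lam [lamF fl]; split => //.
  exact: envelope_le_potential fl.
have [[_ ffs] _] := fsE; apply: qe_imp (qe_and hX lX sX kG ffs fl) => x [].
exact: le_trans.
Qed.

Lemma rint_le_qe f g nu : finite_energy G nu -> (forall x, 0 <= f x) -> (forall x, 0 <= g x) ->
  qe G (fun x => f x <= g x) -> rint nu f <= rint nu g.
Proof.
move=> nuF f0 g0 [E E0 fg]; have [N [mN EN N0]] := null_negligible hX lX sX kG nuF E0.
by apply: (lint_null mN N0) => // x nN; apply: fg => /EN.
Qed.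

Lemma ae_qe_trans (P Q : X -> Prop) mu : finite_energy G mu -> qe G (fun x => P x -> Q x) ->
  {ae (mu : {measure set (borel X) -> \bar R}), forall x, P x} ->
  {ae (mu : {measure set (borel X) -> \bar R}), forall x, Q x}.
Proof.
move=> muF [E E0 PQ] aeP; have [N [mN EN N0]] := null_negligible hX lX sX kG muF E0.
apply: (@negligibleS _ _ _ mu (~` [set x | P x] `|` E)).
  move=> x /= nQ; case: (pselect (E x)) => [|nE]; [by right|left => Px].
  by apply: nQ; exact: PQ.
by apply: negligibleU => //; exists N.
Qed.

(** Two envelopes agree q.e., hence almost everywhere for measures of finite energy. Forward,
    [int fs dnu <= |mu| |nu|] and [|mu|^2 <= int fs dmu] give maximality by completing the square.
    Backward, [fs <= G mu] q.e. while [int G mu dmu <= c^2 <= int fs dmu], the equality case. *)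
Lemma envelope_capacitary f f0 fs : Fplus f -> upper_cap G f < +oo ->
  is_envelope G f f0 -> is_envelope G f fs -> M_upper G f f0 = M_cap G fs.
Proof.
move=> fp foo f0E fsE; have [Hfs fscap] := envelope_cap fsE foo.
have [[qfs ffs] fsmin] := fsE; have [[qf0 ff0] f0min] := f0E.
have [fs0 _] := qfs.
have p0 (m : radon R X) x := potential_ge0 kG m x.
apply/seteqP; split => mu.
  move=> [muF fmu aef0]; have fsmu := envelope_le_potential fsE muF fmu.
  have [N [mN N0 NP]] : {ae (mu : {measure set (borel X) -> \bar R}),
      forall x, potential G mu x <= fs x}.
    apply: ae_qe_trans aef0 => //; apply: qe_imp (f0min _ (conj qfs ffs)) => x f0fs pf0.
    exact: le_trans pf0 f0fs.
  have mufs : rint mu (potential G mu) <= rint mu fs.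
    apply: (lint_null mN N0) => // x nN.
    by apply: contrapT => npf; apply: nN; exact: NP.
  split => // nu nuF.
  have bound (m : radon R X) : finite_energy G m -> rint m fs <= enorm G mu * enorm G m.
    by move=> mF; apply: le_trans (pG muF mF); exact: rint_le_qe.
  have [m m0 hm] := enorm_fin muF; have [n n0 hn] := enorm_fin nuF.
  have fin (r : radon R X) (d : R) : enorm G r = d%:E -> finite_energy G r ->
      rint r fs = (fine (rint r fs))%:E.
    move=> hr rF; rewrite fineK// ge0_fin_numE; last exact: lint_ge0.
    by apply: le_lt_trans (bound _ rF) _; rewrite hm hr -EFinM ltry.
  move: mufs (bound _ nuF); rewrite -(enorm_sqr kG) (fin _ _ hm muF) (fin _ _ hn nuF).
  rewrite hm hn -!EFin_expe -!EFinM -!EFinB !lee_fin => am bn.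
  have := sqr_ge0 (m - n); rewrite sqrrB; nra.
move=> muM; have [muF _] := muM.
have cfin : cap_C0 G fs \is a fin_num.
  rewrite ge0_fin_numE; last exact: (cap_C0_ge0 hX lX sX kG).
  by apply: le_lt_trans (cap_C0_le_upper fs0) _; rewrite fscap.
have hc := esym (fineK cfin).
have c0 : (0 <= fine (cap_C0 G fs))%R.
  by apply: fine_ge0; exact: (cap_C0_ge0 hX lX sX kG).
have [muc cmu] := (M_capP hX lX sX kG mu Hfs hc).1 muM.
have fsmu : qe G (fun x => fs x <= potential G mu x).
  apply: qe_le_potential => // nu nuF.
  exact: (M_cap_variation hX lX sX kG pG Hfs hc muM nuF).
have muE : rint mu (potential G mu) <= (fine (cap_C0 G fs) ^+ 2)%:E by rewrite -enorm_le.
split => //.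
  by apply: qe_imp (qe_and hX lX sX kG ffs fsmu) => x []; exact: le_trans.
have [E E0 Efs] := fsmu; have [N [mN EN N0]] := null_negligible hX lX sX kG muF E0.
have [|||N' [mN' N'0 N'P]] := @lint_le_ae mu N fs (potential G mu) mN N0 _ fs0 (p0 mu)
    (@potential_measurable R X hX lX sX G kG mu).
- by move=> x nN; apply: Efs => /EN.
- exact: le_lt_trans muE (ltry _).
- exact: le_trans muE cmu.
apply: (@ae_qe_trans (fun x => potential G mu x <= fs x)) => //.
  by apply: qe_imp (fsmin _ (conj qf0 ff0)) => x fsf0 pfs; exact: le_trans pfs fsf0.
exists N'; split => // x /= npf; apply: contrapT => nN'; exact: npf (N'P _ nN').
Qed.

End EnvelopeCapacity.

Local Open Scope ereal_scope.

Unset Implicit Arguments.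

(* [f0] is the chosen envelope entering the definition of the upper capacitary
   measures for [f]; [fs] is the arbitrary envelope of the theorem. *)
Theorem theorem3p19 (R : realType) (X : ptopologicalType)
    (G : X * X -> \bar R) (f f0 fs : X -> \bar R) :
  hausdorff_space X -> locally_compact [set: X] -> @second_countable X ->
  is_kernel G -> consistent G -> positive_definite G ->
  Fplus f -> upper_cap G f < +oo ->
  is_envelope G f f0 -> is_envelope G f fs ->
  [/\ H0star G fs /\ has_cap G fs (upper_cap G f),
      Lambda_upper G f = Lambda_upper G fs,
      M_upper G f f0 = M_cap G fs &
      [/\ M_cap G fs !=set0, compact (M_cap G fs) & convex_radon (M_cap G fs)]].
Proof.
move=> hX lX sX kG cG pG fp foo f0E fsE.
have [Hfs fscap] := envelope_cap hX lX sX kG cG pG fsE foo.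
have [fs0 _] := Hfs.
have cfin : cap_C0 G fs \is a fin_num.
  rewrite ge0_fin_numE; last exact: (cap_C0_ge0 hX lX sX kG).
  by apply: (@le_lt_trans _ _ (upper_cap G fs)); [exact: cap_C0_le_upper|rewrite fscap].
have hc := esym (fineK cfin).
split.
- by split => //; split => //; rewrite H0star_cap.
- by rewrite /Lambda_upper /gamma_upper (envelope_Gamma hX lX sX kG cG fsE).
- exact: envelope_capacitary.
split; [exact: M_cap_nonempty hc|exact: M_cap_compact hc|exact: M_cap_convex hc].
Qed.
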